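(* Let $G$ be a group, $(H,\boldsymbol g)$ a finite type pivotal Hopf $G$-coalgebra over a field $\Bbbk$, and $\boldsymbol\alpha$ the modulus of $H_1$. Then the space of right module traces on $(H\text{-pmod},R(\boldsymbol\alpha)_* )$ is equal to the space of $\boldsymbol\alpha$-symmetrised right $G$-integrals, and is thus one-dimensional. Furthermore, the (nonzero) module trace $\mathsf t$ is non-degenerate, and it is determined by the corresponding $\boldsymbol\alpha$-symmetrised right $G$-integral $\hat{\boldsymbol\mu}$ via $$\mathsf t_{H_x}(f)=\hat{\boldsymbol\mu}_x\bigl(f(1_x)\bigr),\qquad f\in\mathrm{Hom}_{H_x}\bigl(H_x,R(\boldsymbol\alpha)_*(H_x)\bigr),\quad x\in G.$$ Similarly, the space of left module traces on $(H\text{-pmod},L(\boldsymbol\alpha)_* )$ is determined by the $\boldsymbol\alpha$-symmetrised left $G$-integrals $\hat{\boldsymbol\mu}^l$ via $$\mathsf t_{H_x}(f)=\hat{\boldsymbol\mu}^l_x\bigl(f(1_x)\bigr),\qquad f\in\mathrm{Hom}_{H_x}\bigl(H_x,L(\boldsymbol\alpha)_*(H_x)\bigr),\quad x\in G.$$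
   Context: A Hopf $G$-coalgebra is a family of $\Bbbk$-algebras $\{(H_x,m_x,1_x)\}_{x\in G}$ with algebra maps $\Delta_{x,y}\colon H_{xy}\to H_x\otimes H_y$ and $\varepsilon\colon H_1\to\Bbbk$ and linear maps $S_x\colon H_x\to H_{x^{-1}}$ such that $(\Delta_{x,y}\otimes\mathrm{id})\Delta_{xy,z}=(\mathrm{id}\otimes\Delta_{y,z})\Delta_{x,yz}$, $(\mathrm{id}\otimes\varepsilon)\Delta_{x,1}=\mathrm{id}_{H_x}=(\varepsilon\otimes\mathrm{id})\Delta_{1,x}$, and $m_x(S_{x^{-1}}\otimes\mathrm{id})\Delta_{x^{-1},x}=1_x\varepsilon=m_x(\mathrm{id}\otimes S_{x^{-1}})\Delta_{x,x^{-1}}$. It is of finite type if every $H_x$ is finite-dimensional. $H_1$ is a Hopf algebra. It is pivotal with pivot $\boldsymbol g=(\boldsymbol g_x)\in\prod_x H_x$ if $\Delta_{x,y}(\boldsymbol g_{xy})=\boldsymbol g_x\otimes\boldsymbol g_y$, $\varepsilon(\boldsymbol g_1)=1$ and $S_{x^{-1}}S_x(a)=\boldsymbol g_x a\boldsymbol g_x^{-1}$ for all $a\in H_x$. $H$-mod is the $G$-graded category $\bigoplus_x H_x\text{-mod}$ (finite-dimensional left modules; objects are finite direct sums of $H_x$-modules for various $x$, with no nonzero morphisms between different degrees). For $V\in H_x$-mod, $W\in H_y$-mod, $V\otimes W$ is an $H_{xy}$-module via $\Delta_{x,y}$. $H$-pmod is the full subcategory of projective objects. For $V\in H_x$-mod,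 $V^*$ is an $H_{x^{-1}}$-module via $(h\xi)(v)=\xi(S_{x^{-1}}(h)v)$, and $\mathrm{ev}_V(\xi\otimes v)=\xi(v)$, $\mathrm{coev}_V(1)=\sum v_i\otimes v_i^*$, $\widetilde{\mathrm{ev}}_V(v\otimes\xi)=\xi(\boldsymbol g_xv)$, $\widetilde{\mathrm{coev}}_V(1)=\sum v_i^*\otimes\boldsymbol g_x^{-1}v_i$ for a basis $\{v_i\}$. Modulus: if $\boldsymbol c\in H_1$ is a nonzero left cointegral ($a\boldsymbol c=\varepsilon(a)\boldsymbol c$), then $\boldsymbol\alpha\in H_1^*$ is the group-like functional (algebra map) with $\boldsymbol c a=\boldsymbol\alpha(a)\boldsymbol c$ for all $a\in H_1$. For group-like $\nu\in H_1^*$ define algebra automorphisms of each $H_x$: $R(\nu)=(\nu\otimes\mathrm{id})\Delta_{1,x}$ and $L(\nu)=(\mathrm{id}\otimes\nu)\Delta_{x,1}$. For a family of algebra automorphisms $\varphi_x$ of $H_x$, the twist functor $\varphi_*$ sends an $H_x$-module $V$ to the same vector space with action $a\cdot_\varphi v=\varphi_x(a)v$, and is the identity on morphisms. $R(\nu)_*$ is a right module endofunctor ($R(\nu)_*(P\otimes V)=R(\nu)_*(P)\otimes V$) and $L(\nu)_*$ a left one ($L(\nu)_*(V\otimes P)=V\otimes L(\nu)_*(P)$), with identity structure maps. $G$-integrals: a right $G$-integral is a family $\boldsymbol\mu=(\boldsymbol\mu_x)\in\prod_xH_x^*$ with $(\boldsymbol\mu_x\otimes\mathrm{id})\Delta_{x,y}(a)=\boldsymbol\mu_{xy}(a)1_y$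 for all $x,y\in G$, $a\in H_{xy}$; a left $G$-integral $\boldsymbol\mu^l$ satisfies $(\mathrm{id}\otimes\boldsymbol\mu^l_y)\Delta_{x,y}(a)=\boldsymbol\mu^l_{xy}(a)1_x$. The $\boldsymbol\alpha$-symmetrised right $G$-integral is $\hat{\boldsymbol\mu}_x(a)=\boldsymbol\mu_x(\boldsymbol g_xa)$, and the $\boldsymbol\alpha$-symmetrised left $G$-integral is $\hat{\boldsymbol\mu}^l_x(a)=\boldsymbol\mu^l_x(\boldsymbol g_x^{-1}a)$. A right module trace on $(H\text{-pmod},\Sigma)$ with $\Sigma=R(\boldsymbol\alpha)_*$ is a family of linear maps $\{\mathsf t_P\colon\mathrm{Hom}_H(P,\Sigma P)\to\Bbbk\}_{P\in H\text{-pmod}}$ with (1) $\mathsf t_P(f\circ g)=\mathsf t_{P'}(\Sigma(g)\circ f)$ for all $g\colon P\to P'$, $f\colon P'\to\Sigma P$; (2) $\mathsf t_{P\otimes V}(f)=\mathsf t_P\bigl((\mathrm{id}\otimes\widetilde{\mathrm{ev}}_V)(f\otimes\mathrm{id}_{V^*})(\mathrm{id}_P\otimes\mathrm{coev}_V)\bigr)$ for all $P\in H$-pmod, $V\in H$-mod, $f\colon P\otimes V\to\Sigma(P\otimes V)=\Sigma(P)\otimes V$. A left module trace (with $\Sigma=L(\boldsymbol\alpha)_*$) satisfies (1) and instead $\mathsf t_{V\otimes P}(f)=\mathsf t_P\bigl((\mathrm{ev}_V\otimes\mathrm{id})(\mathrm{id}_{V^*}\otimes f)(\widetilde{\mathrm{coev}}_V\otimes\mathrm{id}_P)\bigr)$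 for all $f\colon V\otimes P\to\Sigma(V\otimes P)=V\otimes\Sigma(P)$. A trace $\mathsf t$ is non-degenerate if all pairings $\mathrm{Hom}_H(P',\Sigma P)\times\mathrm{Hom}_H(P,P')\to\Bbbk$, $(f,g)\mapsto\mathsf t_P(f\circ g)$, are non-degenerate. *)

(* Defs.v *)
From HB Require Import structures.
From mathcomp Require Import all_boot all_order all_fingroup all_algebra.
Set Implicit Arguments. Unset Strict Implicit. Unset Printing Implicit Defensive.
Import GRing.Theory.
Local Open Scope ring_scope.

Section Tensor.
Variable K : fieldType.

(* A tensor is represented by its coordinate matrix in the canonical bases. *)
Definition tensor (V W : vectType K) : vectType K :=
  'M[K]_(\dim {:V}, \dim {:W}).

Definition bas (V : vectType K) (i : 'I_(\dim {:V})) : V := (vbasis {:V})`_i.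
Definition cobas (V : vectType K) (i : 'I_(\dim {:V})) : 'Hom(V, K^o) :=
  linfun (coord (vbasis {:V}) i : V -> K^o).

Definition tens (V W : vectType K) (v : V) (w : W) : tensor V W :=
  \matrix_(i, j) (cobas i v * cobas j w).

Definition tlift_fun (V W U : vectType K) (b : V -> W -> U) (t : tensor V W) : U :=
  \sum_i \sum_j t i j *: b (bas i) (bas j).

(* The linear map V (x) W -> U induced by a bilinear map b : V -> W -> U
   (see [tlift_tens]); b is only ever taken bilinear. *)
Definition tlift (V W U : vectType K) (b : V -> W -> U) : 'Hom(tensor V W, U) :=
  linfun (tlift_fun b).

Lemma tlift_fun_is_linear (V W U : vectType K) (b : V -> W -> U) : linear (tlift_fun b).
Proof.
move=> k s t; rewrite /tlift_fun scaler_sumr -big_split /=; apply: eq_bigr => i _.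
rewrite scaler_sumr -big_split /=; apply: eq_bigr => j _.
by rewrite !mxE scalerDl scalerA.
Qed.
HB.instance Definition _ (V W U : vectType K) (b : V -> W -> U) :=
  GRing.isLinear.Build K (tensor V W) U _ (tlift_fun b) (tlift_fun_is_linear b).

Lemma tliftE (V W U : vectType K) (b : V -> W -> U) (t : tensor V W) :
  tlift b t = \sum_i \sum_j t i j *: b (bas i) (bas j).
Proof. by rewrite lfunE. Qed.

Lemma bas_sum (V : vectType K) (v : V) : v = \sum_i cobas i v *: bas i.
Proof.
rewrite {1}(coord_vbasis (memvf v)); apply: eq_bigr => i _.
by rewrite lfunE.
Qed.

Lemma cobas_bas (V : vectType K) (i j : 'I_(\dim {:V})) :
  cobas i (bas j) = (j == i)%:R.
Proof. by rewrite lfunE /= coord_free ?(basis_free (vbasisP _)). Qed.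

Definition bilin (V W U : vectType K) (b : V -> W -> U) : Prop :=
  (forall w, linear (b^~ w)) /\ (forall v, linear (b v)).

Lemma linear_sumZ (V U : vectType K) (f : V -> U) (I : finType) (c : I -> K) (v : I -> V) :
  linear f -> f (\sum_i c i *: v i) = \sum_i c i *: f (v i).
Proof.
move=> lf.
have f0 : f 0 = 0 by have := lf (-1) 0 0; rewrite scaler0 addr0 scaleN1r addNr.
elim/big_rec2: _ => [//|i y1 y2 _ <-]; exact: lf.
Qed.

Lemma tlift_tens (V W U : vectType K) (b : V -> W -> U) (v : V) (w : W) :
  bilin b -> tlift b (tens v w) = b v w.
Proof.
case=> bl br; rewrite tliftE {2}(bas_sum v) (linear_sumZ _ _ (bl w)).
apply: eq_bigr => i _; rewrite {2}(bas_sum w) (linear_sumZ _ _ (br _)) scaler_sumr.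
by apply: eq_bigr => j _; rewrite mxE scalerA.
Qed.

Lemma tens_bilin (V W : vectType K) : bilin (@tens V W).
Proof.
split=> [w k u v|v k u w]; apply/matrixP=> i j; rewrite !mxE linearP /=.
  by rewrite mulrDl mulrA.
by rewrite mulrDr mulrCA.
Qed.

Lemma tens_span (V W : vectType K) (t : tensor V W) : t = \sum_i \sum_j t i j *: tens (bas i) (bas j).
Proof.
apply/matrixP=> i j; rewrite summxE (bigD1 i) //= summxE (bigD1 j) //= !mxE.
rewrite !cobas_bas !eqxx !mulr1 !big1 ?addr0 // => [k /negPf ki|k /negPf kj].
  by rewrite summxE big1 // => l _; rewrite !mxE !cobas_bas ki mul0r mulr0.
by rewrite !mxE !cobas_bas kj mulr0 mulr0.
Qed.

Lemma tensor_ext (V W U : vectType K) (f g : 'Hom(tensor V W, U)) :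
  (forall v w, f (tens v w) = g (tens v w)) -> f = g.
Proof.
move=> fg; apply/lfunP=> t; rewrite (tens_span t) !linear_sum.
by apply: eq_bigr => i _; rewrite !linear_sum; apply: eq_bigr => j _; rewrite !linearZ /= fg.
Qed.

Lemma lfun_lin (V W : vectType K) (f : 'Hom(V, W)) (k : K) (u v : V) :
  f (k *: u + v) = k *: f u + f v.
Proof. exact: linearP. Qed.

Lemma lfun0 (V W : vectType K) (f : 'Hom(V, W)) : f 0 = 0.
Proof. exact: linear0. Qed.

Definition tmap (V V' W W' : vectType K) (f : 'Hom(V, V')) (g : 'Hom(W, W')) :
  'Hom(tensor V W, tensor V' W') := tlift (fun v w => tens (f v) (g w)).

Definition tassoc (U V W : vectType K) :
  'Hom(tensor (tensor U V) W, tensor U (tensor V W)) :=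
  tlift (fun s w => tlift (fun u v => tens u (tens v w)) s).
Definition tassocV (U V W : vectType K) :
  'Hom(tensor U (tensor V W), tensor (tensor U V) W) :=
  tlift (fun u s => tlift (fun v w => tens (tens u v) w) s).

Definition tunitr (V : vectType K) : 'Hom(tensor V K^o, V) :=
  tlift (fun v (c : K^o) => (c : K) *: v).
Definition tunitrV (V : vectType K) : 'Hom(V, tensor V K^o) :=
  linfun (fun v : V => tens v (1 : K^o)).
Definition tunitl (V : vectType K) : 'Hom(tensor K^o V, V) :=
  tlift (fun (c : K^o) v => (c : K) *: v).
Definition tunitlV (V : vectType K) : 'Hom(V, tensor K^o V) :=
  linfun (fun v : V => tens (1 : K^o) v).

Lemma tmap_tens (V V' W W' : vectType K) (f : 'Hom(V, V')) (g : 'Hom(W, W')) v w :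
  tmap f g (tens v w) = tens (f v) (g w).
Proof.
rewrite tlift_tens //; split=> [w' k u u'|v' k u u']; rewrite linearP /=.
  by rewrite (tens_bilin _ _).1.
by rewrite (tens_bilin _ _).2.
Qed.

Lemma tmap1 (V W : vectType K) : tmap (\1%VF : 'End(V)) (\1%VF : 'End(W)) = \1%VF.
Proof. by apply: tensor_ext => v w; rewrite tmap_tens !id_lfunE. Qed.

Lemma tmap_comp (V V' V'' W W' W'' : vectType K) (f' : 'Hom(V', V''))
    (f : 'Hom(V, V')) (g' : 'Hom(W', W'')) (g : 'Hom(W, W')) :
  tmap (f' \o f)%VF (g' \o g)%VF = (tmap f' g' \o tmap f g)%VF.
Proof. by apply: tensor_ext => v w; rewrite comp_lfunE !tmap_tens !comp_lfunE. Qed.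

Lemma tmap_bilin (V V' W W' : vectType K) : bilin (@tmap V V' W W').
Proof.
split=> [g k f f'|f k g g']; apply: tensor_ext => v w;
  rewrite add_lfunE scale_lfunE !tmap_tens add_lfunE scale_lfunE.
  by rewrite (tens_bilin _ _).1.
by rewrite (tens_bilin _ _).2.
Qed.

Lemma tens_ind (V W : vectType K) (P : tensor V W -> Prop) :
  P 0 -> (forall k s t, P s -> P t -> P (k *: s + t)) ->
  (forall v w, P (tens v w)) -> forall t, P t.
Proof.
move=> P0 PD Pt t; rewrite (tens_span t).
have PD' s u : P s -> P u -> P (s + u) by rewrite -{2}(scale1r s); apply: PD.
do 2![apply: big_ind => // ? _]; rewrite -[_ *: _]addr0; exact: PD.
Qed.

End Tensor.

(* Unlike mathcomp's [falgType], the zero algebra is allowed: in a Hopf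
   G-coalgebra some of the H_x may vanish. *)
Record fdAlg (K : fieldType) := FdAlg {
  fdcar :> vectType K;
  amul : fdcar -> fdcar -> fdcar;
  aone : fdcar;
  amul_bilin : bilin amul;
  amulA : associative amul;
  amul1l : left_id aone amul;
  amul1r : right_id aone amul
}.
Arguments aone {K}.
Arguments amul {K f}.

Reserved Notation "a ** b" (at level 40, left associativity).
Notation "a ** b" := (amul a b) : ring_scope.

Section Alg.
Variable K : fieldType.

Definition alg_map (A B : fdAlg K) (f : 'Hom(A, B)) : Prop :=
  f (aone A) = aone B /\ forall a b, f (a ** b) = f a ** f b.

Definition mulmap (A : fdAlg K) : 'Hom(tensor A A, A) := tlift (@amul K A).

Definition lmul_fun (A : fdAlg K) (a : A) : 'End(A) := linfun (amul a).
Definition lmul (A : fdAlg K) : 'Hom(A, 'End(A)) := linfun (@lmul_fun A).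

Lemma linfunE_lin (V W : vectType K) (f : V -> W) : linear f -> linfun f =1 f.
Proof.
move=> lf v; pose F := GRing.isLinear.Build K V W _ f lf.
pose F' : {linear V -> W} := HB.pack f F.
exact: (lfunE F').
Qed.

Lemma lmulE (A : fdAlg K) (a b : A) : lmul A a b = a ** b.
Proof.
have lE c d : lmul_fun c d = c ** d :> A by rewrite linfunE_lin //; exact: (amul_bilin A).2.
rewrite linfunE_lin // => k c d; apply/lfunP=> e.
by rewrite add_lfunE scale_lfunE !lE (amul_bilin A).1.
Qed.

Lemma K_bilin : bilin (fun a b : K^o => (a * b : K^o)).
Proof.
split=> [w k u v|v k u w]; rewrite ?mulrDl ?mulrDr; congr (_ + _).
  exact: (esym (mulrA k u w)).
exact: (@mulrCA K v k u).
Qed.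
Definition groundA : fdAlg K :=
  @FdAlg K K^o _ _ K_bilin (@mulrA K) (@mul1r K) (@mulr1 K).

Lemma End_bilin (V : vectType K) : bilin (fun f g : 'End(V) => (f \o g)%VF).
Proof.
split=> [w k u v|v k u w]; apply/lfunP=> x.
  by rewrite !(add_lfunE, scale_lfunE, comp_lfunE).
by rewrite !(add_lfunE, scale_lfunE, comp_lfunE) linearP.
Qed.
Definition EndA (V : vectType K) : fdAlg K :=
  @FdAlg K 'End(V) _ _ (@End_bilin V) (@comp_lfunA _ _ _ _ _)
    (@comp_lfun1l _ _ _) (@comp_lfun1r _ _ _).

(* (a (x) b)(a' (x) b') = aa' (x) bb', see [tensmul_tens] *)
Definition tensmul (A B : fdAlg K) (s t : tensor A B) : tensor A B :=
  tlift (fun a b => tmap (lmul A a) (lmul B b)) s t.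

Lemma lmap_bilin (A B V W : vectType K) (f : 'Hom(A, 'End(V))) (g : 'Hom(B, 'End(W))) :
  bilin (fun a b => tmap (f a) (g b)).
Proof.
by split=> [w k u v|v k u w]; rewrite linearP; [exact: (tmap_bilin _ _ _ _).1|exact: (tmap_bilin _ _ _ _).2].
Qed.

Lemma tensmul_tens (A B : fdAlg K) (a a' : A) (b b' : B) :
  tensmul (tens a b) (tens a' b') = tens (a ** a') (b ** b').
Proof. by rewrite /tensmul tlift_tens ?tmap_tens ?lmulE //; exact: lmap_bilin. Qed.

Lemma tensmul_bilin (A B : fdAlg K) : bilin (@tensmul A B).
Proof.
split=> [w k u v|v k u w]; rewrite /tensmul linearP //.
by rewrite add_lfunE scale_lfunE.
Qed.

Lemma bilin0 (V W U : vectType K) (b : V -> W -> U) : bilin b ->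
  (forall w, b 0 w = 0) /\ (forall v, b v 0 = 0).
Proof.
by case=> bl br; split=> [w|v]; [have := bl w (-1) 0 0|have := br v (-1) 0 0];
  rewrite scaler0 addr0 scaleN1r addNr.
Qed.

Lemma tensmulA (A B : fdAlg K) : associative (@tensmul A B).
Proof.
have [bl br] := tensmul_bilin A B; have [b0 b1] := bilin0 (tensmul_bilin A B).
move=> r s t; elim/tens_ind: r => [|k r r' IH IH'|a b]; first by rewrite !b0.
  by rewrite !bl IH IH'.
elim/tens_ind: s => [|k s s' IH IH'|a' b']; first by rewrite !(b0, b1).
  by rewrite !(bl, br) IH IH'.
elim/tens_ind: t => [|k t t' IH IH'|a'' b'']; first by rewrite !b1.
  by rewrite !br IH IH'.
by rewrite !tensmul_tens !amulA.
Qed.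

Lemma tensmul1l (A B : fdAlg K) : left_id (tens (aone A) (aone B)) (@tensmul A B).
Proof.
have [bl br] := tensmul_bilin A B; have [b0 b1] := bilin0 (tensmul_bilin A B).
elim/tens_ind => [|k s t IH IH'|a b]; rewrite ?b1 ?br ?IH ?IH' //.
by rewrite tensmul_tens !amul1l.
Qed.

Lemma tensmul1r (A B : fdAlg K) : right_id (tens (aone A) (aone B)) (@tensmul A B).
Proof.
have [bl br] := tensmul_bilin A B; have [b0 b1] := bilin0 (tensmul_bilin A B).
elim/tens_ind => [|k s t IH IH'|a b]; rewrite ?b0 ?bl ?IH ?IH' //.
by rewrite tensmul_tens !amul1r.
Qed.

Definition tensA (A B : fdAlg K) : fdAlg K :=
  FdAlg (tensmul_bilin A B) (@tensmulA A B) (@tensmul1l A B) (@tensmul1r A B).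

Lemma alg_map_comp (A B C : fdAlg K) (f : 'Hom(B, C)) (g : 'Hom(A, B)) :
  alg_map f -> alg_map g -> @alg_map A C (f \o g)%VF.
Proof.
by move=> [f1 fM] [g1 gM]; split=> [|a b]; rewrite !comp_lfunE ?g1 ?gM.
Qed.

Lemma lmul_alg_map (A : fdAlg K) : @alg_map A (EndA A) (lmul A).
Proof.
split=> [|a b]; apply/lfunP=> c; rewrite ?lmulE /= ?id_lfunE ?amul1l //.
by rewrite comp_lfunE !lmulE amulA.
Qed.

Definition tensrep (A B : fdAlg K) (V W : vectType K)
    (f : 'Hom(A, 'End(V))) (g : 'Hom(B, 'End(W))) : 'Hom(tensor A B, 'End(tensor V W)) :=
  tlift (fun a b => tmap (f a) (g b)).

Lemma tensrep_alg_map (A B : fdAlg K) (V W : vectType K)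
    (f : 'Hom(A, 'End(V))) (g : 'Hom(B, 'End(W))) :
  @alg_map A (EndA V) f -> @alg_map B (EndA W) g ->
  @alg_map (tensA A B) (EndA (tensor V W)) (tensrep f g).
Proof.
move=> [f1 fM] [g1 gM]; have [bl br] := tensmul_bilin A B.
have [b0 b1] := bilin0 (tensmul_bilin A B).
have [el er] := End_bilin (tensor V W); have [e0 e1] := bilin0 (End_bilin (tensor V W)).
have tE a b : tensrep f g (tens a b) = tmap (f a) (g b).
  by apply: tlift_tens; exact: lmap_bilin.
split=> /=; first by rewrite tE f1 g1 /= tmap1.
elim/tens_ind=> [t|k s s' IH IH' t|a b].
- by rewrite b0 !lfun0 e0.
- by rewrite bl !lfun_lin IH IH' el.
elim/tens_ind=> [|k s s' IH IH'|a' b'].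
- by rewrite b1 !lfun0 e1.
- by rewrite br !lfun_lin IH IH' er.
by rewrite tensmul_tens !tE fM gM /= tmap_comp.
Qed.

End Alg.

Definition cast (K : fieldType) (G : groupType) (H : G -> fdAlg K) (x y : G)
    (e : x = y) : 'Hom(H x, H y) :=
  ecast z 'Hom(H x, H z) e \1%VF.

(* The components H_x are finite dimensional, so all Hopf G-coalgebras here are
   of finite type.  Group laws only hold propositionally: [cast] identifies
   H_x and H_y when x = y. *)
Record hopfGcoalg (K : fieldType) (G : groupType) := HopfGcoalg {
  hcar :> G -> fdAlg K;
  Delta : forall x y, 'Hom(hcar (x * y)%g, tensA (hcar x) (hcar y));
  eps : 'Hom(hcar 1%g, groundA K);
  Sant : forall x, 'Hom(hcar x, hcar x^-1%g);
  Delta_alg : forall x y, alg_map (Delta x y);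
  eps_alg : alg_map eps;
  Delta_coassoc : forall x y z (a : hcar (x * y * z)%g),
    tassoc _ _ _ (tmap (Delta x y) \1%VF (Delta (x * y)%g z a)) =
    tmap \1%VF (Delta y z) (Delta x (y * z)%g (cast hcar (esym (mulgA x y z)) a));
  counitr : forall x (a : hcar x),
    tunitr _ (tmap \1%VF eps (Delta x 1%g (cast hcar (esym (mulg1 x)) a))) = a;
  counitl : forall x (a : hcar x),
    tunitl _ (tmap eps \1%VF (Delta 1%g x (cast hcar (esym (mul1g x)) a))) = a;
  antipodel : forall x (a : hcar 1%g),
    mulmap _ (tmap (cast hcar (invgK x) \o Sant x^-1%g)%VF \1%VF
      (Delta x^-1%g x (cast hcar (esym (mulVg x)) a))) =
    (eps a : K) *: aone (hcar x);
  antipoder : forall x (a : hcar 1%g),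
    mulmap _ (tmap \1%VF (cast hcar (invgK x) \o Sant x^-1%g)%VF
      (Delta x x^-1%g (cast hcar (esym (mulgV x)) a))) =
    (eps a : K) *: aone (hcar x)
}.

(* The inverse of each g_x is carried along; it is determined by g_x. *)
Record pivot (K : fieldType) (G : groupType) (H : hopfGcoalg K G) := Pivot {
  piv :> forall x, H x;
  pivV : forall x, H x;
  pivKV : forall x, piv x ** pivV x = aone (H x);
  pivVK : forall x, pivV x ** piv x = aone (H x);
  piv_Delta : forall x y, Delta H x y (piv (x * y)%g) = tens (piv x) (piv y);
  piv_eps : eps H (piv 1%g) = (1 : K);
  piv_SS : forall x (a : H x),
    cast H (invgK x) (Sant H x^-1%g (Sant H x a)) = piv x ** a ** pivV x
}.

Section HopfG.
Variables (K : fieldType) (G : groupType) (H : hopfGcoalg K G).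

Definition left_cointegral (c : H 1%g) : Prop :=
  forall a, a ** c = (eps H a : K) *: c.

Record grouplike := Grouplike {
  glfun :> 'Hom(H 1%g, groundA K);
  gl_alg : alg_map glfun
}.

Definition is_modulus (alpha : grouplike) : Prop :=
  exists c : H 1%g, [/\ c != 0, left_cointegral c &
    forall a, c ** a = (alpha a : K) *: c].

Definition gfunctional := forall x : G, 'Hom(H x, K^o).

Definition right_integral (mu : gfunctional) : Prop :=
  forall x y (a : H (x * y)%g),
    tunitl _ (tmap (mu x) \1%VF (Delta H x y a)) = (mu (x * y)%g a : K) *: aone (H y).

Definition left_integral (mu : gfunctional) : Prop :=
  forall x y (a : H (x * y)%g),
    tunitr _ (tmap \1%VF (mu y) (Delta H x y a)) = (mu (x * y)%g a : K) *: aone (H x).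

Definition sym_right_integral (g : pivot H) (m : gfunctional) : Prop :=
  exists2 mu, right_integral mu & forall x a, m x a = mu x (g x ** a).

Definition sym_left_integral (g : pivot H) (m : gfunctional) : Prop :=
  exists2 mu, left_integral mu & forall x a, m x a = mu x (pivV g x ** a).

Record hmod (x : G) := Hmod {
  hmcar :> vectType K;
  hact : 'Hom(H x, 'End(hmcar));
  hact_alg : @alg_map K (H x) (EndA hmcar) hact
}.

Definition hregular (x : G) : hmod x :=
  @Hmod x (H x) (lmul (H x)) (lmul_alg_map (H x)).

Definition htensor (x y : G) (V : hmod x) (W : hmod y) : hmod (x * y)%g :=
  @Hmod _ (tensor V W) (tensrep (hact V) (hact W) \o Delta H x y)%VF
    (alg_map_comp (tensrep_alg_map (hact_alg V) (hact_alg W)) (Delta_alg H x y)).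

Record algendo := Algendo {
  aefun :> forall x, 'End(H x);
  ae_alg : forall x, alg_map (aefun x)
}.

Definition htwist (phi : algendo) (x : G) (V : hmod x) : hmod x :=
  @Hmod _ V (hact V \o phi x)%VF (alg_map_comp (hact_alg V) (ae_alg phi x)).

Lemma cast_alg (x y : G) (e : x = y) : alg_map (cast H e).
Proof. by case: y / e; split=> [|a b]; rewrite /= !id_lfunE. Qed.

Lemma tunitl_alg (A B : fdAlg K) (nu : 'Hom(A, groundA K)) : alg_map nu ->
  @alg_map K (tensA A B) B (tunitl _ \o tmap nu \1)%VF.
Proof.
move=> [n1 nM]; have [bl br] := tensmul_bilin A B.
have [b0 b1] := bilin0 (tensmul_bilin A B).
have [ml mr] := amul_bilin B; have [m0 m1] := bilin0 (amul_bilin B).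
set F := (_ \o _)%VF.
have FE a b : F (tens a b) = (nu a : K) *: b.
  rewrite comp_lfunE tmap_tens id_lfunE tlift_tens //.
  by split=> [w k u v|v k u w]; rewrite ?scalerDl ?scalerA // scalerDr !scalerA mulrC.
split=> /=; first by rewrite FE n1 scale1r.
elim/tens_ind=> [t|k s s' IH IH' t|a b].
- by rewrite b0 !lfun0 m0.
- by rewrite bl !lfun_lin IH IH' ml.
elim/tens_ind=> [|k s s' IH IH'|a' b'].
- by rewrite b1 !lfun0 m1.
- by rewrite br !lfun_lin IH IH' mr.
rewrite tensmul_tens !FE nM /= -[X in _ = X ** _]addr0 -[X in _ = _ ** X]addr0.
by rewrite ml mr m0 m1 !addr0 scalerA.
Qed.

Lemma tunitr_alg (A B : fdAlg K) (nu : 'Hom(B, groundA K)) : alg_map nu ->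
  @alg_map K (tensA A B) A (tunitr _ \o tmap \1 nu)%VF.
Proof.
move=> [n1 nM]; have [bl br] := tensmul_bilin A B.
have [b0 b1] := bilin0 (tensmul_bilin A B).
have [ml mr] := amul_bilin A; have [m0 m1] := bilin0 (amul_bilin A).
set F := (_ \o _)%VF.
have FE a b : F (tens a b) = (nu b : K) *: a.
  rewrite comp_lfunE tmap_tens id_lfunE tlift_tens //.
  by split=> [w k u v|v k u w]; rewrite ?scalerDl ?scalerA // scalerDr !scalerA mulrC.
split=> /=; first by rewrite FE n1 scale1r.
elim/tens_ind=> [t|k s s' IH IH' t|a b].
- by rewrite b0 !lfun0 m0.
- by rewrite bl !lfun_lin IH IH' ml.
elim/tens_ind=> [|k s s' IH IH'|a' b'].
- by rewrite b1 !lfun0 m1.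
- by rewrite br !lfun_lin IH IH' mr.
rewrite tensmul_tens !FE nM /= -[X in _ = X ** _]addr0 -[X in _ = _ ** X]addr0.
by rewrite ml mr m0 m1 !addr0 scalerA.
Qed.

Definition Rmap (nu : grouplike) (x : G) : 'End(H x) :=
  (tunitl (H x) \o tmap nu \1 \o (Delta H 1%g x \o cast H (esym (mul1g x))))%VF.
Definition Lmap (nu : grouplike) (x : G) : 'End(H x) :=
  (tunitr (H x) \o tmap \1 nu \o (Delta H x 1%g \o cast H (esym (mulg1 x))))%VF.

Lemma Rmap_alg nu x : alg_map (Rmap nu x).
Proof.
exact: (alg_map_comp (tunitl_alg (H x) (gl_alg nu))
  (alg_map_comp (Delta_alg H 1%g x) (cast_alg (esym (mul1g x))))).
Qed.
Lemma Lmap_alg nu x : alg_map (Lmap nu x).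
Proof.
exact: (alg_map_comp (tunitr_alg (H x) (gl_alg nu))
  (alg_map_comp (Delta_alg H x 1%g) (cast_alg (esym (mulg1 x))))).
Qed.

Definition Rtw (nu : grouplike) : algendo := Algendo (Rmap_alg nu).
Definition Ltw (nu : grouplike) : algendo := Algendo (Lmap_alg nu).

(* An object of H-mod is a finite direct sum of H_x-modules for various x,
   given as a finite family of homogeneous summands. *)
Record hobj := Hobj {
  hidx : finType;
  hdeg : hidx -> G;
  hsum :> forall i, hmod (hdeg i)
}.

(* The matrix of a linear map between the underlying direct sums. *)
Definition hmap (A B : hobj) :=
  forall (i : hidx A) (j : hidx B), 'Hom(A i, B j).

Definition hhom (A B : hobj) (f : hmap A B) : Prop :=
  forall i j,
    (hdeg i <> hdeg j -> f i j = 0) /\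
    (forall (e : hdeg i = hdeg j) (a : H (hdeg i)) (v : A i),
        f i j (hact (A i) a v) = hact (B j) (cast H e a) (f i j v)).

Definition hmap_eq (A B : hobj) (f f' : hmap A B) : Prop :=
  forall i j, f i j = f' i j.
Definition hcomp (A B C : hobj) (f : hmap B C) (g : hmap A B) : hmap A C :=
  fun i k => \sum_j (f j k \o g i j)%VF.
Definition hzero (A B : hobj) : hmap A B := fun i j => 0.
Arguments hzero A B : clear implicits.
Definition hlincomb (A B : hobj) (k : K) (f f' : hmap A B) : hmap A B :=
  fun i j => k *: f i j + f' i j.

Definition epi (A B : hobj) (p : hmap A B) : Prop :=
  forall (C : hobj) (f f' : hmap B C), hhom f -> hhom f' ->
    hmap_eq (hcomp f p) (hcomp f' p) -> hmap_eq f f'.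

Definition projective (P : hobj) : Prop :=
  forall (A B : hobj) (p : hmap A B) (f : hmap P B), hhom p -> epi p -> hhom f ->
    exists2 q : hmap P A, hhom q & hmap_eq (hcomp p q) f.

Definition otensor (A B : hobj) : hobj :=
  @Hobj (hidx A * hidx B)%type _ (fun ij => htensor (A ij.1) (B ij.2)).

Definition otwist (phi : algendo) (A : hobj) : hobj :=
  Hobj (fun i => htwist phi (A i)).
Definition otwist_map (phi : algendo) (A B : hobj) (f : hmap A B) :
  hmap (otwist phi A) (otwist phi B) := f.

Definition oregular (x : G) : hobj := @Hobj unit _ (fun=> hregular x).

Section Duality.
Variable g : pivot H.

Definition dual (V : vectType K) : vectType K := 'Hom(V, K^o).

Definition ev (x : G) (V : hmod x) : 'Hom(tensor (dual V) V, K^o) :=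
  tlift (fun (xi : dual V) v => xi v).
Definition coev (x : G) (V : hmod x) : 'Hom(K^o, tensor V (dual V)) :=
  linfun (fun c : K^o => (c : K) *: \sum_i tens (bas i) (cobas i : dual V)).
Definition evt (x : G) (V : hmod x) : 'Hom(tensor V (dual V), K^o) :=
  tlift (fun v (xi : dual V) => xi (hact V (g x) v)).
Definition coevt (x : G) (V : hmod x) : 'Hom(K^o, tensor (dual V) V) :=
  linfun (fun c : K^o =>
    (c : K) *: \sum_i tens (cobas i : dual V) (hact V (pivV g x) (bas i))).

(* (id (x) evt_V) (f (x) id_{V^*}) (id_A (x) coev_V) *)
Definition rptrace1 (A B : vectType K) (x : G) (V : hmod x)
    (f : 'Hom(tensor A V, tensor B V)) : 'Hom(A, B) :=
  (tunitr B \o tmap \1 (evt V) \o tassoc B V (dual V) \o tmap f \1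
   \o tassocV A V (dual V) \o tmap \1 (coev V) \o tunitrV A)%VF.

(* (ev_V (x) id) (id_{V^*} (x) f) (coevt_V (x) id_A) *)
Definition lptrace1 (A B : vectType K) (x : G) (V : hmod x)
    (f : 'Hom(tensor V A, tensor V B)) : 'Hom(A, B) :=
  (tunitl B \o tmap (ev V) \1 \o tassocV (dual V) V B \o tmap \1 f
   \o tassoc (dual V) V A \o tmap (coevt V) \1 \o tunitlV A)%VF.

(* For V the direct sum of the V_k, (co)evaluations of V are supported on the
   blocks V_k (x) V_k^* (resp. V_k^* (x) V_k), so the partial trace over V is
   the sum over k of the partial traces over V_k of the (k, k) blocks. *)
Definition rptrace (A B V : hobj) (f : hmap (otensor A V) (otensor B V)) : hmap A B :=
  fun i j => \sum_k (@rptrace1 (A i) (B j) _ (V k) (f (i, k) (j, k))).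
Definition lptrace (A B V : hobj) (f : hmap (otensor V A) (otensor V B)) : hmap A B :=
  fun i j => \sum_k (@lptrace1 (A i) (B j) _ (V k) (f (k, i) (k, j))).

(* A family of functions t_P : Hom_H(P, Sigma P) -> K, P projective, is given by
   functions on all maps of all objects; only the values on H-linear maps of
   projective objects are meaningful, and families are compared by [tr_eq]. *)
Definition trfamily (phi : algendo) :=
  forall P : hobj, hmap P (otwist phi P) -> K.

Definition tr_eq (phi : algendo) (t t' : trfamily phi) : Prop :=
  forall P (f : hmap P (otwist phi P)), projective P -> hhom f -> t P f = t' P f.
Definition tr_zero (phi : algendo) : trfamily phi := fun _ _ => 0.
Arguments tr_zero phi P f : clear implicits.
Definition tr_lincomb (phi : algendo) (k : K) (t t' : trfamily phi) : trfamily phi :=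
  fun P f => k * t P f + t' P f.

Definition tr_linear (phi : algendo) (t : trfamily phi) : Prop :=
  forall P (k : K) (f f' : hmap P (otwist phi P)), projective P -> hhom f -> hhom f' ->
    t P (hlincomb k f f') = k * t P f + t P f'.

Definition tr_cyclic (phi : algendo) (t : trfamily phi) : Prop :=
  forall P P' (g : hmap P P') (f : hmap P' (otwist phi P)),
    projective P -> projective P' -> hhom g -> hhom f ->
    t P (hcomp f g) = t P' (hcomp (otwist_map g) f).

(* R(nu)_*(P (x) V) = R(nu)_*(P) (x) V and L(nu)_*(V (x) P) = V (x) L(nu)_*(P):
   both sides have the same underlying spaces, so that f below can be read as a
   map into the right-hand side. *)
Definition right_module_trace (nu : grouplike) (t : trfamily (Rtw nu)) : Prop :=
  [/\ tr_linear t, tr_cyclic t &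
    forall (P V : hobj) (f : hmap (otensor P V) (otwist (Rtw nu) (otensor P V))),
      projective P -> hhom f ->
      t (otensor P V) f = t P (@rptrace P (otwist (Rtw nu) P) V f)].

Definition left_module_trace (nu : grouplike) (t : trfamily (Ltw nu)) : Prop :=
  [/\ tr_linear t, tr_cyclic t &
    forall (P V : hobj) (f : hmap (otensor V P) (otwist (Ltw nu) (otensor V P))),
      projective P -> hhom f ->
      t (otensor V P) f = t P (@lptrace P (otwist (Ltw nu) P) V f)].

Definition tr_nondegenerate (phi : algendo) (t : trfamily phi) : Prop :=
  forall P P', projective P -> projective P' ->
    (forall f : hmap P' (otwist phi P), hhom f ->
       (forall g : hmap P P', hhom g -> t P (hcomp f g) = 0) -> hmap_eq f (hzero _ _)) /\
    (forall g : hmap P P', hhom g ->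
       (forall f : hmap P' (otwist phi P), hhom f -> t P (hcomp f g) = 0) ->
       hmap_eq g (hzero _ _)).

Definition tr_formula (phi : algendo) (t : trfamily phi) (m : gfunctional) : Prop :=
  forall x (f : hmap (oregular x) (otwist phi (oregular x))), hhom f ->
    t (oregular x) f = m x (f tt tt (aone (H x))).

(* [tr_formula] defines a linear isomorphism F from the space I of families of
   functionals onto the space T of traces, a trace in T being determined by the
   corresponding family. *)
Definition tr_iso (phi : algendo) (T : trfamily phi -> Prop) (I : gfunctional -> Prop) : Prop :=
  exists F : gfunctional -> trfamily phi,
    [/\ forall m, I m -> T (F m) /\ tr_formula (F m) m,
        forall k m m', I m -> I m' ->
          tr_eq (F (fun x => k *: m x + m' x)) (tr_lincomb k (F m) (F m')),
        forall m m', I m -> I m' -> tr_eq (F m) (F m') -> forall x, m x = m' x,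
        forall t, T t -> exists2 m, I m & tr_eq t (F m) &
        forall m t, I m -> T t -> tr_formula t m -> tr_eq t (F m)].

Definition tr_one_dimensional (phi : algendo) (T : trfamily phi -> Prop) : Prop :=
  exists t0, [/\ T t0, ~ tr_eq t0 (tr_zero phi) &
    forall t, T t -> exists k : K, tr_eq t (tr_lincomb k t0 (tr_zero phi))].

Definition int_one_dimensional (I : gfunctional -> Prop) : Prop :=
  exists m0, [/\ I m0, ~ (forall x, m0 x = 0) &
    forall m, I m -> exists k : K, forall x, m x = k *: m0 x].

End Duality.
End HopfG.

Arguments tr_zero {K G H} phi P f.

(* Main.v *)
Require Import Defs.
From mathcomp Require Import all_boot all_order all_fingroup all_algebra.
From Stdlib Require Import ClassicalEpsilon FunctionalExtensionality.
Set Implicit Arguments. Unset Strict Implicit. Unset Printing Implicit Defensive.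
Import GRing.Theory.
Local Open Scope ring_scope.

(** Both spaces of traces are compared with families of functionals on the
    regular modules, and everything about integrals is read off from the left
    cointegral [c] of [H_1] that defines the modulus.

    Write [Delta_{x,x^-1}(c) = c_1 (x) c_2].  The antipode axioms turn the
    invariance of [c] under left multiplication and its behaviour under right
    multiplication into the exchange rules
      [c_1 (x) a c_2 = S(a) c_1 (x) c_2]  and
      [c_1 a (x) c_2 = c_1 (x) c_2 S(R(alpha)(a))]
    ([coint_left], [coint_right]).  By the first rule the image of the map
    [f |-> f(c_1) c_2] from functionals on [H_x] to [H_{x^-1}] is a left ideal.
    It contains [1 = f(c_1) S(c_2) c_3] for any [f] with [f(c) = 1], so the map is
    onto, and it is bijective because the antipode makes [H_x] and [H_{x^-1}]
    equidimensional ([cpair_one], [cpair_inj]).  Identities between functionals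
    can therefore be tested on [c]: the preimages of the units form a right
    integral, every right integral is a multiple of it, the exchange rules give
    the Nakayama automorphism [mu(ab) = mu(g R(alpha)(b) g^-1 a)], and the forms
    [(a, b) |-> mu_x(ab)] are non-degenerate.

    A module is projective exactly if it has a dual basis [(e_j, s_j)].  For a
    linear and cyclic family [t], inserting [v = sum_j s_j(v) e_j] yields
    [t(f) = sum_j m(s_j(f(e_j)))], where [m_x(a)] is the value of [t] at the map
    [h |-> phi(h) a] on the regular module ([tr_ftrace]).  Conversely this formula
    defines a cyclic family as soon as [m(ab) = m(phi(b) a)] ([ftrace_cyclic]),
    which for a symmetrised integral is the Nakayama formula.  Finally
    [H_x (x) W] is free over [H_xy] on the vectors [1 (x) w_j], with coordinates
    given by [a_1] and the action of [S(a_2)].  In this dual basis compatibility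
    with partial traces becomes [m_xy(a_1) S(a_2) = m_x(a) g_y], which is the
    integral condition for [mu = m(g^-1 -)] with the antipode applied to it
    ([tact_trace], [sym_rint_of_traces]).  A nonzero map is detected by composing
    it with a map of rank one over the algebra, which reduces non-degeneracy of
    the trace to that of the forms.

    Left traces and left integrals are right ones for the co-opposite, which is
    graded by the opposite group; for this the group law is a parameter below. *)

(** * Multilinear calculus on tensors *)

Reserved Notation "\sw_ ( u , v <- t ) E"
  (at level 41, E at level 41, u name, v name, t at level 41,
   format "'[' \sw_ ( u ,  v  <-  t ) '/  '  E ']'").
(** Sweedler notation: the sum of [E u v] over the pure tensors of [t]. *)
Notation "\sw_ ( u , v <- t ) E" := (tlift (fun u v => E) t) : ring_scope.

Section Multilinear.
Variable K : fieldType.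
Implicit Types V W U X Y : vectType K.

Definition lin V U (f : V -> U) : Prop :=
  forall k u v, f (k *: u + v) = k *: f u + f v.

Lemma lin_id V : lin (fun v : V => v). Proof. by []. Qed.

Lemma lin_comp V U X (f : U -> X) (h : V -> U) :
  lin f -> lin h -> lin (fun v => f (h v)).
Proof. by move=> lf lh k u v; rewrite lh lf. Qed.

Lemma lin_lfun V U X (L : 'Hom(U, X)) (f : V -> U) :
  lin f -> lin (fun v => L (f v)).
Proof. by move=> lf k u v; rewrite lf linearP. Qed.

Lemma lin_app V U X (f : V -> 'Hom(U, X)) w : lin f -> lin (fun v => f v w).
Proof. by move=> lf k u v; rewrite lf add_lfunE scale_lfunE. Qed.

Lemma lin_mull V (A : fdAlg K) (f : V -> A) b : lin f -> lin (fun v => f v ** b).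
Proof. by move=> lf k u v; rewrite lf (amul_bilin A).1. Qed.

Lemma lin_mulr V (A : fdAlg K) (f : V -> A) b : lin f -> lin (fun v => b ** f v).
Proof. by move=> lf k u v; rewrite lf (amul_bilin A).2. Qed.

Lemma lin_Zr V U (c : K) (f : V -> U) : lin f -> lin (fun v => c *: f v).
Proof. by move=> lf k u v; rewrite lf scalerDr !scalerA mulrC. Qed.

Lemma lin_Zl V U (f : V -> K^o) (w : U) : lin f -> lin (fun v => (f v : K) *: w).
Proof. by move=> lf k u v; rewrite lf scalerDl scalerA. Qed.

Lemma lin_tensl V U X (f : V -> U) (w : X) : lin f -> lin (fun v => tens (f v) w).
Proof. by move=> lf k u v; rewrite lf (tens_bilin _ _).1. Qed.

Lemma lin_tensr V U X (f : V -> U) (w : X) : lin f -> lin (fun v => tens w (f v)).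
Proof. by move=> lf k u v; rewrite lf (tens_bilin _ _).2. Qed.

Lemma lin_sw V U X Y (F : V -> U -> X -> Y) t :
  (forall a b, lin (fun v => F v a b)) -> lin (fun v => \sw_(a, b <- t) F v a b).
Proof.
move=> lF k u v; rewrite !tliftE scaler_sumr -big_split; apply: eq_bigr => i _ /=.
rewrite scaler_sumr -big_split; apply: eq_bigr => j _ /=.
by rewrite lF scalerDr !scalerA mulrC.
Qed.

Lemma lin_sum V U (I : finType) (F : V -> I -> U) :
  (forall i, lin (fun v => F v i)) -> lin (fun v => \sum_i F v i).
Proof.
move=> lF k u v; rewrite scaler_sumr -big_split; apply: eq_bigr => i _; exact: lF.
Qed.

Lemma lin_linfun V U (f : V -> U) : lin f -> linfun f =1 f.
Proof. exact: linfunE_lin. Qed.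

Lemma lin0 V U (f : V -> U) : lin f -> f 0 = 0.
Proof. by move=> lf; have := lf (-1) 0 0; rewrite scaler0 addr0 scaleN1r addNr. Qed.

Lemma linZ V U (f : V -> U) k v : lin f -> f (k *: v) = k *: f v.
Proof. by move=> lf; rewrite -[k *: v]addr0 lf lin0 // addr0. Qed.

Lemma linS V U (f : V -> U) (I : finType) (v : I -> V) :
  lin f -> f (\sum_i v i) = \sum_i f (v i).
Proof.
move=> lf; elim/big_rec2: _ => [|i y1 y2 _ <-]; first exact: lin0.
by rewrite -[v i]scale1r lf !scale1r.
Qed.

Lemma lin_sw_out V W U X (f : U -> X) (F : V -> W -> U) t : lin f ->
  f (\sw_(a, b <- t) F a b) = \sw_(a, b <- t) f (F a b).
Proof.
move=> lf; rewrite !tliftE linS //; apply: eq_bigr => i _.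
by rewrite linS //; apply: eq_bigr => j _; rewrite linZ.
Qed.

Lemma lfun_sw V W U X (L : 'Hom(U, X)) (F : V -> W -> U) t :
  L (\sw_(a, b <- t) F a b) = \sw_(a, b <- t) L (F a b).
Proof. by apply: (lin_sw_out (f := L)); exact: lin_lfun. Qed.

Lemma eq_sw V W U (F F' : V -> W -> U) t :
  (forall a b, F a b = F' a b) -> \sw_(a, b <- t) F a b = \sw_(a, b <- t) F' a b.
Proof. by move=> e; rewrite !tliftE; do 2!apply: eq_bigr => ? _; rewrite e. Qed.

Lemma sw_swap V W V' W' U (F : V -> W -> V' -> W' -> U) t s :
  \sw_(a, b <- t) \sw_(c, d <- s) F a b c d = \sw_(c, d <- s) \sw_(a, b <- t) F a b c d.
Proof.
have E X Y (Z : vectType K) (b : X -> Y -> Z) r :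
    tlift b r = \sum_ij r ij.1 ij.2 *: b (bas ij.1) (bas ij.2).
  by rewrite tliftE pair_bigA.
rewrite !E; under eq_bigr do rewrite E scaler_sumr.
rewrite exchange_big; apply: eq_bigr => pq _ /=.
rewrite E scaler_sumr; apply: eq_bigr => ij _.
by rewrite !scalerA mulrC.
Qed.

Lemma sw_sum V W U (I : finType) (F : I -> V -> W -> U) t :
  \sw_(a, b <- t) \sum_i F i a b = \sum_i \sw_(a, b <- t) F i a b.
Proof.
under [RHS]eq_bigr do rewrite tliftE.
rewrite tliftE [RHS]exchange_big; apply: eq_bigr => p _.
rewrite [RHS]exchange_big; apply: eq_bigr => q _.
by rewrite scaler_sumr.
Qed.

Lemma sw_tens V W U (F : V -> W -> U) v w :
  (forall b, lin (F^~ b)) -> (forall a, lin (F a)) ->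
  \sw_(a, b <- tens v w) F a b = F v w.
Proof. by move=> l1 l2; rewrite tlift_tens. Qed.

Lemma sw_id V W (t : tensor V W) : \sw_(a, b <- t) tens a b = t.
Proof. by rewrite tliftE -tens_span. Qed.

Lemma sw_tmap V V' W W' U (f : 'Hom(V, V')) (h : 'Hom(W, W'))
    (F : V' -> W' -> U) t :
  (forall b, lin (F^~ b)) -> (forall a, lin (F a)) ->
  \sw_(u, v <- tmap f h t) F u v = \sw_(u, v <- t) F (f u) (h v).
Proof. by move=> l1 l2; rewrite /tmap lfun_sw; apply: eq_sw => u v; rewrite sw_tens. Qed.

Lemma mulmapE (B : fdAlg K) t : mulmap B t = \sw_(u, v <- t) u ** v.
Proof. by []. Qed.

Lemma cobas_neq0 V (v : V) : v != 0 -> {k | cobas k v != 0}.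
Proof.
move=> v0; apply: sigW; apply/existsP; apply: contraNT v0 => /existsPn ck.
rewrite (bas_sum v) big1 // => k _; move: (ck k); rewrite negbK => /eqP ->.
by rewrite scale0r.
Qed.

Lemma functional_separation U (V : {vspace U}) u : u \notin V ->
  exists z : 'Hom(U, K^o), (forall v, v \in V -> z v = 0) /\ z u = (1 : K).
Proof.
move=> uV; pose pi : 'End(U) := (\1 - projv V)%VF.
have pE v : pi v = v - projv V v by rewrite add_lfunE opp_lfunE id_lfunE.
have pu : pi u != 0.
  by apply: contraNneq uV => /eqP; rewrite pE subr_eq0 => /eqP ->; rewrite memv_proj.
have [k ck] := cobas_neq0 pu.
pose z : 'Hom(U, K^o) := (cobas k (pi u) : K)^-1 *: (cobas k \o pi)%VF.
have zE v : z v = (cobas k (pi u) : K)^-1 *: cobas k (pi v).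
  by rewrite scale_lfunE comp_lfunE.
exists z; split=> [v vV|]; rewrite zE; last by rewrite /= /GRing.scale /= mulVf.
by rewrite (pE v) projv_id // subrr linear0 scaler0.
Qed.

End Multilinear.

Ltac head_of t := match t with ?f _ => head_of f | _ => t end.
Ltac not_id f := lazymatch f with (fun x => x) => fail | _ => idtac end.
(* The last three cases treat expressions headed by a variable, whose
   multilinearity is a hypothesis; composing with the identity is excluded to
   ensure progress. *)
Ltac lin_step :=
  cbv beta;
  match goal with
  | |- bilin _ => split
  | |- forall _, _ => intro
  | |- GRing.linear_for _ ?f => change (lin f)
  | |- @lin _ _ _ (fun x => x) => apply: lin_id
  | |- @lin _ _ _ (@fun_of_lfun _ _ _ ?L) => exact: (lin_lfun L (@lin_id _ _))
  | |- @lin _ _ _ (@amul _ _ ?b) => exact: (lin_mulr b (@lin_id _ _))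
  | |- @lin _ _ _ (@GRing.scale _ _ ?c) => exact: (lin_Zr c (@lin_id _ _))
  | |- @lin _ _ _ (@tens _ _ _ ?w) => exact: (lin_tensr w (@lin_id _ _))
  | |- @lin _ _ _ (fun x => @fun_of_lfun _ _ _ ?L (@?f x)) => apply: lin_lfun
  | |- @lin _ _ _ (fun x => @fun_of_lfun _ _ _ (@tlift _ _ _ _ (@?b x)) ?t) => apply: lin_sw
  | |- @lin _ _ _ (fun x => @fun_of_lfun _ _ _ (@?f x) ?w) => apply: lin_app
  | |- @lin _ _ _ (fun x => @amul _ _ (@?f x) ?b) => apply: lin_mull
  | |- @lin _ _ _ (fun x => @amul _ _ ?b (@?f x)) => apply: lin_mulr
  | |- @lin _ _ _ (fun x => @GRing.scale _ _ ?c (@?f x)) => apply: lin_Zr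
  | |- @lin _ _ _ (fun x => @GRing.scale _ _ (@?f x) ?w) => apply: (lin_Zl (f := f))
  | |- @lin _ _ _ (fun x => @tens _ _ _ (@?f x) ?w) => apply: lin_tensl
  | |- @lin _ _ _ (fun x => @tens _ _ _ ?w (@?f x)) => apply: lin_tensr
  | |- @lin _ _ _ (fun x => \sum_i (@?F x i)) => apply: lin_sum
  | H : lin _ |- @lin _ _ _ _ => exact: H
  | H : forall _, lin _ |- @lin _ _ _ _ => solve [apply: H]
  | H : forall _ _, lin _ |- @lin _ _ _ _ => solve [apply: H]
  | |- @lin _ _ _ (fun x => ?F (@?f x)) =>
      let h := head_of F in is_var h; not_id f; apply: (lin_comp (f := F) (h := f))
  | |- @lin _ _ _ (fun x => ?F (@?f x) ?b) =>
      let h := head_of F in is_var h; not_id f;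
      apply: (lin_comp (f := fun y => F y b) (h := f))
  | |- @lin _ _ _ (fun x => ?F (@?f x) ?b ?c) =>
      let h := head_of F in is_var h; not_id f;
      apply: (lin_comp (f := fun y => F y b c) (h := f))
  end.
Ltac multilin := repeat lin_step.

(* The summands on the right are left to unification, so that [tac] may rewrite
   below the binders of a Sweedler sum. *)
Ltac under_sw tac :=
  etransitivity; [apply: eq_sw => ? ?; tac; reflexivity | cbv beta].
Ltac under_sw2 tac := under_sw ltac:(under_sw ltac:(tac)).

(** * Pivotal Hopf group-coalgebras with unbiased gradings *)

(** The comultiplication is indexed by all proofs of [gmul x y = z] and the
    antipode by all proofs of [gmul x y = gone], which removes the transports
    along group laws.  The group law is a parameter so that the co-opposite, graded
    by the opposite group, is again such a structure. *)
Record gHopf (K : fieldType) (G : Type) (A : G -> fdAlg K) := GHopf {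
  gmul : G -> G -> G; gone : G; ginv : G -> G;
  gmulA : associative gmul; gmul1g : left_id gone gmul; gmulg1 : right_id gone gmul;
  gmulVg : left_inverse gone ginv gmul; gmulgV : right_inverse gone ginv gmul;
  comul : forall x y z, gmul x y = z -> 'Hom(A z, tensor (A x) (A y));
  counit : 'Hom(A gone, groundA K);
  antip : forall x y, gmul x y = gone -> 'Hom(A x, A y);
  pvt : forall x, A x; pvtV : forall x, A x;
  comulM : forall x y z (e : gmul x y = z) a b,
    comul e (a ** b) = tensmul (comul e a) (comul e b);
  comul1 : forall x y z (e : gmul x y = z), comul e (aone _) = tens (aone _) (aone _);
  counit_alg : alg_map counit;
  comul_coassoc : forall x y z xy yz xyz (e1 : gmul x y = xy) (e2 : gmul xy z = xyz)
      (e3 : gmul y z = yz) (e4 : gmul x yz = xyz) a,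
    \sw_(s, w <- comul e2 a) \sw_(u, v <- comul e1 s) tens u (tens v w) =
    \sw_(u, s <- comul e4 a) \sw_(v, w <- comul e3 s) tens u (tens v w);
  comul_counitr : forall x (e : gmul x gone = x) a,
    \sw_(u, v <- comul e a) (counit v : K) *: u = a;
  comul_counitl : forall x (e : gmul gone x = x) a,
    \sw_(u, v <- comul e a) (counit u : K) *: v = a;
  antip_l : forall x y (e e' : gmul y x = gone) a,
    \sw_(u, v <- comul e a) antip e' u ** v = (counit a : K) *: aone (A x);
  antip_r : forall x y (e : gmul x y = gone) (e' : gmul y x = gone) a,
    \sw_(u, v <- comul e a) u ** antip e' v = (counit a : K) *: aone (A x);
  pvtK : forall x, pvt x ** pvtV x = aone _;
  pvtVK : forall x, pvtV x ** pvt x = aone _;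
  comul_pvt : forall x y z (e : gmul x y = z), comul e (pvt z) = tens (pvt x) (pvt y);
  counit_pvt : counit (pvt gone) = 1;
  antip_antip : forall x y (e : gmul x y = gone) (e' : gmul y x = gone) a,
    antip e' (antip e a) = pvt x ** a ** pvtV x
}.

Section Theory.
Variables (K : fieldType) (G : Type) (A : G -> fdAlg K) (Q : gHopf A).
Notation gmul := (gmul Q).
Notation gone := (gone Q).
Notation ginv := (ginv Q).
Notation "1_ x" := (aone (A x)) (at level 2, x at level 2, format "1_ x").

Implicit Types U V W X : vectType K.

(** ** Sweedler rules *)

(** A trilinear map out of the iterated tensor product factors through the
    comparison of the two bracketings. *)
Lemma sw_coassoc x y z xy yz xyz (e1 : gmul x y = xy) (e2 : gmul xy z = xyz)
    (e3 : gmul y z = yz) (e4 : gmul x yz = xyz) X (F : A x -> A y -> A z -> X) a :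
  (forall v w, lin (fun u => F u v w)) -> (forall u w, lin (fun v => F u v w)) ->
  (forall u v, lin (F u v)) ->
  \sw_(s, w <- comul e2 a) \sw_(u, v <- comul e1 s) F u v w =
  \sw_(u, s <- comul e4 a) \sw_(v, w <- comul e3 s) F u v w.
Proof.
move=> l1 l2 l3.
pose L := tlift (fun u t => \sw_(v, w <- t) F u v w).
have LE u v w : L (tens u (tens v w)) = F u v w.
  by rewrite /L sw_tens ?sw_tens //; multilin.
have /(congr1 L) := comul_coassoc e1 e2 e3 e4 a.
rewrite !lfun_sw => E; etransitivity; last (etransitivity; first exact: E).
  by apply: eq_sw => s w; rewrite lfun_sw; apply: eq_sw => u v; rewrite LE.
by apply: eq_sw => s w; rewrite lfun_sw; apply: eq_sw => u v; rewrite LE.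
Qed.

Lemma sw_mul x y z (e : gmul x y = z) X (F : A x -> A y -> X) a b :
  (forall v, lin (F^~ v)) -> (forall u, lin (F u)) ->
  \sw_(u, v <- comul e (a ** b)) F u v =
  \sw_(u, v <- comul e a) \sw_(p, q <- comul e b) F (u ** p) (v ** q).
Proof.
move=> l1 l2; rewrite comulM /tensmul.
rewrite (lin_sw_out (f := fun M : 'End(tensor _ _) => tlift F (M _))); last by multilin.
apply: eq_sw => u v; rewrite /tmap lfun_sw; apply: eq_sw => p q.
by rewrite sw_tens // !lmulE.
Qed.

Lemma sw_1 x y z (e : gmul x y = z) X (F : A x -> A y -> X) :
  (forall v, lin (F^~ v)) -> (forall u, lin (F u)) ->
  \sw_(u, v <- comul e 1_z) F u v = F 1_x 1_y.
Proof. by move=> l1 l2; rewrite comul1 sw_tens. Qed.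

Lemma sw_counitr x (e : gmul x gone = x) X (f : A x -> X) a : lin f ->
  \sw_(u, v <- comul e a) (counit Q v : K) *: f u = f a.
Proof.
move=> lf; rewrite -{2}(comul_counitr e a) lin_sw_out //.
by apply: eq_sw => u v; rewrite linZ.
Qed.

Lemma sw_counitl x (e : gmul gone x = x) X (f : A x -> X) a : lin f ->
  \sw_(u, v <- comul e a) (counit Q u : K) *: f v = f a.
Proof.
move=> lf; rewrite -{2}(comul_counitl e a) lin_sw_out //.
by apply: eq_sw => u v; rewrite linZ.
Qed.

Lemma sw_antipl x y (e e' : gmul y x = gone) X (f : A x -> X) a : lin f ->
  \sw_(u, v <- comul e a) f (antip e' u ** v) = (counit Q a : K) *: f 1_x.
Proof. by move=> lf; rewrite -linZ // -(antip_l e e') lin_sw_out. Qed.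

Lemma sw_antipr x y (e : gmul x y = gone) (e' : gmul y x = gone) X (f : A x -> X) a : lin f ->
  \sw_(u, v <- comul e a) f (u ** antip e' v) = (counit Q a : K) *: f 1_x.
Proof. by move=> lf; rewrite -linZ // -(antip_r e e') lin_sw_out. Qed.

(** The cancellations [a_1 (x) a_2 S(a_3) = a (x) 1] and its mirror images. *)
Lemma sw_cancel_r x y y' z (e1 : gmul x y = z) (e2 : gmul z y' = x)
    (e' : gmul y' y = gone) X (F : A x -> A y -> X) a :
  gmul y y' = gone ->
  (forall v, lin (F^~ v)) -> (forall u, lin (F u)) ->
  \sw_(s, w <- comul e2 a) \sw_(u, v <- comul e1 s) F u (v ** antip e' w) = F a 1_y.
Proof.
move=> e l1 l2; rewrite (sw_coassoc e1 e2 e (gmulg1 Q x)); try by multilin.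
rewrite -(sw_counitr (gmulg1 Q x) (f := F^~ 1_y)) //.
by apply: eq_sw => u s; rewrite (sw_antipr e e' (f := F u)).
Qed.

Lemma sw_cancel_r' x y y' z (e1 : gmul x y = z) (e2 : gmul z y' = x)
    (e' : gmul y' y = gone) X (F : A z -> A y -> X) a :
  (forall v, lin (F^~ v)) -> (forall u, lin (F u)) ->
  \sw_(s, w <- comul e1 a) \sw_(u, v <- comul e2 s) F u (antip e' v ** w) = F a 1_y.
Proof.
move=> l1 l2; rewrite (sw_coassoc e2 e1 e' (gmulg1 Q z)); try by multilin.
rewrite -(sw_counitr (gmulg1 Q z) (f := F^~ 1_y)) //.
by apply: eq_sw => u s; rewrite (sw_antipl e' e' (f := F u)).
Qed.

Lemma sw_cancel_l x y y' z (e1 : gmul y z = x) (e2 : gmul y' x = z)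
    (e' : gmul y' y = gone) X (F : A y -> A z -> X) a :
  (forall v, lin (F^~ v)) -> (forall u, lin (F u)) ->
  \sw_(u, s <- comul e2 a) \sw_(v, w <- comul e1 s) F (antip e' u ** v) w = F 1_y a.
Proof.
move=> l1 l2; rewrite -(sw_coassoc e' (gmul1g Q z) e1 e2); try by multilin.
rewrite -(sw_counitl (gmul1g Q z) (f := F 1_y)) //.
by apply: eq_sw => s w; rewrite (sw_antipl e' e' (f := F^~ w)).
Qed.

(** ** The antipode *)

Lemma antip1 x y (e : gmul x y = gone) : antip e 1_x = 1_y.
Proof.
have e' : gmul x y = gone by [].
have := antip_l e e 1_gone; rewrite sw_1; try by multilin.
by rewrite amul1r (counit_alg Q).1 scale1r.
Qed.

Lemma antip_pvt x y (e : gmul x y = gone) : antip e (pvt Q x) = pvtV Q y.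
Proof.
have := antip_l e e (pvt Q gone); rewrite comul_pvt sw_tens; try by multilin.
rewrite counit_pvt scale1r => /(congr1 (fun a => a ** pvtV Q y)).
by rewrite -amulA pvtK amul1r amul1l.
Qed.

Lemma comul_pvtV x y z (e : gmul x y = z) : comul e (pvtV Q z) = tens (pvtV Q x) (pvtV Q y).
Proof.
have [m1 m2] := (@tensmul1l _ (A x) (A y), @tensmul1r _ (A x) (A y)).
rewrite -[LHS]m2 -(pvtK Q x) -(pvtK Q y) -tensmul_tens tensmulA -(comul_pvt e) -comulM.
by rewrite pvtVK comul1 m1.
Qed.

Lemma counit_pvtV : counit Q (pvtV Q gone) = 1.
Proof.
have /(congr1 (counit Q)) := pvtK Q gone.
by rewrite (counit_alg Q).2 counit_pvt (counit_alg Q).1 /= mul1r.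
Qed.

Lemma antip_pvtV x y (e : gmul x y = gone) : antip e (pvtV Q x) = pvt Q y.
Proof.
have := antip_l e e (pvtV Q gone); rewrite comul_pvtV sw_tens; try by multilin.
rewrite counit_pvtV scale1r => /(congr1 (fun a => a ** pvt Q y)).
by rewrite -amulA pvtVK amul1r amul1l.
Qed.

Lemma gmul_sym x y : gmul x y = gone -> gmul y x = gone.
Proof.
move=> e; have -> : y = ginv x; last exact: gmulVg.
by rewrite -[y](gmul1g Q) -(gmulVg Q x) -gmulA e gmulg1.
Qed.

(** Both [S(ab)] and [S(b) S(a)] are convolution inverse to the product. *)
Lemma antipM x y (e : gmul x y = gone) a b : antip e (a ** b) = antip e b ** antip e a.
Proof.
have e' := gmul_sym e; have i := gmul1g Q x.
transitivity (\sw_(s, w <- comul i a) \sw_(s', w' <- comul i b)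
  \sw_(u, v <- comul e (s ** s')) (antip e u ** v) ** (antip e w' ** antip e w)).
  symmetry; under_sw2 ltac:(rewrite sw_mul; [|by multilin|by multilin]).
  under_sw ltac:(rewrite sw_swap).
  transitivity (\sw_(s, w <- comul i a) \sw_(u, v <- comul e s) antip e (u ** b) ** (v ** antip e
    w)).
    apply: eq_sw => s w; apply: eq_sw => u v.
    transitivity (\sw_(s', w' <- comul i b) \sw_(u', v' <- comul e s')
      antip e (u ** u') ** (v ** (v' ** antip e w') ** antip e w)).
      by do 2 (apply: eq_sw => ? ?); rewrite !amulA.
    rewrite (sw_cancel_r e i e (F := fun u' r => antip e (u ** u') ** (v ** r ** antip e w))) //;
      try by multilin.
    by rewrite amul1r.
  rewrite (sw_cancel_r e i e (F := fun u r => antip e (u ** b) ** r)) //; try by multilin.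
  by rewrite amul1r.
under_sw2 ltac:(rewrite (sw_antipl e e (f := fun r => r ** (antip e _ ** antip e _)));
  last by multilin).
transitivity (\sw_(s, w <- comul i a) (counit Q s : K) *: (antip e b ** antip e w)).
  apply: eq_sw => s w.
  rewrite -(sw_counitl i (f := fun w' => antip e w' ** antip e w)); last by multilin.
  rewrite (lin_sw_out (f := fun r => (counit Q s : K) *: r)); last by multilin.
  apply: eq_sw => s' w'; rewrite amul1l scalerA; congr (_ *: _).
  exact: (counit_alg Q).2.
by rewrite (sw_counitl i (f := fun w => antip e b ** antip e w)); last by multilin.
Qed.

(** The square of the antipode is conjugation by the pivot. *)
Lemma antip_inj x y (e : gmul x y = gone) : injective (antip e).
Proof.
move=> a b /(congr1 (fun c => pvtV Q x ** antip (gmul_sym e) c ** pvt Q x)).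
by rewrite !antip_antip -!amulA !pvtVK !amulA !pvtVK !amul1l !amul1r => ->.
Qed.

Lemma antip_dim x y : gmul x y = gone -> \dim {:A x} = \dim {:A y}.
Proof.
have H u v : gmul u v = gone -> (\dim {:A u} <= \dim {:A v})%N.
  move=> e; have /lker0P/eqP k0 := @antip_inj _ _ e.
  by rewrite -(limg_dim_eq (f := antip e) (U := fullv)) ?k0 ?capv0 // dimvS ?subvf.
by move=> e; apply/eqP; rewrite eqn_leq !H // gmul_sym.
Qed.

(** By the pivotality axiom the inverse antipode is [g^-1 S(-) g]. *)
Definition antipV x y (e : gmul x y = gone) : 'Hom(A x, A y) :=
  linfun (fun a => pvtV Q y ** antip e a ** pvt Q y).

Lemma antipVE x y (e : gmul x y = gone) a : antipV e a = pvtV Q y ** antip e a ** pvt Q y.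
Proof. by rewrite lin_linfun //; multilin. Qed.

Lemma antipVK x y (e : gmul x y = gone) (e' : gmul y x = gone) a : antip e' (antipV e a) = a.
Proof.
rewrite antipVE !antipM antip_pvt antip_antip antip_pvtV.
by rewrite -!amulA pvtVK amul1r !amulA pvtVK amul1l.
Qed.

Lemma antipV_l x y (e : gmul x y = gone) (e' : gmul y x = gone) a :
  \sw_(u, v <- comul e a) antipV e' v ** u = (counit Q a : K) *: 1_x.
Proof.
apply: (antip_inj (e := e)); rewrite lfun_sw linearZ /= antip1 -(antip_l e e).
by apply: eq_sw => u v; rewrite antipM antipVK.
Qed.

Lemma antipV_r x y (e : gmul x y = gone) (e' e'' : gmul y x = gone) a :
  \sw_(u, v <- comul e' a) v ** antipV e'' u = (counit Q a : K) *: 1_x.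
Proof.
apply: (antip_inj (e := e)); rewrite lfun_sw linearZ /= antip1 -(antip_r e' e).
by apply: eq_sw => u v; rewrite antipM antipVK.
Qed.

Lemma sw_cancel_antipV x y y' z (e1 : gmul x y = z) (e2 : gmul z y' = x)
    (e' : gmul y' y = gone) X (F : A x -> A y -> X) a :
  (forall v, lin (F^~ v)) -> (forall u, lin (F u)) ->
  \sw_(s, w <- comul e2 a) \sw_(u, v <- comul e1 s) F u (antipV e' w ** v) = F a 1_y.
Proof.
move=> l1 l2; have e := gmul_sym e'.
rewrite (sw_coassoc e1 e2 e (gmulg1 Q x)); try by multilin.
rewrite -(sw_counitr (gmulg1 Q x) (f := F^~ 1_y)) //.
apply: eq_sw => u s; rewrite -linZ // -(antipV_l e e').
by rewrite lin_sw_out.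
Qed.

End Theory.

(** ** The co-opposite *)

Section Flip.
Variable K : fieldType.
Implicit Types V W U : vectType K.

Definition tflip V W : 'Hom(tensor V W, tensor W V) := tlift (fun v w => tens w v).

Lemma sw_flip V W U (F : W -> V -> U) t :
  (forall b, lin (F^~ b)) -> (forall a, lin (F a)) ->
  \sw_(b, a <- tflip V W t) F b a = \sw_(a, b <- t) F b a.
Proof.
move=> l1 l2; rewrite /tflip lfun_sw; apply: eq_sw => a b.
by rewrite sw_tens.
Qed.

Lemma tflip_tens V W (v : V) (w : W) : tflip V W (tens v w) = tens w v.
Proof. by rewrite /tflip sw_tens //; multilin. Qed.

Lemma tflipK V W t : tflip W V (tflip V W t) = t.
Proof. by rewrite {2}/tflip lfun_sw -[RHS]sw_id; apply: eq_sw => a b; rewrite tflip_tens. Qed.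

Lemma tensmulE (A B : fdAlg K) (s t : tensor A B) :
  tensmul s t = \sw_(u, v <- s) \sw_(p, q <- t) tens (u ** p) (v ** q).
Proof.
rewrite /tensmul (lin_sw_out (f := fun M : 'End(tensor _ _) => M t)); last by multilin.
by apply: eq_sw => u v; apply: eq_sw => p q; rewrite !lmulE.
Qed.

Lemma tflip_mul (A B : fdAlg K) (s t : tensor A B) :
  tflip A B (tensmul s t) = tensmul (tflip A B s) (tflip A B t).
Proof.
rewrite !tensmulE lfun_sw sw_flip; try by multilin.
apply: eq_sw => u v; rewrite lfun_sw sw_flip; try by multilin.
by apply: eq_sw => p q; rewrite tflip_tens.
Qed.
End Flip.

Section Coop.
Variables (K : fieldType) (G : Type) (A : G -> fdAlg K) (Q : gHopf A).

Definition coop : gHopf A.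
Proof.
refine (@GHopf K G A (fun x y => gmul Q y x) (gone Q) (ginv Q) _ _ _ _ _
  (fun x y z e => tflip _ _ \o comul e)%VF (counit Q)
  (fun x y e => antipV (gmul_sym (Q := Q) e)) (pvtV Q) (pvt Q)
  _ _ (counit_alg Q) _ _ _ _ _ (pvtVK Q) (pvtK Q) _ (counit_pvtV Q) _).
- by move=> x y z; rewrite gmulA.
- exact: gmulg1.
- exact: gmul1g.
- exact: gmulgV.
- exact: gmulVg.
- by move=> x y z e a b; rewrite !comp_lfunE comulM tflip_mul.
- by move=> x y z e; rewrite comp_lfunE comul1 tflip_tens.
- move=> x y z xy yz xyz e1 e2 e3 e4 a.
  rewrite !comp_lfunE !sw_flip; try by multilin.
  under_sw ltac:(rewrite comp_lfunE sw_flip; [|by multilin|by multilin]).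
  symmetry; under_sw ltac:(rewrite comp_lfunE sw_flip; [|by multilin|by multilin]).
  by rewrite (sw_coassoc e3 e4 e1 e2 (F := fun w v u => tens u (tens v w))) //; multilin.
- by move=> x e a; rewrite comp_lfunE sw_flip ?comul_counitl //; multilin.
- by move=> x e a; rewrite comp_lfunE sw_flip ?comul_counitr //; multilin.
- move=> x y e e' a; rewrite comp_lfunE sw_flip; try by multilin.
  exact: antipV_l.
- move=> x y e e' a; rewrite comp_lfunE sw_flip; try by multilin.
  exact: antipV_r e' e _ _.
- by move=> x y z e; rewrite comp_lfunE comul_pvtV tflip_tens.
- move=> x y e e' a; rewrite !antipVE !antipM antip_antip antip_pvt antip_pvtV.
  by rewrite -!amulA !(amulA (pvtV Q x) (pvt Q x)) !pvtVK !amul1l.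
Defined.
End Coop.

(** * Integrals and cointegrals *)

Section Integrals.
Variables (K : fieldType) (G : Type) (A : G -> fdAlg K) (Q : gHopf A).
Implicit Types X : vectType K.
Notation gmul := (gmul Q).
Notation gone := (gone Q).
Notation ginv := (ginv Q).
Notation "1_ x" := (aone (A x)) (at level 2, x at level 2, format "1_ x").

Definition right_int (mu : forall x, 'Hom(A x, K^o)) : Prop :=
  forall x y z (e : gmul x y = z) a,
    \sw_(u, v <- comul e a) (mu x u : K) *: v = (mu z a : K) *: 1_y.

(** The algebra map [R(al)] along which modules are twisted. *)
Definition Rtwist (al : 'Hom(A gone, groundA K)) x (a : A x) : A x :=
  \sw_(u, v <- comul (gmul1g Q x) a) (al u : K) *: v.

(** This identity makes the twist a right module functor with identity structure
    maps. *)
Lemma Rtwist_comul (al : 'Hom(A gone, groundA K)) x y z (e : gmul x y = z) a :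
  comul e (Rtwist al a) = \sw_(u, v <- comul e a) tens (Rtwist al u) v.
Proof.
transitivity (\sw_(s, w <- comul (gmul1g Q z) a) \sw_(u, v <- comul e w)
    (al s : K) *: tens u v).
  rewrite lfun_sw; apply: eq_sw => s w; rewrite linearZ /= -[in LHS](sw_id (comul e w)).
  by rewrite (lin_sw_out (f := fun t => _ *: t)) //; multilin.
rewrite -(sw_coassoc (gmul1g Q x) e e (gmul1g Q z) (F := fun s u v => (al s : K) *: tens u v));
  try by multilin.
apply: eq_sw => r v; rewrite (lin_sw_out (f := fun t => tens t v)); last by multilin.
by apply: eq_sw => s u; rewrite (linZ _ _ (f := fun t => tens t v)) //; multilin.
Qed.

Lemma Rtwist1 (al : 'Hom(A gone, groundA K)) x : alg_map al -> Rtwist al 1_x = 1_x.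
Proof. by move=> [al1 _]; rewrite /Rtwist sw_1 ?al1 ?scale1r //; multilin. Qed.

Lemma RtwistM (al : 'Hom(A gone, groundA K)) x (a b : A x) : alg_map al ->
  Rtwist al (a ** b) = Rtwist al a ** Rtwist al b.
Proof.
move=> [_ alM]; rewrite /Rtwist sw_mul; try by multilin.
rewrite (lin_sw_out (f := fun t => t ** _)); last by multilin.
apply: eq_sw => u v; rewrite (linZ _ _ (f := fun t => t ** _)); last by multilin.
rewrite (lin_sw_out (f := fun t => v ** t)); last by multilin.
rewrite (lin_sw_out (f := fun t => _ *: t)); last by multilin.
apply: eq_sw => p q; rewrite (linZ _ _ (f := fun t => v ** t)); last by multilin.
by rewrite scalerA alM.
Qed.

Variables (c : A gone) (al : 'Hom(A gone, groundA K)).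
Hypothesis c_neq0 : c != 0.
Hypothesis c_left : forall a, a ** c = (counit Q a : K) *: c.
Hypothesis c_mod : forall a, c ** a = (al a : K) *: c.

(** [S(a) c_1 (x) c_2 = S(a_1) eps(a_2) c_1 (x) c_2 = S(a_1) a_2 c_1 (x) a_3 c_2],
    by invariance of [c], and the first two factors cancel. *)
Lemma coint_left x y (e : gmul x y = gone) (e' : gmul y x = gone) X (F : A x -> A y -> X) a :
  (forall v, lin (F^~ v)) -> (forall u, lin (F u)) ->
  \sw_(p, q <- comul e c) F p (a ** q) = \sw_(p, q <- comul e c) F (antip e' a ** p) q.
Proof.
move=> l1 l2; have i := gmulg1 Q y.
transitivity (\sw_(u, s <- comul i a) \sw_(p, q <- comul e (s ** c)) F (antip e' u ** p) q).
  symmetry; under_sw ltac:(rewrite sw_mul; [|by multilin|by multilin]).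
  transitivity (\sw_(u, s <- comul i a) \sw_(v, w <- comul e s)
    \sw_(p, q <- comul e c) F ((antip e' u ** v) ** p) (w ** q)).
    by do 3 (apply: eq_sw => ? ?); rewrite amulA.
  rewrite (sw_cancel_l e i e' (F := fun r w => \sw_(p, q <- comul e c) F (r ** p) (w ** q)));
    try by multilin.
  by apply: eq_sw => p q; rewrite amul1l.
rewrite -(sw_counitr i (f := fun u => \sw_(p, q <- comul e c) F (antip e' u ** p) q));
  last by multilin.
apply: eq_sw => u s; rewrite c_left.
by rewrite (linZ _ _ (f := fun t => \sw_(p, q <- comul e t) F (antip e' u ** p) q)) //; multilin.
Qed.

(** [c_1 (x) c_2 S(al(a_1) a_2) = c_1 a_1 (x) c_2 a_2 S(a_3)], since
    [al(a) c = c a], and the last two factors cancel. *)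
Lemma coint_right x y (e : gmul x y = gone) X (F : A x -> A y -> X) a :
  (forall v, lin (F^~ v)) -> (forall u, lin (F u)) ->
  \sw_(p, q <- comul e c) F (p ** a) q =
  \sw_(p, q <- comul e c) F p (q ** antip e (Rtwist al a)).
Proof.
move=> l1 l2; have e' := gmul_sym e; pose i := gmul1g Q x.
transitivity (\sw_(s, w <- comul i a) \sw_(p, q <- comul e (c ** s)) F p (q ** antip e w)).
  symmetry; under_sw ltac:(rewrite sw_mul; [|by multilin|by multilin]).
  under_sw ltac:(rewrite sw_swap).
  transitivity (\sw_(s, w <- comul i a) \sw_(u, v <- comul e s)
    \sw_(p, q <- comul e c) F (p ** u) (q ** (v ** antip e w))).
    by do 3 (apply: eq_sw => ? ?); rewrite amulA.
  rewrite (sw_cancel_r e i e (F := fun u r => \sw_(p, q <- comul e c) F (p ** u) (q ** r))) //;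
    try by multilin.
  by apply: eq_sw => p q; rewrite amul1r.
rewrite /Rtwist (lin_sw_out (f := fun w => \sw_(p, q <- comul e c) F p (q ** antip e w)));
  last by multilin.
apply: eq_sw => s w; rewrite c_mod.
rewrite (linZ _ _ (f := fun t => \sw_(p, q <- comul e t) F p (q ** antip e w))); last by multilin.
by rewrite (linZ _ _ (f := fun w => \sw_(p, q <- comul e c) F p (q ** antip e w))) //; multilin.
Qed.

(** ** Non-degeneracy of [Delta(c)] *)

Definition cpair x y (e : gmul x y = gone) (f : 'Hom(A x, K^o)) : A y :=
  \sw_(p, q <- comul e c) (f p : K) *: q.

(** Any functional [f] with [f(c) = 1] yields [1 = f(c_1) S(c_2) c_3], and the
    left invariance of [c] moves [S(c_2)] into the argument of a functional. *)
Lemma cpair_one x y (e : gmul x y = gone) : {mu : 'Hom(A x, K^o) | cpair e mu = 1_y}.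
Proof.
have [k ck] := cobas_neq0 c_neq0.
pose f : 'Hom(A gone, K^o) := (cobas k c : K)^-1 *: cobas k.
have fc : f c = (1 : K) by rewrite scale_lfunE /= /GRing.scale /= mulVf.
pose i := gmul1g Q x; have e' := gmul_sym e.
pose B (r : A x) := \sw_(s, u <- comul i r) (f s : K) *: u.
have lB : lin B by rewrite /B; multilin.
pose m (r : A x) : K^o := \sum_k (cobas k (B (antip e' (antip e (bas k)) ** r)) : K^o).
have lm : lin m by rewrite /m; multilin.
exists (linfun m).
rewrite /cpair; under_sw ltac:(rewrite lin_linfun //).
transitivity (\sw_(r, v <- comul e c) antip e (B r) ** v).
  symmetry.
  transitivity (\sw_(r, v <- comul e c) \sum_k (cobas k (B r) : K) *: (antip e (bas k) ** v)).
    apply: eq_sw => r v; rewrite {1}[B r]bas_sum.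
    rewrite (linS _ (f := fun x => antip e x ** v)); last by multilin.
    by apply: eq_bigr => j _; rewrite (linZ _ _ (f := fun x => antip e x ** v)) //; multilin.
  transitivity (\sw_(r, v <- comul e c)
      \sum_k (cobas k (B (antip e' (antip e (bas k)) ** r)) : K) *: v).
    rewrite !sw_sum; apply: eq_bigr => j _.
    by rewrite (coint_left e e' (F := fun r v => (cobas j (B r) : K) *: v)) //; multilin.
  by apply: eq_sw => r v; rewrite /m scaler_suml.
transitivity ((f c : K) *: 1_y); last by rewrite fc scale1r.
transitivity (\sw_(s, w <- comul (gmulg1 Q gone) c) (f s : K) *: ((counit Q w : K) *: 1_y));
  last first.
  rewrite -(sw_counitr (gmulg1 Q gone) (f := fun s => (f s : K) *: 1_y)); last by multilin.
  by apply: eq_sw => s w; rewrite !scalerA mulrC.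
symmetry; under_sw ltac:(rewrite -(antip_l e e) (lin_sw_out (f := fun r => _ *: r));
  last by multilin).
rewrite -(sw_coassoc i e e (gmulg1 Q gone) (F := fun s u v => (f s : K) *: (antip e u ** v)));
  try by multilin.
apply: eq_sw => r v; rewrite /B.
rewrite (lin_sw_out (f := fun b => antip e b ** v)); last by multilin.
apply: eq_sw => s u.
by rewrite (linZ _ _ (f := fun u => antip e u ** v)) //; multilin.
Qed.

(** The map [a |-> mu(S(a) -)] is a right inverse of [cpair], and the spaces have
    the same dimension. *)
Lemma cpair_inj x y (e : gmul x y = gone) f : cpair e f = 0 -> f = 0.
Proof.
have e' := gmul_sym e.
have [mu mu1] := cpair_one e.
pose j (a : A y) : 'Hom(A x, K^o) := (mu \o lmul (A x) (antip e' a))%VF.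
have jE a r : j a r = mu (antip e' a ** r) by rewrite comp_lfunE lmulE.
have lj : lin j.
  move=> k a b; apply/lfunP=> r; rewrite add_lfunE scale_lfunE !jE.
  by rewrite linearP (amul_bilin _).1 linearP.
have cj a : cpair e (j a) = a.
  rewrite /cpair; under_sw ltac:(rewrite jE).
  rewrite -(coint_left e e' (F := fun p q => (mu p : K) *: q)); try by multilin.
  rewrite -[RHS]amul1r -mu1 (lin_sw_out (f := fun r => a ** r)); last by multilin.
  by apply: eq_sw => p q; rewrite (linZ _ _ (f := fun r => a ** r)) //; multilin.
pose J := linfun j.
have JE : J =1 j := lin_linfun lj.
have k0 : lker J == 0%VS.
  by apply/lker0P => a b; rewrite !JE => jab; rewrite -(cj a) jab cj.
have full : limg J = fullv.
  apply/eqP; rewrite eqEdim subvf /= limg_dim_eq ?(eqP k0) ?capv0 //.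
  rewrite -(antip_dim e) !dimvf /=.
  by rewrite -[X in (_ <= X)%N]muln1.
have /memv_imgP[a _ ->] : f \in limg J by rewrite full memvf.
by rewrite JE cj => ->; rewrite -JE linear0.
Qed.

Lemma cpair_eq x y (e : gmul x y = gone) f f' : cpair e f = cpair e f' -> f = f'.
Proof.
move=> ff; have l : lin (cpair e) by rewrite /cpair; multilin.
apply/eqP; rewrite -subr_eq0; apply/eqP; apply: (@cpair_inj _ _ e).
by rewrite addrC -scaleN1r l ff scaleN1r addNr.
Qed.

Lemma cpair_apply x y (e : gmul x y = gone) X (mu : 'Hom(A x, K^o)) (f : A y -> X) :
  lin f -> \sw_(p, q <- comul e c) (mu p : K) *: f q = f (cpair e mu).
Proof. by move=> lf; rewrite lin_sw_out //; apply: eq_sw => p q; rewrite linZ. Qed.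

(** Linear maps can be compared on [c_1]: coordinatewise this is the injectivity
    of [cpair]. *)
Lemma cpair_ext x y (e : gmul x y = gone) (V : vectType K) (f f' : 'Hom(A x, V)) :
  \sw_(p, q <- comul e c) tens (f p) q = \sw_(p, q <- comul e c) tens (f' p) q -> f = f'.
Proof.
move=> ff; apply/lfunP => a; rewrite [LHS]bas_sum [RHS]bas_sum; apply: eq_bigr => k _.
congr (_ *: _); suff /lfunP/(_ a) : (cobas k \o f = cobas k \o f')%VF by rewrite !comp_lfunE.
apply: (@cpair_eq _ _ e).
have /(congr1 (tlift (fun v (q : A y) => (cobas k v : K) *: q))) := ff.
rewrite !lfun_sw => E; rewrite /cpair; etransitivity; last (etransitivity; first exact: E).
  by apply: eq_sw => p q; rewrite comp_lfunE sw_tens //; multilin.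
by apply: eq_sw => p q; rewrite comp_lfunE sw_tens //; multilin.
Qed.

(** ** Existence and uniqueness of integrals *)

Definition rint0 x : 'Hom(A x, K^o) := sval (cpair_one (gmulgV Q x)).

Lemma cpair_rint0 x : cpair (gmulgV Q x) (rint0 x) = 1_(ginv x).
Proof. by rewrite /rint0; case: cpair_one. Qed.

(** [(mu_x (x) id) Delta_{x,y}] and [mu_xy 1_y] agree on [c_1], since
    [mu_x(c_1) c_2 (x) c_3 = Delta(1)]. *)
Lemma rint0_rint : right_int rint0.
Proof.
move=> x y z e a.
pose f := linfun (fun a => \sw_(u, v <- comul e a) (rint0 x u : K) *: v).
pose f' := linfun (fun a => (rint0 z a : K) *: 1_y).
have fE b : f b = \sw_(u, v <- comul e b) (rint0 x u : K) *: v by rewrite lin_linfun //; multilin.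
have fE' b : f' b = (rint0 z b : K) *: 1_y by rewrite lin_linfun //; multilin.
rewrite -fE -fE'; suff -> : f = f' by [].
apply: (@cpair_ext _ _ (gmulgV Q z)).
have e3 : gmul y (ginv z) = ginv x.
  by rewrite -[LHS](gmul1g Q) -(gmulVg Q x) -gmulA [gmul x _]gmulA e gmulgV gmulg1.
under_sw ltac:(rewrite fE (lin_sw_out (f := fun v => tens v _)); last by multilin).
under_sw2 ltac:(rewrite (linZ _ _ (f := fun v => tens v _)); last by multilin).
rewrite (sw_coassoc e (gmulgV Q z) e3 (gmulgV Q x)
  (F := fun u v w => (rint0 x u : K) *: tens v w)); try by multilin.
transitivity (\sw_(u, s <- comul (gmulgV Q x) c) (rint0 x u : K) *: comul e3 s).
  apply: eq_sw => u s; rewrite -[in RHS](sw_id (comul e3 s)).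
  by rewrite (lin_sw_out (f := fun t => _ *: t)) //; multilin.
rewrite (cpair_apply (gmulgV Q x) (rint0 x) (f := comul e3)); last by multilin.
rewrite cpair_rint0 comul1; symmetry.
under_sw ltac:(rewrite fE' (linZ _ _ (f := fun v => tens v _)); last by multilin).
rewrite (cpair_apply (gmulgV Q z) (rint0 z) (f := fun q => tens 1_y q)); last by multilin.
by rewrite cpair_rint0.
Qed.

Lemma cpair_rint x y (e : gmul x y = gone) nu : right_int nu ->
  cpair e (nu x) = (nu gone c : K) *: 1_y.
Proof. by move=> /(_ _ _ _ e c). Qed.

Lemma rint0_coint : rint0 gone c = (1 : K).
Proof.
have := cpair_rint0 gone; rewrite (cpair_rint _ rint0_rint) => /(congr1 (antip (gmulVg Q gone))).
rewrite linearZ /= antip1 => /(congr1 (counit Q)).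
by rewrite linearZ /= (counit_alg Q).1 /= /GRing.scale /= mulr1.
Qed.

(** [nu(c_1) c_2 = nu(c) 1 = nu(c) rint0(c_1) c_2]. *)
Lemma rint_unique nu : right_int nu -> forall x, nu x = (nu gone c : K) *: rint0 x.
Proof.
move=> nuI x; apply: (@cpair_eq _ _ (gmulgV Q x)).
rewrite (cpair_rint _ nuI) -cpair_rint0 /cpair.
rewrite (lin_sw_out (f := fun v => _ *: v)); last by multilin.
by apply: eq_sw => p q; rewrite scale_lfunE scalerA.
Qed.

(** ** The Nakayama automorphism and non-degeneracy *)

(** With [d = S(R(al)(b))] both functionals pair with [c] to [nu(c) d]: the left
    one by [coint_right], and the right one by [coint_left], because
    [S(d) = g R(al)(b) g^-1]. *)
Lemma rint_nakayama nu : right_int nu -> forall x a b,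
  nu x (a ** b) = nu x ((pvt Q x ** Rtwist al b ** pvtV Q x) ** a).
Proof.
move=> nuI x a b; have e := gmulgV Q x; have e' := gmul_sym e.
pose f : 'Hom(A x, K^o) := linfun (fun a => nu x (a ** b)).
pose d := antip e (Rtwist al b).
pose f' : 'Hom(A x, K^o) := linfun (fun a => nu x (antip e' d ** a)).
have fE r : f r = nu x (r ** b) by rewrite lin_linfun //; multilin.
have fE' r : f' r = nu x (antip e' d ** r) by rewrite lin_linfun //; multilin.
rewrite -(antip_antip e e') -fE -fE'; suff -> : f = f' by [].
apply: (@cpair_eq _ _ e); rewrite /cpair.
under_sw ltac:(rewrite fE).
rewrite (coint_right e (F := fun p q => (nu x p : K) *: q)); try by multilin.
symmetry; under_sw ltac:(rewrite fE').
rewrite -(coint_left e e' (F := fun p q => (nu x p : K) *: q)); try by multilin.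
rewrite (cpair_apply e (nu x) (f := fun q => d ** q)); last by multilin.
rewrite (cpair_apply e (nu x) (f := fun q => q ** d)); last by multilin.
rewrite (cpair_rint e nuI) (linZ _ _ (f := fun q => d ** q)); last by multilin.
by rewrite (linZ _ _ (f := fun q => q ** d)) ?amul1l ?amul1r //; multilin.
Qed.

(** Writing [a = S(d)], the functional [nu(a -)] pairs with [c] to [nu(c) d]. *)
Lemma rint_nondeg nu : right_int nu -> nu gone c != 0 -> forall x a,
  (forall b, nu x (a ** b) = 0) -> a = 0.
Proof.
move=> nuI nuc x a a0; have e := gmulgV Q x; have e' := gmul_sym e.
pose d := antipV e a; have ad : a = antip e' d by rewrite antipVK.
suff : (nu gone c : K) *: d = 0.
  by move/eqP; rewrite scaler_eq0 (negPf nuc) /= => /eqP d0; rewrite ad d0 linear0.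
rewrite -[d]amul1r -(linZ _ _ (f := fun q => d ** q)) -?(cpair_rint e nuI); last by multilin.
rewrite -(cpair_apply e (nu x) (f := fun q => d ** q)); last by multilin.
rewrite (coint_left e e' (F := fun p q => (nu x p : K) *: q)); try by multilin.
under_sw ltac:(rewrite -ad a0 scale0r -(scale0r 1_(ginv x))).
rewrite tliftE big1 // => i _; rewrite big1 // => j _.
by rewrite scale0r scaler0.
Qed.

End Integrals.

Section Symmetrised.
Variables (K : fieldType) (G : Type) (A : G -> fdAlg K) (Q : gHopf A).
Implicit Types m : forall x, 'Hom(A x, K^o).

Definition sym_rint m : Prop :=
  exists2 mu, right_int Q mu & forall x a, m x a = mu x (pvt Q x ** a).

(** The integral condition at [g a] reads [m(a_1) a_2 = m(a) g^-1]; applying the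
    antipode gives the form in which it appears in partial traces. *)
Lemma sym_rint_antip m : sym_rint m ->
  forall x y y' z (e : gmul Q z y' = x) (e' : gmul Q y' y = gone Q) a,
  \sw_(u, v <- comul e a) (m z u : K) *: antip e' v = (m x a : K) *: pvt Q y.
Proof.
move=> [mu muI mE] x y y' z e e' a.
pose f w := antip e' (pvtV Q y' ** w).
have lf : lin f by rewrite /f; multilin.
transitivity (f (\sw_(u, v <- comul e (pvt Q x ** a)) (mu z u : K) *: v)); last first.
  by rewrite muI linZ // -mE /f amul1r antip_pvtV.
rewrite sw_mul; try by multilin.
rewrite comul_pvt sw_tens; try by multilin.
rewrite lin_sw_out //; apply: eq_sw => u v.
by rewrite linZ // /f amulA pvtVK amul1l mE.
Qed.

(** The antipode is injective, so the previous step can be reversed. *)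
Lemma sym_rint_of_antip m :
  (forall x y y' z (e : gmul Q z y' = x) (e' : gmul Q y' y = gone Q) a,
    \sw_(u, v <- comul e a) (m z u : K) *: antip e' v = (m x a : K) *: pvt Q y) -> sym_rint m.
Proof.
move=> H; pose mu x : 'Hom(A x, K^o) := linfun (fun a => m x (pvtV Q x ** a)).
have muE x a : mu x a = m x (pvtV Q x ** a) by rewrite lin_linfun //; multilin.
exists mu => [x y z e a|x a]; last by rewrite muE amulA pvtVK amul1l.
have e' := gmulgV Q y.
under_sw ltac:(rewrite muE); rewrite muE.
pose f w := pvt Q y ** w.
have lf : lin f by rewrite /f; multilin.
have E : \sw_(u, v <- comul e (pvtV Q z ** a)) (m x u : K) *: v =
         (m z (pvtV Q z ** a) : K) *: pvtV Q y.
  apply: (@antip_inj _ _ _ Q _ _ e'); rewrite lfun_sw linearZ /= antip_pvtV -(H _ _ _ _ e e').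
  by apply: eq_sw => u v; rewrite linearZ.
transitivity (f (\sw_(u, v <- comul e (pvtV Q z ** a)) (m x u : K) *: v)).
  rewrite sw_mul; try by multilin.
  rewrite comul_pvtV sw_tens; try by multilin.
  rewrite lin_sw_out //; apply: eq_sw => u v.
  by rewrite linZ // /f amulA pvtK amul1l.
by rewrite E linZ // /f pvtK.
Qed.

Variables (c : A (gone Q)) (al : 'Hom(A (gone Q), groundA K)).
Hypothesis c_neq0 : c != 0.
Hypothesis c_left : forall a, a ** c = (counit Q a : K) *: c.
Hypothesis c_mod : forall a, c ** a = (al a : K) *: c.

Lemma sym_nakayama m : sym_rint m -> forall x a b,
  m x (a ** b) = m x (Rtwist al b ** a).
Proof.
move=> [mu muI mE] x a b; rewrite !mE amulA (rint_nakayama c_neq0 c_left c_mod muI).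
by rewrite -!amulA (amulA (pvtV Q x)) pvtVK amul1l.
Qed.

Definition sym0 x : 'Hom(A x, K^o) := linfun (fun a => rint0 c_neq0 c_left x (pvt Q x ** a)).

Lemma sym0_sym : sym_rint sym0.
Proof.
exists (rint0 c_neq0 c_left) => [|x a]; first exact: rint0_rint.
by rewrite lin_linfun //; multilin.
Qed.

Lemma sym0_neq0 : sym0 (gone Q) (pvtV Q (gone Q) ** c) = (1 : K).
Proof.
rewrite lin_linfun; last by multilin.
by rewrite amulA pvtK amul1l rint0_coint.
Qed.

Lemma sym_unique m : sym_rint m -> exists k : K, forall x, m x = k *: sym0 x.
Proof.
move=> [mu muI mE]; exists (mu (gone Q) c) => x; apply/lfunP => a.
rewrite mE scale_lfunE lin_linfun; last by multilin.
by rewrite (rint_unique c_neq0 c_left muI) scale_lfunE.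
Qed.

Lemma sym_nondeg m : sym_rint m -> (exists x, m x != 0) -> forall x a,
  (forall b, m x (a ** b) = 0) -> a = 0.
Proof.
move=> [mu muI mE] [y my] x a a0.
have ga : pvt Q x ** a = 0.
  apply: (rint_nondeg c_left muI) => [|b]; last by rewrite -amulA -mE a0.
  apply: contraNneq my => muc; apply/eqP/lfunP => b.
  by rewrite mE (rint_unique c_neq0 c_left muI) muc scale0r !zero_lfunE.
rewrite -[a]amul1l -(pvtVK Q x) -amulA ga.
by rewrite (lin0 (f := amul (pvtV Q x))) //; multilin.
Qed.
End Symmetrised.

(** * Traces on projective modules over an algebra *)

Section DualSystems.
Variables (K : fieldType) (B : fdAlg K).
Implicit Types (V W : vectType K) (m : 'Hom(B, K^o)).

(** A dual basis, in the sense of the dual basis lemma for projectives. *)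
Definition dual_system V (rho : 'Hom(B, 'End(V))) (J : finType) (e : J -> V)
    (s : J -> 'Hom(V, B)) : Prop :=
  (forall j b v, s j (rho b v) = b ** s j v) /\
  (forall v, \sum_j rho (s j v) (e j) = v).

(** Expanding [g(e_j)] in the second dual basis produces the products
    [s_j(f(e'_l)) s'_l(g(e_j))], which are then contracted over [j] after a twisted
    commutation under [m].  For [g = id] the statement says that the sum does not
    depend on the dual basis. *)
Lemma dual_system_cyclic V W (rho : 'Hom(B, 'End(V))) (sigma : 'Hom(B, 'End(W)))
    (J L : finType) (e : J -> V) s (e' : L -> W) s' (m : 'Hom(B, K^o)) (phi : B -> B)
    (g : 'Hom(V, W)) (f : 'Hom(W, V)) :
  dual_system rho e s -> dual_system sigma e' s' ->
  (forall a b, m (a ** b) = m (phi b ** a)) ->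
  (forall b v, g (rho b v) = sigma b (g v)) ->
  (forall b w, f (sigma b w) = rho (phi b) (f w)) ->
  \sum_j m (s j (f (g (e j)))) = \sum_l m (s' l (g (f (e' l)))).
Proof.
move=> [sl se] [sl' se'] mC pvt fl.
transitivity (\sum_j \sum_l m (s' l (g (rho (s j (f (e' l))) (e j))))).
  apply: eq_bigr => j _; rewrite -{1}(se' (g (e j))) !linear_sum; apply: eq_bigr => l _ /=.
  by rewrite fl sl -mC -sl' -pvt.
rewrite exchange_big; apply: eq_bigr => l _.
by rewrite -{2}(se (f (e' l))) !linear_sum.
Qed.

(** The dual basis with respect to the fixed vector space basis of [V], which
    exists as soon as [V] is projective. *)
Definition dual_coords V (rho : 'Hom(B, 'End(V))) : 'I_(\dim {:V}) -> 'Hom(V, B) :=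
  epsilon (inhabits (fun=> 0)) (dual_system rho (@bas K V)).

Definition has_dual_system V (rho : 'Hom(B, 'End(V))) : Prop :=
  dual_system rho (@bas K V) (dual_coords rho).

Lemma dual_system_exists V (rho : 'Hom(B, 'End(V))) (J : finType) (e : J -> V) s :
  dual_system rho e s -> has_dual_system rho.
Proof.
move=> [sl se].
pose s' k : 'Hom(V, B) := \sum_j (cobas k (e j) : K) *: s j.
apply: epsilon_spec; exists s'; split=> [k b v|v].
  rewrite !sum_lfunE (linS _ (f := fun x => b ** x)); last by multilin.
  apply: eq_bigr => j _; rewrite !scale_lfunE sl.
  by rewrite (linZ _ _ (f := fun x => b ** x)) //; multilin.
rewrite -[RHS]se.
transitivity (\sum_k \sum_j (cobas k (e j) : K) *: rho (s j v) (bas k)).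
  apply: eq_bigr => k _; rewrite sum_lfunE.
  have l : lin (fun b => rho b (bas k)) by multilin.
  rewrite (linS _ l); apply: eq_bigr => j _.
  by rewrite scale_lfunE (linZ _ _ l).
rewrite exchange_big; apply: eq_bigr => j _.
by rewrite [e j in RHS]bas_sum linear_sum; apply: eq_bigr => k _; rewrite linearZ.
Qed.

Lemma dual_system_reg : dual_system (lmul B) (fun=> aone B) (fun _ : unit => \1%VF).
Proof.
split=> [_ b v|v]; first by rewrite !id_lfunE lmulE.
by rewrite big_const card_unit /= addr0 id_lfunE lmulE amul1r.
Qed.

Lemma dual_system_iso (M N : vectType K) (rho : 'Hom(B, 'End(M)))
    (sigma : 'Hom(B, 'End(N))) (p : 'Hom(M, N)) (q : 'Hom(N, M)) (J : finType) (e : J -> N) s :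
  (forall v, q (p v) = v) -> (forall b v, p (rho b v) = sigma b (p v)) ->
  (forall b w, q (sigma b w) = rho b (q w)) ->
  dual_system sigma e s -> dual_system rho (fun j => q (e j)) (fun j => s j \o p)%VF.
Proof.
move=> pK pl ql [sl se]; split=> [j b v|v]; first by rewrite !comp_lfunE pl sl.
rewrite -[RHS]pK -(se (p v)) linear_sum; apply: eq_bigr => j _ /=.
by rewrite comp_lfunE ql.
Qed.

Definition dual_trace (m : 'Hom(B, K^o)) V (rho : 'Hom(B, 'End(V))) (f : 'End(V)) : K :=
  \sum_k m (dual_coords rho k (f (bas k))).

Lemma dual_traceE m phi V (rho : 'Hom(B, 'End(V))) (J : finType) (e : J -> V) s (f : 'End(V)) :
  (forall a b, m (a ** b) = m (phi b ** a)) -> dual_system rho e s ->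
  (forall b w, f (rho b w) = rho (phi b) (f w)) ->
  dual_trace m rho f = \sum_j m (s j (f (e j))).
Proof.
move=> mC es fl; rewrite /dual_trace.
transitivity (\sum_k m (dual_coords rho k (f ((\1%VF : 'End(V)) (bas k))))).
  by apply: eq_bigr => k _; rewrite id_lfunE.
rewrite (dual_system_cyclic (dual_system_exists es) es mC) => [|b v|//].
  by apply: eq_bigr => j _; rewrite id_lfunE.
by rewrite !id_lfunE.
Qed.

Lemma dual_trace_cyclic m phi V W (rho : 'Hom(B, 'End(V))) (sigma : 'Hom(B, 'End(W)))
    (g : 'Hom(V, W)) (f : 'Hom(W, V)) :
  (forall a b, m (a ** b) = m (phi b ** a)) -> has_dual_system rho -> has_dual_system sigma ->
  (forall b v, g (rho b v) = sigma b (g v)) ->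
  (forall b w, f (sigma b w) = rho (phi b) (f w)) ->
  dual_trace m rho (f \o g)%VF = dual_trace m sigma (g \o f)%VF.
Proof.
move=> mC dr ds pvt fl; rewrite /dual_trace.
under eq_bigr do rewrite comp_lfunE.
by rewrite (dual_system_cyclic dr ds mC pvt fl); apply: eq_bigr => l _; rewrite comp_lfunE.
Qed.

Lemma dual_trace_linear m V (rho : 'Hom(B, 'End(V))) k (f f' : 'End(V)) :
  dual_trace m rho (k *: f + f') = k * dual_trace m rho f + dual_trace m rho f'.
Proof.
rewrite mulr_sumr -big_split; apply: eq_bigr => j _ /=.
by rewrite add_lfunE scale_lfunE !linearP.
Qed.

Lemma dual_trace_linear_form m m' V (rho : 'Hom(B, 'End(V))) k (f : 'End(V)) :
  dual_trace (k *: m + m') rho f = k * dual_trace m rho f + dual_trace m' rho f.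
Proof.
rewrite mulr_sumr -big_split; apply: eq_bigr => j _ /=.
by rewrite add_lfunE scale_lfunE.
Qed.
Lemma dual_trace_sum n V (rho : 'Hom(B, 'End(V)))
    (I : finType) (f : I -> 'End(V)) :
  dual_trace n rho (\sum_i f i) = \sum_i dual_trace n rho (f i).
Proof.
rewrite /dual_trace exchange_big; apply: eq_bigr => k _ /=.
by rewrite sum_lfunE !linear_sum.
Qed.

End DualSystems.

(** * Tensor products with a projective module *)

Section Induced.
Variables (K : fieldType) (G : Type) (A : G -> fdAlg K) (Q : gHopf A).
Implicit Types V W : vectType K.
Variables (x y z : G) (e : gmul Q x y = z).

(** The action of [A_z] on the tensor product of modules in degrees [x], [y]. *)
Definition tact V W (rho : 'Hom(A x, 'End(V))) (sigma : 'Hom(A y, 'End(W))) :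
  'Hom(A z, 'End(tensor V W)) := (tensrep rho sigma \o comul e)%VF.

Lemma tactE V W (rho : 'Hom(A x, 'End(V))) (sigma : 'Hom(A y, 'End(W))) a v w :
  tact rho sigma a (tens v w) = \sw_(p, q <- comul e a) tens (rho p v) (sigma q w).
Proof.
rewrite comp_lfunE /tensrep (lin_sw_out (f := fun h : 'End(_) => h _)); last by multilin.
by apply: eq_sw => p q; rewrite tmap_tens.
Qed.

Lemma tact_sw V W (rho : 'Hom(A x, 'End(V))) (sigma : 'Hom(A y, 'End(W))) a t :
  tact rho sigma a t =
  \sw_(v, w <- t) \sw_(p, q <- comul e a) tens (rho p v) (sigma q w).
Proof.
by rewrite -{1}(sw_id t) lfun_sw; apply: eq_sw => v w; rewrite tactE.
Qed.

Lemma tact_alg V W (rho : 'Hom(A x, 'End(V))) (sigma : 'Hom(A y, 'End(W))) :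
  @alg_map K (A x) (EndA V) rho -> @alg_map K (A y) (EndA W) sigma ->
  @alg_map K (A z) (EndA (tensor V W)) (tact rho sigma).
Proof.
move=> ra sa; apply: (alg_map_comp (tensrep_alg_map ra sa)).
by split=> [|a b]; [exact: comul1 | exact: comulM].
Qed.

Variables (W : vectType K) (sigma : 'Hom(A y, 'End(W))).
Hypothesis sigma_alg : @alg_map K (A y) (EndA W) sigma.

Let sigma1 w : sigma (aone _) w = w.
Proof. by rewrite sigma_alg.1 id_lfunE. Qed.
Let sigmaM a b w : sigma (a ** b) w = sigma a (sigma b w).
Proof. by rewrite sigma_alg.2 comp_lfunE. Qed.

Lemma tact_tmap V V' (rho : 'Hom(A x, 'End(V))) (rho' : 'Hom(A x, 'End(V')))
    (f : 'Hom(V, V')) a t : (forall b v, f (rho b v) = rho' b (f v)) ->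
  tmap f \1%VF (tact rho sigma a t) = tact rho' sigma a (tmap f \1%VF t).
Proof.
move=> fl; rewrite -{2}(sw_id t) tact_sw !lfun_sw; apply: eq_sw => v w.
rewrite lfun_sw tmap_tens tactE; apply: eq_sw => p q.
by rewrite tmap_tens fl !id_lfunE.
Qed.

Variables (y' : G) (e2 : gmul Q z y' = x) (e' : gmul Q y' y = gone Q).

(** [A_x (x) W] is free over [A_z] on the elements [1 (x) w_j]: the coordinates
    are read off from the inverse [a (x) w |-> a_1 (x) S(a_2) w] of the map
    [A_z (x) W -> A_x (x) W], [h (x) w |-> h (1 (x) w)]. *)
Definition free_coord (j : 'I_(\dim {:W})) : 'Hom(tensor (A x) W, A z) :=
  tlift (fun a w => \sw_(u, v <- comul e2 a) (cobas j (sigma (antip e' v) w) : K) *: u).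

Lemma free_coord_tens j a w :
  free_coord j (tens a w) =
  \sw_(u, v <- comul e2 a) (cobas j (sigma (antip e' v) w) : K) *: u.
Proof. by rewrite /free_coord sw_tens //; multilin. Qed.

Let reg := lmul (A x).

Lemma free_coord_decomp t :
  \sum_j tact reg sigma (free_coord j t) (tens (aone _) (bas j)) = t.
Proof.
have l : lin (fun t => \sum_j tact reg sigma (free_coord j t) (tens (aone _) (bas j))) by multilin.
rewrite -{1}(sw_id t) (lin_sw_out (f := fun t => \sum_j _) _ _ l) -[RHS]sw_id.
apply: eq_sw => a w.
transitivity (\sum_j \sw_(u, v <- comul e2 a) \sw_(p, q <- comul e u)
   (cobas j (sigma (antip e' v) w) : K) *: tens p (sigma q (bas j))).
  apply: eq_bigr => j _; rewrite free_coord_tens.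
  rewrite (lin_sw_out (f := fun a => tact _ _ a _)); last by multilin.
  apply: eq_sw => u v; rewrite (linZ _ _ (f := fun a => tact _ _ a _)); last by multilin.
  rewrite tactE (lin_sw_out (f := fun a => _ *: a)); last by multilin.
  by apply: eq_sw => p q; rewrite lmulE amul1r.
rewrite -sw_sum.
transitivity (\sw_(u, v <- comul e2 a) \sw_(p, q <- comul e u) tens p (sigma (q ** antip e' v) w)).
  apply: eq_sw => u v; rewrite -sw_sum; apply: eq_sw => p q.
  rewrite sigmaM {2}[sigma _ w]bas_sum linear_sum (linS _ (f := fun x => tens p x));
    last by multilin.
  apply: eq_bigr => j _; rewrite linearZ /=.
  by rewrite (linZ _ _ (f := fun x => tens p x)) //; multilin.
rewrite (sw_cancel_r e e2 e' (F := fun p r => tens p (sigma r w))); try by multilin.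
  by rewrite sigma1.
exact: gmul_sym e'.
Qed.

Lemma free_coord_tact j h w :
  free_coord j (tact reg sigma h (tens (aone _) w)) = (cobas j w : K) *: h.
Proof.
rewrite tactE lfun_sw.
transitivity (\sw_(p, q <- comul e h) \sw_(u, v <- comul e2 p)
   (cobas j (sigma (antip e' v ** q) w) : K) *: u).
  apply: eq_sw => p q; rewrite lmulE amul1r free_coord_tens.
  by apply: eq_sw => u v; rewrite sigmaM.
rewrite (sw_cancel_r' e e2 e' (F := fun u r => (cobas j (sigma r w) : K) *: u));
  try by multilin.
by rewrite sigma1.
Qed.

(** [free_coord] inverts a linear bijection that commutes with the action. *)
Lemma free_coord_linear j h t : free_coord j (tact reg sigma h t) = h ** free_coord j t.
Proof.
rewrite -{1}(free_coord_decomp t) !linear_sum.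
transitivity (\sum_i (cobas j (bas i : W) : K) *: (h ** free_coord i t)).
  have regA := tact_alg (lmul_alg_map (A x)) sigma_alg.
  have regM a b u : tact reg sigma (a ** b) u = tact reg sigma a (tact reg sigma b u).
    by rewrite regA.2 comp_lfunE.
  by apply: eq_bigr => i _ /=; rewrite -regM free_coord_tact.
rewrite (bigD1 j) //= big1 ?addr0 => [|i ij]; rewrite cobas_bas ?eqxx ?scale1r //.
by rewrite (negPf ij) scale0r.
Qed.

(** The free case applies to [(s_k (x) 1)(t)], and [sum_k r_k s_k = 1] for the maps
    [r_k(a) = a b_k]. *)
(** The free case applies to [(s_k (x) 1)(t)], and [sum_k r_k s_k = 1] for the maps
    [r_k(a) = a b_k]. *)
Lemma tact_dual_system V (rho : 'Hom(A x, 'End(V))) (J : finType) (b : J -> V) s :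
  @alg_map K (A x) (EndA V) rho -> dual_system rho b s ->
  dual_system (tact rho sigma) (fun kj : J * 'I_(\dim {:W}) => tens (b kj.1) (bas kj.2))
    (fun kj => free_coord kj.2 \o tmap (s kj.1) \1)%VF.
Proof.
move=> ra [sl se]; split=> [[k j] a v|t] /=.
  rewrite [LHS]comp_lfunE [in RHS]comp_lfunE (tact_tmap (rho' := reg)) ?free_coord_linear // => c
    w.
  by rewrite sl lmulE.
pose r k : 'Hom(A x, V) := linfun (fun a => rho a (b k)).
have rE k a : r k a = rho a (b k) by rewrite lin_linfun //; multilin.
have rl k c a : r k (reg c a) = rho c (r k a).
  by rewrite !rE lmulE ra.2 comp_lfunE.
transitivity (\sum_k tmap (r k) \1%VF (tmap (s k) \1%VF t)).
  rewrite -(pair_bigA _ (fun k j => tact rho sigma ((free_coord j \o tmap (s k) \1)%VF t)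
      (tens (b k) (bas j)))) /=.
  apply: eq_bigr => k _; rewrite -[tmap (s k) _ t in RHS]free_coord_decomp linear_sum.
  apply: eq_bigr => j _ /=; rewrite comp_lfunE (tact_tmap _ _ (rl k)) tmap_tens.
  by rewrite rE ra.1 !id_lfunE.
rewrite -[RHS](sw_id t) -{1}(sw_id t).
under eq_bigr do rewrite !lfun_sw.
rewrite -sw_sum; apply: eq_sw => v w.
under eq_bigr do rewrite !tmap_tens !id_lfunE rE.
rewrite -{2}(se v) (linS _ (f := fun v => tens v w)) //; multilin.
Qed.

(** ** Partial traces *)

(** The partial trace over [W], weighted by an endomorphism [h] of [W]. *)
Definition ptr (h : 'End(W)) V V' (f : 'Hom(tensor V W, tensor V' W)) : 'Hom(V, V') :=
  linfun (fun v => \sum_j \sw_(b, w <- f (tens v (bas j))) (cobas j (h w) : K) *: b).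

Lemma ptrE h V V' (f : 'Hom(tensor V W, tensor V' W)) v :
  ptr h f v = \sum_j \sw_(b, w <- f (tens v (bas j))) (cobas j (h w) : K) *: b.
Proof. by rewrite lin_linfun //; multilin. Qed.

Lemma rint_free_coord m j t : sym_rint Q m ->
  m z (free_coord j t) = \sw_(a, w <- t) (m x a : K) *: cobas j (sigma (pvt Q y) w).
Proof.
move=> ms; rewrite -{1}(sw_id t) !lfun_sw; apply: eq_sw => a w.
rewrite free_coord_tens lfun_sw.
transitivity (\sw_(u, v <- comul e2 a) (m z u : K) *: (cobas j (sigma (antip e' v) w))).
  by apply: eq_sw => u v; rewrite linearZ; exact: (@mulrC K).
transitivity (cobas j (sigma (\sw_(u, v <- comul e2 a) (m z u : K) *: antip e' v) w)).
  rewrite (lin_sw_out (f := fun b => cobas j (sigma b w))); last by multilin.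
  apply: eq_sw => u v.
  by rewrite (linZ _ _ (f := fun b => cobas j (sigma b w))) //; multilin.
rewrite sym_rint_antip // (linZ _ _ (f := fun b => cobas j (sigma b w))) //; multilin.
Qed.

(** The dual basis [e_k (x) w_j] of the tensor product computes the left side, and
    [rint_free_coord] rewrites it term by term. *)
Lemma tact_trace m V (rho : 'Hom(A x, 'End(V))) (phi : A z -> A z) (f : 'End(tensor V W)) :
  sym_rint Q m -> @alg_map K (A x) (EndA V) rho -> has_dual_system rho ->
  (forall a b, m z (a ** b) = m z (phi b ** a)) ->
  (forall a t, f (tact rho sigma a t) = tact rho sigma (phi a) (f t)) ->
  dual_trace (m z) (tact rho sigma) f = dual_trace (m x) rho (ptr (sigma (pvt Q y)) f).
Proof.
move=> ms ra hr mC fl; rewrite (dual_traceE mC (tact_dual_system ra hr) fl).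
rewrite -(pair_bigA _ (fun k j => m z ((free_coord j \o tmap (dual_coords rho k) \1)%VF
  (f (tens (bas k) (bas j)))))) /=.
apply: eq_bigr => k _; rewrite ptrE !linear_sum; apply: eq_bigr => j _ /=.
rewrite comp_lfunE rint_free_coord // -{1}(sw_id (f _)) !lfun_sw.
apply: (@eq_sw K V W (K^o : vectType K)) => b w; rewrite tmap_tens id_lfunE sw_tens;
  try by multilin.
  by rewrite !linearZ; exact: (@mulrC K).
Qed.

(** Maps that are twisted linear of rank one in the free basis; they detect the
    integral condition. *)
Definition test_map al (a : A x) (w0 : W) j : 'End(tensor (A x) W) :=
  linfun (fun t => tact reg sigma (Rtwist (Q := Q) al (free_coord j t)) (tens a w0)).

Lemma test_mapE al a w0 j t :
  test_map al a w0 j t = tact reg sigma (Rtwist al (free_coord j t)) (tens a w0).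
Proof. by rewrite lin_linfun // /Rtwist; multilin. Qed.

Lemma test_map_linear al a w0 j b t : alg_map al ->
  test_map al a w0 j (tact reg sigma b t) =
  tact reg sigma (Rtwist al b) (test_map al a w0 j t).
Proof.
move=> alA; rewrite !test_mapE free_coord_linear RtwistM //.
by rewrite (tact_alg (lmul_alg_map _) sigma_alg).2 comp_lfunE.
Qed.

(** The map sends [b (x) w_i] to [w_j^*(S(b_3) w_i) R(al)(b_1) a (x) b_2 w0], and the
    partial trace cancels [S(b_3) g b_2 = g S^-1(b_3) b_2]. *)
Lemma ptr_test_map al a w0 j b :
  ptr (sigma (pvt Q y)) (test_map al a w0 j) b =
  (cobas j (sigma (pvt Q y) w0) : K) *: (Rtwist al b ** a).
Proof.
rewrite ptrE.
transitivity (\sum_i \sw_(s, r <- comul e2 b) \sw_(p, q <- comul e s)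
  ((cobas i (sigma (pvt Q y ** q) w0) : K) *:
    ((cobas j (sigma (antip e' r) (bas i)) : K) *: (Rtwist al p ** a)))).
  apply: eq_bigr => i _; rewrite test_mapE free_coord_tens.
  have l : lin (fun h => tact reg sigma (Rtwist al h) (tens a w0)) by rewrite /Rtwist; multilin.
  rewrite (lin_sw_out _ _ l) lfun_sw; apply: eq_sw => s r.
  rewrite (linZ _ _ l) linearZ /= tactE Rtwist_comul.
  rewrite !lfun_sw (lin_sw_out (f := fun t => _ *: t)); last by multilin.
  apply: eq_sw => p q; rewrite sw_tens; [|by multilin|by multilin].
  rewrite sw_tens; [|by multilin|by multilin].
  by rewrite lmulE sigmaM !scalerA mulrC.
rewrite -sw_sum.
have lr : lin (Rtwist al (x := x)) by rewrite /Rtwist; multilin.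
pose F p h := (cobas j (sigma (pvt Q y ** h) w0) : K) *: (Rtwist al p ** a).
transitivity (\sw_(s, r <- comul e2 b) \sw_(p, q <- comul e s) F p (antipV e' r ** q)).
  apply: eq_sw => s r; rewrite -sw_sum; apply: eq_sw => p q.
  rewrite /F; have -> : pvt Q y ** (antipV e' r ** q) = antip e' r ** (pvt Q y ** q).
    by rewrite antipVE !amulA pvtK amul1l.
  rewrite [in RHS]sigmaM [sigma (pvt Q y ** q) w0 in RHS]bas_sum !linear_sum scaler_suml.
  by apply: eq_bigr => i _; rewrite !linearZ /= scalerA; congr (_ *: _); rewrite mulrC.
rewrite (sw_cancel_antipV e e2 e' (F := F)); first by rewrite /F amul1r.
  by rewrite /F; multilin.
by rewrite /F /Rtwist; multilin.
Qed.

(** Only the basis vector [1 (x) w_j] contributes, and the trace identity for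
    the test maps becomes the coordinate form of the integral condition. *)
Lemma trace_test_map (m : forall x, 'Hom(A x, K^o)) (al : 'Hom(A (gone Q), groundA K)) a w0 j :
  alg_map al -> (forall a b, m z (a ** b) = m z (Rtwist al b ** a)) ->
  dual_trace (m z) (tact reg sigma) (test_map al a w0 j) =
  \sw_(u, v <- comul e2 a) (m z u : K) *: cobas j (sigma (antip e' v) w0).
Proof.
move=> alA mC.
have ia := tact_alg (lmul_alg_map (A x)) sigma_alg.
have ind1 t : tact reg sigma (aone _) t = t by rewrite ia.1 id_lfunE.
rewrite (dual_traceE mC (tact_dual_system (lmul_alg_map (A x)) (dual_system_reg _))); last first.
  by move=> b t; rewrite test_map_linear.
have E i : test_map al a w0 j (tens (aone _) (bas i)) = ((j == i)%:R : K) *: tens a w0.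
  rewrite test_mapE -[X in free_coord j X]ind1 free_coord_tact cobas_bas.
  have l : lin (fun h => tact reg sigma (Rtwist al h) (tens a w0)) by rewrite /Rtwist; multilin.
  by rewrite (linZ _ _ l) Rtwist1 // ind1 eq_sym.
rewrite (bigD1 (tt, j)) //= big1 ?addr0 => [|[[] i]]; last first.
  by rewrite xpair_eqE /= => ij; rewrite E eq_sym (negPf ij) scale0r !linear0.
rewrite E eqxx scale1r comp_lfunE tmap1 id_lfunE free_coord_tens lfun_sw.
by apply: (@eq_sw K _ _ (K^o : vectType K)) => u v; rewrite linearZ; exact: (@mulrC K).
Qed.
End Induced.

(** The trace identities for regular modules alone force the integral
    condition; the test maps provide each of its coordinates. *)
Lemma sym_rint_of_traces (K : fieldType) (G : Type) (A : G -> fdAlg K) (Q : gHopf A)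
    (al : 'Hom(A (gone Q), groundA K)) (m : forall x, 'Hom(A x, K^o)) :
  alg_map al ->
  (forall x a b, m x (a ** b) = m x (Rtwist al b ** a)) ->
  (forall x y z (e : gmul Q x y = z) (f : 'End(tensor (A x) (A y))),
    (forall a t, f (tact e (lmul _) (lmul _) a t) =
                 tact e (lmul _) (lmul _) (Rtwist al a) (f t)) ->
    (forall a b, ptr (lmul (A y) (pvt Q y)) f (a ** b) =
                 Rtwist al a ** ptr (lmul (A y) (pvt Q y)) f b) ->
    dual_trace (m z) (tact e (lmul _) (lmul _)) f =
    dual_trace (m x) (lmul _) (ptr (lmul (A y) (pvt Q y)) f)) ->
  sym_rint Q m.
Proof.
move=> alA mC H; apply: sym_rint_of_antip => x y y' z e2 e' a.
have e : gmul Q x y = z by rewrite -e2 -gmulA e' gmulg1.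
have sA := lmul_alg_map (A y).
rewrite [LHS]bas_sum [RHS]bas_sum; apply: eq_bigr => j _; congr (_ *: _).
pose f := test_map e (lmul (A y)) e2 e' al a (aone _) j.
have fl b t : f (tact e (lmul _) (lmul _) b t) =
    tact e (lmul _) (lmul _) (Rtwist al b) (f t) by exact: test_map_linear.
have pf b : ptr (lmul (A y) (pvt Q y)) f b = (cobas j (pvt Q y) : K) *: (Rtwist al b ** a).
  by rewrite (ptr_test_map e sA) lmulE amul1r.
have pl b b' : ptr (lmul (A y) (pvt Q y)) f (b ** b') =
               Rtwist al b ** ptr (lmul (A y) (pvt Q y)) f b'.
  rewrite !pf RtwistM // -amulA.
  by rewrite (linZ _ _ (f := fun t => Rtwist al b ** t)) //; multilin.
have := H x y z e f fl pl.
rewrite trace_test_map // (dual_traceE (mC x) (dual_system_reg _)); last by move=> b w;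
  rewrite !lmulE.
rewrite big_const card_unit /= addr0 id_lfunE pf Rtwist1 // amul1l linearZ /= => E.
rewrite lfun_sw linearZ /=.
transitivity (cobas j (pvt Q y) * m x a : K); last exact: mulrC.
rewrite -[RHS]E; apply: (@eq_sw K _ _ (K^o : vectType K)) => u v.
by rewrite linearZ /= lmulE amul1r.
Qed.

(** * The graded category of modules *)

Section Standard.
Variables (K : fieldType) (G : groupType) (H : hopfGcoalg K G).

Lemma cast_id (x : G) (e : x = x) a : cast H e a = a.
Proof. by rewrite (eq_irrelevance e erefl) /cast /= id_lfunE. Qed.

Lemma cast_irr (x y : G) (e e' : x = y) a : cast H e a = cast H e' a.
Proof. by rewrite (eq_irrelevance e e'). Qed.

Lemma castC (x y z : G) (e : x = y) (e' : y = z) e'' a :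
  cast H e' (cast H e a) = cast H e'' a.
Proof. by case: z / e' e''; case: y / e => e''; rewrite !cast_id. Qed.

Lemma castM (x y : G) (e : x = y) a b : cast H e (a ** b) = cast H e a ** cast H e b.
Proof. exact: (cast_alg H e).2. Qed.

Lemma cast1 (x y : G) (e : x = y) : cast H e (aone _) = aone _.
Proof. exact: (cast_alg H e).1. Qed.

Lemma invg_uniq (x y : G) : (x * y = 1 -> x^-1 = y)%g.
Proof. by move=> e; rewrite -[y](mulKg x) e mulg1. Qed.

Variable g : pivot H.

Definition std_comul (x y z : G) (e : (x * y)%g = z) : 'Hom(H z, tensor (H x) (H y)) :=
  (Delta H x y \o cast H (esym e))%VF.
Definition std_antip (x y : G) (e : (x * y = 1)%g) : 'Hom(H x, H y) :=
  (cast H (invg_uniq e) \o Sant H x)%VF.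

Lemma std_comulE (x y z : G) (e : (x * y)%g = z) a :
  std_comul e a = Delta H x y (cast H (esym e) a).
Proof. by rewrite comp_lfunE. Qed.

(** Proof irrelevance for equalities in [G] makes the transports coherent. *)
Definition std : gHopf H.
Proof.
refine (@GHopf K G H (fun x y => (x * y)%g) 1%g (fun x => x^-1)%g (@mulgA G) (@mul1g G)
  (@mulg1 G) (@mulVg G) (@mulgV G) std_comul (eps H) std_antip g (pivV g)
  _ _ (eps_alg H) _ _ _ _ _ (pivKV g) (pivVK g) _ (piv_eps g) _).
- by move=> x y z e a b; rewrite !std_comulE castM (Delta_alg H x y).2.
- by move=> x y z e; rewrite std_comulE cast1 (Delta_alg H x y).1.
- move=> x y z xy yz xyz e1 e2 e3 e4 a.
  case: xy / e1 e2 => e2; case: yz / e3 e4 => e4; case: xyz / e2 a e4 => a e4.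
  have := Delta_coassoc a; rewrite -[LHS]/(tlift _ _) sw_tmap; try by multilin.
  move=> E; etransitivity; last (etransitivity; first exact: E).
    rewrite std_comulE cast_id; apply: eq_sw => u v; rewrite std_comulE cast_id.
    by apply: eq_sw => p q; rewrite id_lfunE.
  rewrite std_comulE (cast_irr _ (esym (mulgA x y z))) -[LHS]/(tlift _ _).
  apply: eq_sw => u v; rewrite id_lfunE std_comulE cast_id -{1}(sw_id (Delta H y z v)).
  by rewrite (lin_sw_out (f := fun t => tens u t)) //; multilin.
- move=> x e a; rewrite -[RHS](counitr a) /tunitr sw_tmap; try by multilin.
  rewrite std_comulE (cast_irr _ (esym (mulg1 x))).
  by apply: eq_sw => u v; rewrite id_lfunE.
- move=> x e a; rewrite -[RHS](counitl a) /tunitl sw_tmap; try by multilin.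
  rewrite std_comulE (cast_irr _ (esym (mul1g x))).
  by apply: eq_sw => u v; rewrite id_lfunE.
- move=> x y e e' a; have ey : (x^-1)%g = y by apply: invg_uniq; apply: (mulgI y);
  rewrite mulgA e mul1g mulg1.
  case: y / ey e e' => e e'.
  rewrite -antipodel mulmapE sw_tmap; try by multilin.
  rewrite std_comulE (cast_irr _ (esym (mulVg x))).
  by apply: eq_sw => u v; rewrite !comp_lfunE id_lfunE (cast_irr _ (invgK x)).
- move=> x y e e' a; have ey : (x^-1)%g = y by exact: invg_uniq.
  case: y / ey e e' => e e'.
  rewrite -antipoder mulmapE sw_tmap; try by multilin.
  rewrite std_comulE (cast_irr _ (esym (mulgV x))).
  by apply: eq_sw => u v; rewrite !comp_lfunE id_lfunE (cast_irr _ (invgK x)).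
- by move=> x y z e; case: z / e; rewrite std_comulE cast_id (piv_Delta g).
- move=> x y e e' a; have ey : (x^-1)%g = y by exact: invg_uniq.
  case: y / ey e e' => e e'.
  by rewrite !comp_lfunE cast_id (cast_irr _ (invgK x)) (piv_SS g).
Defined.

Definition cop : gHopf H := coop std.

Lemma right_integralP mu : right_integral (H := H) mu <-> right_int std mu.
Proof.
split=> muI x y.
  move=> z e; case: z / e => a; have := muI x y a; rewrite /tunitl sw_tmap; try by multilin.
  move=> <-; rewrite [comul _ a]std_comulE cast_id.
  by apply: eq_sw => u v; rewrite id_lfunE.
move=> a; rewrite /tunitl sw_tmap; try by multilin.
rewrite -(muI x y _ erefl a) [comul _ a]std_comulE cast_id.
by apply: eq_sw => u v; rewrite id_lfunE.
Qed.

Lemma left_integralP mu : left_integral (H := H) mu <-> right_int cop mu.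
Proof.
split=> muI.
  move=> x y z e; case: z / e => a; have := muI y x a; rewrite /tunitr sw_tmap; try by multilin.
  move=> <-; rewrite [comul _ a]comp_lfunE [comul _ a]std_comulE cast_id sw_flip; try by multilin.
  by apply: eq_sw => u v; rewrite id_lfunE.
move=> x y a; rewrite /tunitr sw_tmap; try by multilin.
rewrite -(muI y x _ erefl a) [comul _ a]comp_lfunE [comul _ a]std_comulE cast_id sw_flip;
  try by multilin.
by apply: eq_sw => u v; rewrite id_lfunE.
Qed.

Lemma sym_rightP m : sym_right_integral g m <-> sym_rint std m.
Proof. by split=> -[mu /right_integralP muI mE]; exists mu. Qed.

Lemma sym_leftP m : sym_left_integral g m <-> sym_rint cop m.
Proof. by split=> -[mu /left_integralP muI mE]; exists mu. Qed.

Lemma RmapE (nu : grouplike H) (x : G) a : Rmap nu x a = Rtwist (Q := std) nu a.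
Proof.
rewrite !comp_lfunE /tunitl sw_tmap; try by multilin.
rewrite /Rtwist [comul _ a]std_comulE (cast_irr _ (esym (mul1g x))).
by apply: eq_sw => u v; rewrite id_lfunE.
Qed.

Lemma LmapE (nu : grouplike H) (x : G) a : Lmap nu x a = Rtwist (Q := cop) nu a.
Proof.
rewrite !comp_lfunE /tunitr sw_tmap; try by multilin.
rewrite /Rtwist [comul _ a]comp_lfunE [comul _ a]std_comulE sw_flip; try by multilin.
rewrite (cast_irr _ (esym (mulg1 x))).
by apply: eq_sw => u v; rewrite id_lfunE.
Qed.

Lemma htensor_ind (x y : G) (V : hmod H x) (W : hmod H y) a t :
  hact (htensor V W) a t = tact (Q := std) erefl (hact V) (hact W) a t.
Proof.
have -> : tact (Q := std) erefl (hact V) (hact W) a =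
    tensrep (hact V) (hact W) (std_comul erefl a) by rewrite comp_lfunE.
by rewrite std_comulE cast_id comp_lfunE.
Qed.

(** Exchanging the factors identifies the tensor product of [V] and [W] with the
    tensor product of [W] and [V] over the co-opposite. *)
Lemma htensor_cop (x y : G) (V : hmod H x) (W : hmod H y) a t :
  tflip V W (hact (htensor V W) a t) =
  tact (Q := cop) erefl (hact W) (hact V) a (tflip V W t).
Proof.
rewrite htensor_ind -{1}(sw_id t) tact_sw [RHS]tact_sw.
rewrite sw_flip; try by multilin.
rewrite lfun_sw sw_id; apply: eq_sw => v w.
rewrite lfun_sw [X in _ = tlift _ X]comp_lfunE sw_flip; try by multilin.
by apply: eq_sw => p q; rewrite tflip_tens.
Qed.
End Standard.

Section Objects.
Variables (K : fieldType) (G : groupType) (H : hopfGcoalg K G).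
Implicit Types A B P : hobj H.

Lemma hmap_ext A B (f f' : hmap A B) : hmap_eq f f' -> f = f'.
Proof.
move=> e; apply: functional_extensionality_dep => i.
by apply: functional_extensionality_dep => j; exact: e.
Qed.

Lemma hact1 (x : G) (M : hmod H x) v : hact M (aone _) v = v.
Proof. by rewrite (hact_alg M).1 id_lfunE. Qed.

Lemma hactM (x : G) (M : hmod H x) a b v : hact M (a ** b) v = hact M a (hact M b v).
Proof. by rewrite (hact_alg M).2 comp_lfunE. Qed.

Lemma hhom_neq A B (f : hmap A B) i j : hhom f -> hdeg i <> hdeg j -> f i j = 0.
Proof. by move=> /(_ i j)[f0 _]; exact: f0. Qed.

Lemma hhom_eq A B (f : hmap A B) i j (e : hdeg i = hdeg j) a v : hhom f ->
  f i j (hact (A i) a v) = hact (B j) (cast H e a) (f i j v).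
Proof. by move=> /(_ i j)[_]; apply. Qed.

Lemma hhom_diag A (phi : algendo H) (f : hmap A (otwist phi A)) i a v : hhom f ->
  f i i (hact (A i) a v) = hact (A i) (phi _ a) (f i i v).
Proof.
move=> fh; have := @hhom_eq A (otwist phi A) f i i erefl a v fh.
by rewrite cast_id /= comp_lfunE.
Qed.

Lemma hhom_comp A B C (f : hmap B C) (h : hmap A B) : hhom f -> hhom h -> hhom (hcomp f h).
Proof.
move=> fh hh i k; split=> [ne|e a v].
  rewrite /hcomp big1 // => j _; apply/lfunP => v; rewrite comp_lfunE zero_lfunE.
  have [e|e] := hdeg i =P hdeg j; last by rewrite (hhom_neq hh e) zero_lfunE linear0.
  by rewrite (hhom_neq fh) ?zero_lfunE // -e.
rewrite /hcomp !sum_lfunE linear_sum; apply: eq_bigr => j _ /=; rewrite !comp_lfunE.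
have [e1|e1] := hdeg i =P hdeg j; last by rewrite (hhom_neq hh e1) !zero_lfunE !linear0.
have e2 : hdeg j = hdeg k by rewrite -e1.
by rewrite (hhom_eq e1 _ _ hh) (hhom_eq e2 _ _ fh) (castC _ _ e).
Qed.

Lemma algendo_cast (phi : algendo H) (x y : G) (e : x = y) a :
  phi y (cast H e a) = cast H e (phi x a).
Proof. by case: y / e; rewrite !cast_id. Qed.

Lemma otwistE (phi : algendo H) A (i : hidx A) b w :
  hact (otwist phi A i) b w = hact (A i) (phi _ b) w.
Proof. by rewrite comp_lfunE. Qed.

Lemma hhom_twist (phi : algendo H) A B (f : hmap A B) :
  hhom f -> hhom (@otwist_map K G H phi A B f).
Proof.
move=> fh i j; split=> [ne|e a v]; first by rewrite /otwist_map (hhom_neq fh ne).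
by rewrite !otwistE algendo_cast /otwist_map (@hhom_eq A B f i j e _ _ fh).
Qed.

(** ** Homogeneous objects, inclusions and projections *)

Definition osingle (x : G) (M : hmod H x) : hobj H := @Hobj K G H unit _ (fun=> M).

Lemma single_comp A B (x : G) (M : hmod H x) (f : hmap (osingle M) B)
    (h : hmap A (osingle M)) :
  hcomp f h = (fun i j => f tt j \o h i tt)%VF.
Proof. by apply: hmap_ext => i j; rewrite /hcomp (bigD1 tt) //= big1 ?addr0 // => -[]. Qed.

Definition hin P (i : hidx P) : hmap (osingle (P i)) P := fun _ j =>
  if i =P j is ReflectT e then ecast k 'Hom(P i, P k) e \1%VF else 0.
Definition hout P (i : hidx P) : hmap P (osingle (P i)) := fun j _ =>
  if i =P j is ReflectT e then ecast k 'Hom(P k, P i) e \1%VF else 0.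

Arguments hin {P} i _ _.
Arguments hout {P} i _ _.

Lemma hin_id P (i : hidx P) u : hin i u i = \1%VF.
Proof. by rewrite /hin; case: eqP => // e; rewrite (eq_irrelevance e erefl). Qed.
Lemma hin_ne P (i j : hidx P) u : i != j -> hin i u j = 0.
Proof. by rewrite /hin; case: eqP. Qed.
Lemma hout_id P (i : hidx P) u : hout i i u = \1%VF.
Proof. by rewrite /hout; case: eqP => // e; rewrite (eq_irrelevance e erefl). Qed.
Lemma hout_ne P (i j : hidx P) u : i != j -> hout i j u = 0.
Proof. by rewrite /hout; case: eqP. Qed.

Lemma hin_hhom P (i : hidx P) : hhom (hin i).
Proof.
move=> u j; have [ij|ij] := eqVneq i j; last first.
  by rewrite hin_ne //; split=> // e a v; rewrite !zero_lfunE linear0.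
case: j / ij; rewrite hin_id; split=> // e a v.
by rewrite !id_lfunE cast_id.
Qed.

Lemma hout_hhom P (i : hidx P) : hhom (hout i).
Proof.
move=> j u; have [ij|ij] := eqVneq i j; last first.
  by rewrite hout_ne //; split=> // e a v; rewrite !zero_lfunE linear0.
case: j / ij; rewrite hout_id; split=> // e a v.
by rewrite !id_lfunE cast_id.
Qed.

Arguments hin_hhom {P} i.
Arguments hout_hhom {P} i.

Lemma comp_hin P B (i : hidx P) (f : hmap P B) : hcomp f (hin i) = fun _ => f i.
Proof.
apply: hmap_ext => u j; rewrite /hcomp (bigD1 i) //= hin_id comp_lfun1r big1 ?addr0 //.
by move=> k ki; rewrite hin_ne 1?eq_sym // comp_lfun0r.
Qed.

(** ** Projective objects are those with dual bases *)

(** The summand [P_i] is covered by one copy of the regular module for each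
    vector of a basis, and the projection of [P] to [P_i] lifts to the cover. *)
Lemma dual_system_of_projective P (i : hidx P) : projective P -> has_dual_system (hact (P i)).
Proof.
move=> Pp.
pose A := @Hobj K G H 'I_(\dim {:P i}) _ (fun=> hregular H (hdeg i)).
pose p : hmap A (osingle (P i)) := fun k _ => linfun (fun a => hact (P i) a (bas k)).
have pE k u a : p k u a = hact (P i) a (bas k) by rewrite lin_linfun //; multilin.
have ph : hhom p.
  move=> k u; split=> // e a v.
  by rewrite !pE /= lmulE hactM cast_id.
have pe : epi p.
  move=> C f f' _ _ ff [] l; apply/lfunP => v.
  rewrite [v]bas_sum !linear_sum; apply: eq_bigr => k _; rewrite !linearZ; congr (_ *: _).
  have /lfunP/(_ (aone _)) := ff k l.
  by rewrite !single_comp !comp_lfunE pE hact1.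
have [q qh pq] := Pp _ _ p (hout i) ph pe (hout_hhom i).
pose s (k : 'I_(\dim {:P i})) : 'Hom(P i, H (hdeg i)) := q i k.
apply: (dual_system_exists (e := @bas K (P i)) (s := s)); split=> [k b v|v].
  rewrite /s (@hhom_eq P A q i k erefl _ _ qh) cast_id.
  exact: lmulE.
have /lfunP/(_ v) := pq i tt; rewrite hout_id id_lfunE sum_lfunE => {2}<-.
by apply: eq_bigr => k _; rewrite comp_lfunE pE.
Qed.

(** The coinduced module [Hom(H_x, k)] with [(a xi)(h) = xi(h a)]. *)
Definition coind_act (x : G) : 'Hom(H x, 'End('Hom(H x, K^o))) :=
  linfun (fun a => linfun (fun xi : 'Hom(H x, K^o) =>
    linfun (fun h => xi (h ** a)) : 'Hom(H x, K^o))).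

Lemma coind_actE (x : G) a xi h : @coind_act x a xi h = xi (h ** a).
Proof.
have l1 a' (xi' : 'Hom(H x, K^o)) h' :
    (linfun (fun h => xi' (h ** a')) : 'Hom(H x, K^o)) h' = xi' (h' ** a').
  by rewrite lin_linfun //; multilin.
have l2 a' (xi' : 'Hom(H x, K^o)) h' : (linfun (fun xi : 'Hom(H x, K^o) =>
    linfun (fun h => xi (h ** a')) : 'Hom(H x, K^o)) : 'End('Hom(H x, K^o))) xi' h' =
    xi' (h' ** a').
  rewrite lin_linfun ?l1 // => k u v; apply/lfunP => b.
  by rewrite add_lfunE scale_lfunE !l1 add_lfunE scale_lfunE.
rewrite /coind_act lin_linfun ?l2 // => k u v; apply/lfunP => b; apply/lfunP => d.
rewrite add_lfunE scale_lfunE add_lfunE scale_lfunE !l2.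
by rewrite (amul_bilin _).2 linearP.
Qed.

Lemma coind_alg (x : G) : @alg_map K (H x) (EndA 'Hom(H x, K^o)) (@coind_act x).
Proof.
split=> [|a b]; apply/lfunP => xi; apply/lfunP => h.
  by rewrite coind_actE amul1r id_lfunE.
by rewrite comp_lfunE !coind_actE amulA.
Qed.

Definition coind (x : G) : hmod H x := Hmod (@coind_alg x).

Definition coind_map (x y : G) (e : x = y) (N : hmod H y) (Z : 'Hom(N, K^o)) :
  'Hom(N, coind x) :=
  linfun (fun v => linfun (fun h => Z (hact N (cast H e h) v)) : 'Hom(H x, K^o)).

Lemma coind_mapE (x y : G) (e : x = y) (N : hmod H y) (Z : 'Hom(N, K^o)) v h :
  (coind_map e Z v : 'Hom(H x, K^o)) h = Z (hact N (cast H e h) v).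
Proof.
have l1 v' h' : (linfun (fun h => Z (hact N (cast H e h) v')) : 'Hom(H x, K^o)) h' =
    Z (hact N (cast H e h') v') by rewrite lin_linfun //; multilin.
rewrite /coind_map lin_linfun ?l1 // => k u u'; apply/lfunP => c.
by rewrite add_lfunE scale_lfunE !l1 linearP linearP.
Qed.

(** If some degree [x] family [w] is not in the image of [p], a functional
    separating it from the image defines a nonzero map to [coind x] that
    vanishes on the image of [p]. *)
Lemma epi_surj A B (p : hmap A B) (x : G) (w : forall b, B b) : hhom p -> epi p ->
  exists u : forall a, A a, forall b, hdeg b = x -> \sum_a p a b (u a) = w b.
Proof.
move=> ph pe.
pose SB := {b : hidx B & 'I_(\dim {:B b})}.
pose U : vectType K := {ffun SB -> K^o}.
pose vec (v : forall b, B b) : U :=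
  [ffun t => if hdeg (tag t) == x then cobas (tagged t) (v (tag t)) else 0].
pose L a : 'Hom(A a, U) := linfun (fun u => vec (fun b => p a b u)).
have LE a u : L a u = vec (fun b => p a b u).
  rewrite lin_linfun // => k u' v; apply/ffunP => t; rewrite !ffunE.
  by case: ifP => _; rewrite ?linearP // scaler0 addr0.
have vecI v v' b : vec v = vec v' -> hdeg b = x -> v b = v' b.
  move=> /ffunP vv bx; rewrite (bas_sum (v b)) (bas_sum (v' b)); apply: eq_bigr => k _.
  by have := vv (Tagged (fun b => 'I_(\dim {:B b})) k); rewrite !ffunE /= (introT eqP bx) => ->.
have [wV|wV] := boolP (vec w \in (\sum_a limg (L a))%VS).
  have /memv_sumP[ys yL wy] := wV.
  exists (fun a => (L a)^-1%VF (ys a)) => b bx.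
  apply: (vecI (fun b => \sum_a p a b _)) => //; rewrite wy; apply/ffunP => t.
  rewrite !ffunE sum_ffunE.
  case: ifP => tx.
    rewrite linear_sum; apply: eq_bigr => a _.
    by rewrite -[ys a in RHS](limg_lfunVK (yL a isT)) LE ffunE tx.
  rewrite big1 // => a _.
  by rewrite -[ys a](limg_lfunVK (yL a isT)) LE ffunE tx.
have [z [zW zw]] := functional_separation wV.
pose dl (t : SB) : U := [ffun t' => ((t' == t)%:R : K^o)].
pose Z b : 'Hom(B b, K^o) := linfun (fun y =>
  \sum_s (cobas s y : K) *: z (dl (Tagged (fun b => 'I_(\dim {:B b})) s))).
have ZE b y : Z b y =
    \sum_s (cobas s y : K) *: z (dl (Tagged (fun b => 'I_(\dim {:B b})) s)).
  by rewrite lin_linfun //; multilin.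
have zvec v : z (vec v) = \sum_(b | hdeg b == x) Z b (v b).
  have -> : vec v = \sum_t (vec v t : K) *: dl t.
    apply/ffunP => t; rewrite sum_ffunE (bigD1 t) //= !ffunE eqxx.
    rewrite big1 ?addr0 => [|t' tt']; first by rewrite /GRing.scale /= mulr1.
    by rewrite !ffunE [t == t']eq_sym (negPf tt') scaler0.
  rewrite linear_sum; under [RHS]eq_bigr do rewrite ZE.
  rewrite (sig_big_dep _ (fun b _ => true)
    (fun b s => (cobas s (v b) : K) *: z (dl (Tagged (fun b => 'I_(\dim {:B b})) s)))).
  rewrite [RHS]big_mkcond /=; apply: eq_bigr => t _; rewrite linearZ /= ffunE andbT.
  by case: t => b s /=; case: ifP => // _; rewrite scale0r.
pose f : hmap B (osingle (coind x)) := fun b _ =>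
  if hdeg b =P x is ReflectT e then coind_map (esym e) (Z b) else 0.
have fE b (e : x = hdeg b) y h :
    (f b tt y : 'Hom(H x, K^o)) h = Z b (hact (B b) (cast H e h) y).
  rewrite /f; case: eqP => [e'|]; last by case.
  by rewrite (cast_irr e (esym e')) coind_mapE.
have f0 b : hdeg b <> x -> f b tt = 0 by rewrite /f; case: eqP.
have fh : hhom f.
  move=> b []; split=> [/f0//|e a v]; apply/lfunP => h.
  rewrite (fE b (esym e)) (coind_actE (cast H e a)) (fE b (esym e)) castM hactM.
  by rewrite (castC e (esym e) erefl) cast_id.
have Lz a u : \sum_(b | hdeg b == x) Z b (p a b u) = 0.
  rewrite -(zvec (fun b => p a b u)) -LE zW // memvE.
  by apply: (subv_trans _ (sumv_sup a _ (subvv _))) => //; rewrite -memvE memv_img ?memvf.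
pose zz : hmap B (osingle (coind x)) := fun _ _ => 0.
have fp0 : hmap_eq (hcomp f p) (hcomp zz p).
  move=> a []; apply/lfunP => u; apply/lfunP => h.
  rewrite /hcomp [in RHS]big1 => [|b _]; last by rewrite /zz comp_lfun0l.
  rewrite !zero_lfunE !sum_lfunE.
  have [ax|ax] := hdeg a =P x; last first.
    rewrite big1 // => b _; rewrite comp_lfunE.
    have [bx|bx] := hdeg b =P x; last by rewrite f0 // !zero_lfunE.
    have ne : hdeg a <> hdeg b by rewrite bx.
    by rewrite (hhom_neq ph ne) zero_lfunE linear0 zero_lfunE.
  rewrite -[RHS](Lz a (hact (A a) (cast H (esym ax) h) u)) [RHS]big_mkcond /=.
  apply: eq_bigr => b _; rewrite comp_lfunE; case: eqP => bx; last by rewrite f0 // !zero_lfunE.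
  have e : hdeg a = hdeg b by rewrite bx.
  by rewrite (fE b (esym bx)) (hhom_eq e _ _ ph) (castC (esym ax) e (esym bx)).
have zh : hhom zz.
  by move=> b l; split=> // e a v; rewrite /zz !zero_lfunE linear0.
have f00 := pe _ _ _ fh zh fp0.
have : z (vec w) = 0; last by rewrite zw => /eqP; rewrite oner_eq0.
rewrite zvec big1 // => b /eqP bx.
have := fE b (esym bx) (w b) (aone _); rewrite cast1 hact1 => <-.
by rewrite (f00 b tt) /zz !zero_lfunE.
Qed.

(** A lift sends [v] to [sum_k s_k(v) u_k], where [u_k] is a simultaneous preimage
    of the values of [f] at the basis vector [e_k]. *)
Lemma projective_of_dual_system P : (forall i, has_dual_system (hact (P i))) -> projective P.
Proof.
move=> dP A B p f ph pe fh.
pose n (i : hidx P) := \dim {:P i}.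
pose s i := dual_coords (hact (P i)).
have uP i (k : 'I_(n i)) := epi_surj (hdeg i) (fun b => f i b (bas k)) ph pe.
pose u i k := sval (constructive_indefinite_description _ (uP i k)).
have uE i k b : hdeg b = hdeg i -> \sum_a p a b (u i k a) = f i b (bas k).
  by rewrite /u; case: constructive_indefinite_description => u' /= /(_ b).
pose q : hmap P A := fun i a =>
  if hdeg i =P hdeg a is ReflectT e then
    linfun (fun v => \sum_k hact (A a) (cast H e (s i k v)) (u i k a))
  else 0.
have qE i a (e : hdeg i = hdeg a) v :
    q i a v = \sum_k hact (A a) (cast H e (s i k v)) (u i k a).
  rewrite /q; case: eqP => [e'|]; last by case.
  rewrite (eq_irrelevance e' e) lin_linfun //; multilin.
have q0 i a : hdeg i <> hdeg a -> q i a = 0 by rewrite /q; case: eqP.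
exists q.
  move=> i a; split=> [/q0//|e c v]; rewrite !qE linear_sum; apply: eq_bigr => k _ /=.
  by rewrite /s (dP i).1 castM hactM.
move=> i b; apply/lfunP => v; rewrite /hcomp sum_lfunE.
have [e|ne] := hdeg i =P hdeg b; last first.
  rewrite (hhom_neq fh ne) zero_lfunE big1 // => a _; rewrite comp_lfunE.
  have [ea|nea] := hdeg i =P hdeg a; last by rewrite q0 // zero_lfunE linear0.
  have nab : hdeg a <> hdeg b by rewrite -ea.
  by rewrite (hhom_neq ph nab) zero_lfunE.
transitivity (\sum_k \sum_a hact (B b) (cast H e (s i k v)) (p a b (u i k a))).
  rewrite exchange_big; apply: eq_bigr => a _ /=; rewrite comp_lfunE.
  have [ea|nea] := hdeg i =P hdeg a; last first.
    have nab : hdeg a <> hdeg b by rewrite -e => /esym.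
    by rewrite q0 // (hhom_neq ph nab) zero_lfunE big1 // => k _; rewrite zero_lfunE linear0.
  have eab : hdeg a = hdeg b by rewrite -ea.
  rewrite (qE i a ea) linear_sum; apply: eq_bigr => k _ /=.
  by rewrite (hhom_eq eab _ _ ph) (castC ea eab e).
rewrite -{2}((dP i).2 v) linear_sum; apply: eq_bigr => k _ /=.
by rewrite -linear_sum uE // (hhom_eq e _ _ fh).
Qed.
End Objects.

Arguments hin {K G H P} i _ _.
Arguments hout {K G H P} i _ _.
Arguments hin_hhom {K G H P} i.
Arguments hout_hhom {K G H P} i.

(** * Cyclic traces on projective objects *)

Section Traces.
Variables (K : fieldType) (G : groupType) (H : hopfGcoalg K G).
Variable phi : algendo H.
Implicit Types (P A B : hobj H) (m : gfunctional H) (t : trfamily phi).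

Definition twisted_comm m : Prop := forall x a b, m x (a ** b) = m x (phi x b ** a).

Definition ftrace m : trfamily phi :=
  fun P f => \sum_i dual_trace (m (hdeg i)) (hact (P i)) (f i i).

Definition twmul (x : G) (a : H x) : 'End(H x) := linfun (fun h => phi x h ** a).

Lemma twmulE (x : G) (a h : H x) : twmul a h = phi x h ** a.
Proof. by rewrite lin_linfun //; multilin. Qed.

Definition twmap (x : G) (a : H x) : hmap (oregular H x) (otwist phi (oregular H x)) :=
  fun _ _ => twmul a.

Lemma twmap_hhom (x : G) (a : H x) : hhom (twmap a).
Proof.
move=> [] []; split=> // e b v.
by rewrite otwistE cast_id /twmap !twmulE /= !lmulE (ae_alg phi x).2 amulA.
Qed.

Definition trform t : gfunctional H := fun x =>
  linfun (fun a => (t (oregular H x) (twmap a) : K^o)).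

Lemma osingle_projective (x : G) (M : hmod H x) :
  has_dual_system (hact M) -> projective (osingle M).
Proof. by move=> dM; apply: projective_of_dual_system => -[]. Qed.

Lemma oregular_projective (x : G) : projective (oregular H x).
Proof. by apply: projective_of_dual_system => -[];
  exact: (dual_system_exists (dual_system_reg _)). Qed.

Section FromTrace.
Variable t : trfamily phi.
Arguments t : clear implicits.
Hypotheses (tl : tr_linear t) (tc : tr_cyclic t).

Lemma hmap0_hhom A B : hhom ((fun _ _ => 0) : hmap A B).
Proof. by move=> i j; split=> // e a v; rewrite !zero_lfunE linear0. Qed.

Lemma tr0 P : projective P -> t P (fun _ _ => 0) = 0.
Proof.
move=> Pp; have h0 := @hmap0_hhom P (otwist phi P).
have := tl (-1) Pp h0 h0.
have -> : hlincomb (-1) (fun _ _ => 0) (fun _ _ => 0) =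
    ((fun _ _ => 0) : hmap P (otwist phi P)).
  by apply: hmap_ext => i j; rewrite /hlincomb scaler0 addr0.
by rewrite mulN1r addNr.
Qed.

Lemma hhom_sum A B (I : finType) (f : I -> hmap A B) (s : seq I) :
  (forall k, hhom (f k)) -> hhom ((fun i j => \sum_(k <- s) f k i j) : hmap A B).
Proof.
move=> fh i j; split=> [ne|e a v].
  by rewrite big1 // => k _; rewrite (hhom_neq (fh k) ne).
rewrite !sum_lfunE linear_sum; apply: eq_bigr => k _ /=.
exact: (hhom_eq e _ _ (fh k)).
Qed.

Lemma tr_sum P (I : finType) (f : I -> hmap P (otwist phi P)) : projective P ->
  (forall k, hhom (f k)) ->
  t P (fun i j => \sum_k f k i j) = \sum_k t P (f k).
Proof.
move=> Pp fh; elim: (index_enum I) => [|k s IH].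
  rewrite big_nil -[RHS](tr0 Pp); congr (t _ _).
  by apply: hmap_ext => i j; rewrite big_nil.
rewrite big_cons -IH -[t P (f k)]mul1r -(tl 1 Pp) //; last exact: hhom_sum.
by congr (t _ _); apply: hmap_ext => i j; rewrite big_cons /hlincomb scale1r.
Qed.

Lemma trformE (x : G) a : trform t x a = t (oregular H x) (twmap a).
Proof.
rewrite lin_linfun // => k u v.
rewrite -[RHS](tl k (@oregular_projective x) (@twmap_hhom x u) (@twmap_hhom x v)).
congr (t _ _); apply: hmap_ext => i j; apply/lfunP => h.
rewrite /hlincomb /twmap add_lfunE scale_lfunE !twmulE.
exact: (amul_bilin _).2.
Qed.

Lemma tr_regular (x : G) (f : hmap (oregular H x) (otwist phi (oregular H x))) : hhom f ->
  t (oregular H x) f = trform t x (f tt tt (aone _)).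
Proof.
move=> fh; rewrite trformE; congr (t _ _); apply: hmap_ext => -[] []; apply/lfunP => h.
have := @hhom_diag K G H (oregular H x) phi f tt h (aone _) fh.
by rewrite /= !lmulE amul1r twmulE.
Qed.

(** The values [m_x(ab)] and [m_x(phi(b) a)] are the traces of the two
    composites of a right multiplication with a twisted one. *)
Lemma trform_twisted_comm : twisted_comm (trform t).
Proof.
move=> x a b.
pose r : hmap (oregular H x) (oregular H x) := fun _ _ => (linfun (fun h : H x => h ** b)).
have rE i j h : r i j h = h ** b by rewrite lin_linfun //; multilin.
have rh : hhom r.
  by move=> [] []; split=> // e c v; rewrite !rE cast_id /= !lmulE amulA.
have rp := @oregular_projective x.
have := tc rp rp rh (@twmap_hhom x a).
have -> : hcomp (twmap a) r = twmap (phi x b ** a).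
  rewrite single_comp; apply: hmap_ext => i j; apply/lfunP => h.
  by rewrite comp_lfunE rE !twmulE (ae_alg phi x).2 amulA.
have -> : hcomp (otwist_map r) (twmap a) = twmap (a ** b).
  rewrite (@single_comp K G H (oregular H x) _ x (htwist phi (hregular H x))).
  apply: hmap_ext => i j; apply/lfunP => h.
  by rewrite comp_lfunE rE !twmulE amulA.
by rewrite !trformE.
Qed.

Lemma tr_single (x : G) (M : hmod H x) (f : 'End(M)) : has_dual_system (hact M) ->
  (forall a v, f (hact M a v) = hact M (phi x a) (f v)) ->
  t (osingle M) (fun _ _ => f) = dual_trace (trform t x) (hact M) f.
Proof.
move=> dM fl; have Mp := osingle_projective dM; have rp := @oregular_projective x.
pose s k : hmap (osingle M) (oregular H x) := fun _ _ => (dual_coords (hact M) k).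
pose r k : hmap (oregular H x) (osingle M) := fun _ _ => (linfun (fun h => hact M h (bas k))).
have rE k i j h : r k i j h = hact M h (bas k) by rewrite lin_linfun //; multilin.
have sh k : hhom (s k).
  by move=> [] []; split=> // e a v; rewrite cast_id /s dM.1 /= lmulE.
have rh k : hhom (r k).
  by move=> [] []; split=> // e a v; rewrite cast_id !rE /= lmulE hactM.
have fh : hhom ((fun _ _ => f) : hmap (osingle M) (otwist phi (osingle M))).
  by move=> [] []; split=> // e a v; rewrite otwistE cast_id fl.
pose fr k : hmap (oregular H x) (otwist phi (osingle M)) :=
  hcomp ((fun _ _ => f) : hmap (osingle M) (otwist phi (osingle M))) (r k).
have frh k : hhom (fr k) by apply: hhom_comp.
transitivity (\sum_k t (osingle M) (hcomp (fr k) (s k))).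
  rewrite -tr_sum //; last by move=> k; apply: hhom_comp.
  congr (t _ _); apply: hmap_ext => i j; apply/lfunP => v.
  rewrite sum_lfunE -{1}(dM.2 v) linear_sum; apply: eq_bigr => k _ /=.
  by rewrite /fr !single_comp !comp_lfunE rE.
apply: eq_bigr => k _; rewrite (tc Mp rp (sh k) (frh k)) tr_regular.
  rewrite (@single_comp K G H (oregular H x) _ x (htwist phi M)) /fr single_comp.
  by rewrite !comp_lfunE rE hact1.
by apply: hhom_comp => //; exact: hhom_twist.
Qed.

(** Decomposing the identity of [P] along its summands, and the identity of
    each summand along a dual basis, cyclicity reduces [t] to regular modules. *)
Lemma tr_ftrace : tr_eq t (ftrace (trform t)).
Proof.
move=> P f Pp fh; have dP i := dual_system_of_projective i Pp.
have sp i := osingle_projective (dP i).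
transitivity (\sum_i t P (hcomp (hcomp f (hin i)) (hout i))).
  rewrite -tr_sum //; last first.
    by move=> i; apply: hhom_comp (hout_hhom i); apply: hhom_comp (hin_hhom i).
  congr (t _ _); apply: hmap_ext => i j; apply/lfunP => v.
  rewrite sum_lfunE (bigD1 i) //= big1 ?addr0 => [|k ki]; last first.
    by rewrite comp_hin single_comp hout_ne // comp_lfun0r zero_lfunE.
  by rewrite comp_hin single_comp hout_id comp_lfun1r.
apply: eq_bigr => i _.
rewrite (tc Pp (sp i) (hout_hhom i) (hhom_comp fh (hin_hhom i))).
rewrite -tr_single //; last by move=> a v; exact: (@hhom_diag K G H P phi f i a v fh).
congr (t _ _); rewrite comp_hin.
apply: hmap_ext => u j; rewrite /hcomp (bigD1 i) //= /otwist_map hout_id comp_lfun1l.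
rewrite big1 ?addr0 // => k ki.
by rewrite hout_ne 1?eq_sym // comp_lfun0l.
Qed.
End FromTrace.

(** ** The trace of a family of functionals *)

Section FromForm.
Variable m : gfunctional H.
Hypothesis mC : twisted_comm m.

Lemma ftrace_linear : tr_linear (ftrace m).
Proof.
move=> P k f f' _ _ _; rewrite mulr_sumr -big_split; apply: eq_bigr => i _ /=.
exact: dual_trace_linear.
Qed.

(** Cyclicity for summands of possibly different degrees; if the degrees differ,
    both composites vanish. *)
Lemma dual_trace_graded (x y : G) (M : hmod H x) (N : hmod H y)
    (h : 'Hom(M, N)) (f : 'Hom(N, M)) :
  has_dual_system (hact M) -> has_dual_system (hact N) ->
  (x <> y -> h = 0) -> (x <> y -> f = 0) ->
  (forall (e : x = y) a v, h (hact M a v) = hact N (cast H e a) (h v)) ->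
  (forall (e : y = x) a v, f (hact N a v) = hact M (phi x (cast H e a)) (f v)) ->
  dual_trace (m x) (hact M) (f \o h)%VF = dual_trace (m y) (hact N) (h \o f)%VF.
Proof.
move=> dM dN h0 f0 hl fl; have [e|ne] := x =P y; last first.
  rewrite h0 // f0 // !comp_lfun0r /dual_trace !big1 // => k _;
    by rewrite zero_lfunE !linear0.
case: y / e N h f dN h0 f0 hl fl => N h f dN h0 f0 hl fl.
apply: (@dual_trace_cyclic K (H x) (m x) (phi x) _ _ (hact M) (hact N) h f (@mC x) dM dN) => b v;
  first by rewrite (hl erefl) cast_id.
by rewrite (fl erefl) cast_id.
Qed.

Lemma ftrace_cyclic : tr_cyclic (ftrace m).
Proof.
move=> P P' h f Pp P'p hh fh.
have dP i := dual_system_of_projective i Pp; have dP' i := dual_system_of_projective i P'p.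
rewrite /ftrace.
transitivity (\sum_i \sum_j dual_trace (m (hdeg i)) (hact (P i)) (f j i \o h i j)%VF).
  by apply: eq_bigr => i _; rewrite -dual_trace_sum.
rewrite exchange_big; apply: eq_bigr => j _ /=; rewrite [RHS]dual_trace_sum.
apply: eq_bigr => i _; apply: dual_trace_graded => //.
- exact: hhom_neq hh.
- by move=> ne; apply: (hhom_neq fh) => e; apply: ne.
- by move=> e a v; exact: (hhom_eq e _ _ hh).
- move=> e a v; have := @hhom_eq K G H _ _ f j i e a v fh.
  by rewrite otwistE.
Qed.

Lemma ftrace_regular (x : G) (f : hmap (oregular H x) (otwist phi (oregular H x))) :
  hhom f -> ftrace m f = m x (f tt tt (aone _)).
Proof.
move=> fh; rewrite /ftrace (bigD1 tt) //= big1 ?addr0 => [|[] //].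
rewrite (dual_traceE (@mC x) (dual_system_reg _)); last first.
  by move=> b w; exact: (@hhom_diag K G H (oregular H x) phi f tt b w fh).
by rewrite (bigD1 tt) //= big1 ?addr0 => [|[] //]; rewrite id_lfunE.
Qed.

Lemma ftrace_twmap (x : G) (a : H x) : ftrace m (twmap a) = m x a.
Proof.
rewrite ftrace_regular; last exact: twmap_hhom.
by rewrite twmulE (ae_alg phi x).1 amul1l.
Qed.

End FromForm.

Lemma ftrace_lin_form k m m' P (f : hmap P (otwist phi P)) :
  ftrace (fun x => k *: m x + m' x) f = k * ftrace m f + ftrace m' f.
Proof.
rewrite /ftrace mulr_sumr -big_split; apply: eq_bigr => i _; exact: dual_trace_linear_form.
Qed.

(** Traces and functionals determine each other, so it remains to match the
    defining conditions of [T] and [I]. *)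
Lemma tr_iso_ftrace (T : trfamily phi -> Prop) (I : gfunctional H -> Prop) :
  (forall m, I m -> twisted_comm m) -> (forall m, I m -> T (ftrace m)) ->
  (forall t, T t -> tr_linear t /\ tr_cyclic t) -> (forall t, T t -> I (trform t)) ->
  tr_iso T I.
Proof.
move=> IC IT TC TI; exists ftrace; split.
- by move=> m Im; split; [exact: IT | move=> x f fh; exact: ftrace_regular (IC m Im) _ _ fh].
- by move=> k m m' _ _ P f _ _; exact: ftrace_lin_form.
- move=> m m' Im Im' mm x; apply/lfunP => a.
  rewrite -(ftrace_twmap (IC _ Im)) -(ftrace_twmap (IC _ Im')).
  by apply: mm; [exact: oregular_projective | exact: twmap_hhom].
- move=> t Tt; exists (trform t); first exact: TI.
  by have [tl tc] := TC t Tt; exact: tr_ftrace.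
- move=> m t Im Tt tm P f Pp fh; have [tl tc] := TC t Tt.
  rewrite (tr_ftrace tl tc Pp fh); suff -> : trform t = m by [].
  apply: functional_extensionality_dep => x; apply/lfunP => a.
  rewrite (trformE tl) tm; last exact: twmap_hhom.
  by rewrite /twmap twmulE (ae_alg phi x).1 amul1l.
Qed.

Lemma tr_nondegenerate_eq t t' :
  tr_eq t t' -> tr_nondegenerate t' -> tr_nondegenerate t.
Proof.
move=> tt' nd P P' Pp P'p; have [n1 n2] := nd P P' Pp P'p.
by split=> [f fh f0|h hh h0]; [apply: n1 | apply: n2] => // k kh;
  rewrite -tt' ?f0 ?h0 //; exact: hhom_comp.
Qed.

(** ** Non-degeneracy *)

Section Nondegenerate.
Variable m : gfunctional H.
Hypothesis mC : twisted_comm m.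
Hypothesis mN : forall x a, (forall b, m x (a ** b) = 0) -> a = 0.

(** The map between direct sums with the single nonzero entry [h]. *)
Let blk A B (i : hidx A) (j : hidx B) (h : 'Hom(A i, B j)) : hmap A B :=
  hcomp (hcomp (hin j) ((fun _ _ => h) : hmap (osingle (A i)) (osingle (B j)))) (hout i).

Lemma blk_hhom A B (i : hidx A) (j : hidx B) (h : 'Hom(A i, B j)) :
  (forall (e : hdeg i = hdeg j) a v, h (hact (A i) a v) = hact (B j) (cast H e a) (h v)) ->
  hdeg i = hdeg j -> hhom (blk h).
Proof.
move=> hl e; apply: hhom_comp (hout_hhom i); apply: hhom_comp (hin_hhom j) _.
by move=> [] []; split=> // e' a v; exact: hl.
Qed.

Lemma comp_blk A B C (i : hidx A) (j : hidx B) (h : 'Hom(A i, B j)) (f : hmap B C) l k :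
  hcomp f (blk h) l k = if l == i then (f j k \o h \o hout i l tt)%VF else 0.
Proof.
have bE l' j' : blk h l' j' = (hin j tt j' \o h \o hout i l' tt)%VF.
  by rewrite /blk !single_comp.
rewrite /hcomp (bigD1 j) //= bE hin_id comp_lfun1l big1 ?addr0 => [|j' jj'].
  rewrite comp_lfunA; case: eqP => // /eqP li.
  by rewrite hout_ne 1?eq_sym // comp_lfun0r.
by rewrite bE hin_ne 1?eq_sym // !comp_lfun0l comp_lfun0r.
Qed.

Lemma ftrace_blk A B (i : hidx A) (j : hidx B) (h : 'Hom(A i, B j))
    (f : hmap B (otwist phi A)) :
  ftrace m (hcomp f (blk h)) = dual_trace (m (hdeg i)) (hact (A i)) (f j i \o h)%VF.
Proof.
rewrite /ftrace (bigD1 i) //= big1 ?addr0 => [|l li].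
  by rewrite comp_blk eqxx hout_id comp_lfun1r.
rewrite comp_blk (negPf li) /dual_trace big1 // => k _.
by rewrite zero_lfunE !linear0.
Qed.

Lemma dual_trace_rank1 (x : G) (M : hmod H x) k a u (F : 'End(M)) : has_dual_system (hact M) ->
  (forall v, F v = hact M (phi x (dual_coords (hact M) k v ** a)) u) ->
  dual_trace (m x) (hact M) F = m x (dual_coords (hact M) k u ** a).
Proof.
move=> dM FE; rewrite -{1}(dM.2 u) linear_sum (linS _ (f := fun b => b ** a)); last by multilin.
rewrite linear_sum; apply: eq_bigr => l _ /=.
by rewrite FE !dM.1 -mC amulA.
Qed.

Lemma dual_coords_eq0 (x : G) (M : hmod H x) u : has_dual_system (hact M) ->
  (forall k a, m x (dual_coords (hact M) k u ** a) = 0) -> u = 0.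
Proof.
move=> dM u0; rewrite -(dM.2 u) big1 // => k _.
by rewrite (mN (u0 k)) linear0 zero_lfunE.
Qed.

(** A nonzero value [u] of [f] is detected by a map [v |-> s_k(v) a w] of rank
    one over the algebra, since the trace of the composite is [m(s_k(u) a)]. *)
Lemma ftrace_nondeg : tr_nondegenerate (ftrace m).
Proof.
move=> P P' Pp P'p.
have dP i := dual_system_of_projective i Pp; have dP' i := dual_system_of_projective i P'p.
split=> [f fh f0|h hh h0].
  move=> j i; have [e|ne] := hdeg i =P hdeg j; last first.
    by rewrite (hhom_neq fh) // => e; apply: ne.
  apply/lfunP => w; rewrite zero_lfunE; apply: (dual_coords_eq0 (dP i)) => k a.
  pose r : 'Hom(P i, P' j) :=
    linfun (fun v => hact (P' j) (cast H e (dual_coords (hact (P i)) k v ** a)) w).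
  have rE v : r v = hact (P' j) (cast H e (dual_coords (hact (P i)) k v ** a)) w.
    by rewrite lin_linfun //; multilin.
  have rl (e' : hdeg i = hdeg j) b v :
      r (hact (P i) b v) = hact (P' j) (cast H e' b) (r v).
    by rewrite !rE (dP i).1 -amulA castM hactM (cast_irr e e').
  have rh := @blk_hhom P P' i j r rl e.
  rewrite -(f0 _ rh) ftrace_blk; symmetry; apply: dual_trace_rank1 (dP i) _ => v.
  rewrite comp_lfunE rE (hhom_eq (esym e) _ _ fh) otwistE.
  by rewrite (castC e (esym e) erefl) cast_id.
move=> i j; have [e|ne] := hdeg i =P hdeg j; last by rewrite (hhom_neq hh).
apply/lfunP => v; rewrite zero_lfunE; apply: (dual_coords_eq0 (dP' j)) => k a.
pose r : 'Hom(P' j, otwist phi P i) := linfun (fun w =>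
  hact (P i) (phi _ (cast H (esym e) (dual_coords (hact (P' j)) k w ** a))) v).
have rE w : r w = hact (P i) (phi _ (cast H (esym e) (dual_coords (hact (P' j)) k w ** a))) v.
  by rewrite lin_linfun //; multilin.
have rl (e' : hdeg j = hdeg i) b w :
    r (hact (P' j) b w) = hact (otwist phi P i) (cast H e' b) (r w).
  rewrite otwistE !rE (dP' j).1 -amulA castM (ae_alg phi _).2 hactM.
  by rewrite (cast_irr (esym e) e').
have rh := @blk_hhom P' (otwist phi P) j i r rl (esym e).
rewrite -(h0 _ rh) (ftrace_cyclic mC Pp P'p hh rh) ftrace_blk; symmetry.
apply: dual_trace_rank1 (dP' j) _ => w.
rewrite comp_lfunE rE /otwist_map (hhom_eq e _ _ hh) -algendo_cast.
by rewrite (castC (esym e) e erefl) cast_id.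
Qed.
End Nondegenerate.
End Traces.

(** * Module traces *)

Section ModuleTraces.
Variables (K : fieldType) (G : groupType) (H : hopfGcoalg K G) (g : pivot H).
Notation std := (std g).
Notation cop := (cop g).

(** On [a], the string of structure maps inserts a basis and its dual, applies
    [f] and evaluates against [g]. *)
Lemma rptrace1E (A B : vectType K) (x : G) (V : hmod H x) (f : 'Hom(tensor A V, tensor B V)) :
  rptrace1 g f = ptr (hact V (g x)) f.
Proof.
apply/lfunP => a; rewrite ptrE.
have cE : coev V (1 : K^o) = \sum_j tens (bas j) (cobas j : dual V).
  by rewrite /coev lin_linfun ?scale1r //; multilin.
rewrite /rptrace1 !comp_lfunE.
have -> : tunitrV A a = tens a (1 : K^o) by rewrite /tunitrV lin_linfun //; multilin.
rewrite tmap_tens id_lfunE cE (linS _ (f := fun t => tens a t)); last by multilin.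
rewrite !linear_sum; apply: eq_bigr => j _ /=.
have -> : tassocV A V (dual V) (tens a (tens (bas j) (cobas j : dual V))) =
    tens (tens a (bas j)) (cobas j : dual V).
  by rewrite /tassocV sw_tens ?sw_tens //; multilin.
rewrite tmap_tens id_lfunE -{1}(sw_id (f _)).
have -> : tassoc B V (dual V) (tens (\sw_(b, w <- f (tens a (bas j))) tens b w) (cobas j : dual
  V)) =
    \sw_(b, w <- f (tens a (bas j))) tens b (tens w (cobas j : dual V)).
  rewrite /tassoc sw_tens; try by multilin.
  by rewrite lfun_sw; apply: eq_sw => b w; rewrite sw_tens //; multilin.
rewrite !lfun_sw; apply: eq_sw => b w; rewrite tmap_tens id_lfunE.
rewrite /evt sw_tens; try by multilin.
by rewrite /tunitr sw_tens //; multilin.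
Qed.

(** The left partial trace inserts [g^-1] before [f]; cyclicity of the usual
    trace on [V] moves it behind [f]. *)
Lemma lptrace1E (A B : vectType K) (x : G) (V : hmod H x) (f : 'Hom(tensor V A, tensor V B)) :
  lptrace1 g f = ptr (hact V (pivV g x)) (tflip V B \o f \o tflip A V)%VF.
Proof.
apply/lfunP => a; rewrite ptrE.
pose h := hact V (pivV g x).
have cE : coevt g V (1 : K^o) = \sum_j tens (cobas j : dual V) (h (bas j)).
  by rewrite /coevt lin_linfun ?scale1r //; multilin.
transitivity (\sum_j \sw_(w, b <- f (tens (h (bas j)) a)) (cobas j w : K) *: b).
  rewrite /lptrace1 !comp_lfunE.
  have -> : tunitlV A a = tens (1 : K^o) a by rewrite /tunitlV lin_linfun //; multilin.
  rewrite tmap_tens id_lfunE cE (linS _ (f := fun t => tens t a)); last by multilin.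
  rewrite !linear_sum; apply: eq_bigr => j _ /=.
  have -> : tassoc (dual V) V A (tens (tens (cobas j : dual V) (h (bas j))) a) =
      tens (cobas j : dual V) (tens (h (bas j)) a).
    by rewrite /tassoc sw_tens ?sw_tens //; multilin.
  rewrite tmap_tens id_lfunE -{1}(sw_id (f _)).
  have -> : tassocV (dual V) V B (tens (cobas j : dual V)
      (\sw_(w, b <- f (tens (h (bas j)) a)) tens w b)) =
      \sw_(w, b <- f (tens (h (bas j)) a)) tens (tens (cobas j : dual V) w) b.
    rewrite /tassocV sw_tens; try by multilin.
    by rewrite lfun_sw; apply: eq_sw => w b; rewrite sw_tens //; multilin.
  rewrite !lfun_sw; apply: eq_sw => w b; rewrite tmap_tens id_lfunE.
  rewrite /ev sw_tens; try by multilin.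
  by rewrite /tunitl sw_tens //; multilin.
(* Both sides are traces over [V] of the map [v |-> f(v (x) a)], with values in
   [B], composed with [h] in the two orders. *)
transitivity (\sum_j \sum_i \sw_(w, b <- f (tens (bas i) a))
    ((cobas i (h (bas j)) : K) * (cobas j w : K)) *: b).
  apply: eq_bigr => j _.
  have l : lin (fun v => \sw_(w, b <- f (tens v a)) (cobas j w : K) *: b) by multilin.
  rewrite {1}[h (bas j)]bas_sum (linS _ l); apply: eq_bigr => i _.
  rewrite (linZ _ _ l) (lin_sw_out (f := fun b => _ *: b)); last by multilin.
  by apply: eq_sw => w b; rewrite scalerA.
rewrite exchange_big; apply: eq_bigr => i _ /=.
rewrite comp_lfunE comp_lfunE tflip_tens sw_flip; try by multilin.
rewrite -sw_sum; apply: eq_sw => w b.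
rewrite [w in RHS]bas_sum !linear_sum scaler_suml; apply: eq_bigr => j _ /=.
by rewrite !linearZ /= mulrC.
Qed.

Lemma htensor_act (x y : G) (V : hmod H x) (W : hmod H y) :
  hact (htensor V W) = tact (Q := std) erefl (hact V) (hact W).
Proof. by apply/lfunP => a; apply/lfunP => t; exact: htensor_ind. Qed.

Lemma htensor_dual_system_r (x y : G) (V : hmod H x) (W : hmod H y) :
  has_dual_system (hact V) -> has_dual_system (hact (htensor V W)).
Proof.
move=> dV; rewrite htensor_act.
have e2 : gmul std (gmul std x y) (y^-1)%g = x by rewrite /= mulgK.
have e : gmul std x y = (x * y)%g by [].
have D := tact_dual_system e (hact_alg W) e2 (mulVg y) (hact_alg V) dV.
have -> : erefl = e by exact: eq_irrelevance.
exact: dual_system_exists D.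
Qed.

Lemma htensor_cop_inv (x y : G) (V : hmod H x) (W : hmod H y) a t :
  tflip W V (tact (Q := cop) erefl (hact W) (hact V) a t) =
  hact (htensor V W) a (tflip W V t).
Proof. by rewrite -{1}(tflipK t) -htensor_cop tflipK. Qed.

Lemma cop_dual_system (x y : G) (V : hmod H x) (W : hmod H y) :
  has_dual_system (hact W) ->
  has_dual_system (tact (Q := cop) (erefl : gmul cop y x = (x * y)%g) (hact W) (hact V)).
Proof.
move=> dW.
have e2 : gmul cop (gmul cop y x) (x^-1)%g = y by rewrite /= mulKg.
have D := tact_dual_system (erefl : gmul cop y x = (x * y)%g) (hact_alg V) e2 (mulgV x) (hact_alg
  W) dW.
exact: dual_system_exists D.
Qed.

Lemma htensor_dual_system_l (x y : G) (V : hmod H x) (W : hmod H y) :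
  has_dual_system (hact W) -> has_dual_system (hact (htensor V W)).
Proof.
move=> /(cop_dual_system V) D; apply: dual_system_exists (dual_system_iso _ _ _ D).
- exact: tflipK.
- exact: htensor_cop.
- exact: htensor_cop_inv.
Qed.

(** The trace is invariant under the exchange isomorphism, by cyclicity. *)
Lemma dual_trace_flip (x y : G) (n : 'Hom(H (x * y)%g, K^o)) 
    (psi : H (x * y)%g -> H (x * y)%g) (V : hmod H x) (W : hmod H y)
    (f : 'End(tensor V W)) : has_dual_system (hact W) ->
  (forall a b, n (a ** b) = n (psi b ** a)) ->
  (forall a t, f (hact (htensor V W) a t) = hact (htensor V W) (psi a) (f t)) ->
  dual_trace n (hact (htensor V W)) f =
  dual_trace n (tact (Q := cop) erefl (hact W) (hact V)) (tflip V W \o f \o tflip W V)%VF.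
Proof.
move=> dW nC fl; have dC := cop_dual_system V dW; have dT := htensor_dual_system_l V dW.
have -> : f = ((f \o tflip W V) \o tflip V W)%VF.
  by apply/lfunP => t; rewrite !comp_lfunE tflipK.
have -> : (tflip V W \o ((f \o tflip W V) \o tflip V W) \o tflip W V)%VF =
    (tflip V W \o (f \o tflip W V))%VF.
  by apply/lfunP => t; rewrite !comp_lfunE tflipK.
apply: (dual_trace_cyclic nC dT dC); first exact: htensor_cop.
have E u : (f \o tflip W V)%VF u = f (tflip W V u) by rewrite comp_lfunE.
by move=> a t; rewrite !E htensor_cop_inv fl.
Qed.

Section WithModulus.
Variable alpha : grouplike H.
Variable c : H 1%g.
Hypotheses (c_neq0 : c != 0) (c_left : left_cointegral c).
Hypothesis c_mod : forall a, c ** a = (alpha a : K) *: c.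

Lemma twisted_comm_right m : sym_rint std m -> twisted_comm (Rtw alpha) m.
Proof.
by move=> ms x a b; rewrite (sym_nakayama (Q := std) c_neq0 c_left c_mod ms) [aefun _ _ _](RmapE
  g).
Qed.

Lemma twisted_comm_left m : sym_rint cop m -> twisted_comm (Ltw alpha) m.
Proof.
by move=> ms x a b; rewrite (sym_nakayama (Q := cop) c_neq0 c_left c_mod ms) [aefun _ _ _](LmapE
  g).
Qed.

Lemma ftrace_right m : sym_rint std m -> right_module_trace g (ftrace (phi := Rtw alpha) m).
Proof.
move=> ms; have mC := twisted_comm_right ms.
split; [exact: ftrace_linear | exact: ftrace_cyclic | move=> P V f Pp fh].
have dP i := dual_system_of_projective i Pp.
transitivity (\sum_i \sum_k dual_trace (m (hdeg i * hdeg k)%g)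
    (hact (htensor (P i) (V k))) (f (i, k) (i, k))).
  by rewrite pair_bigA; apply: eq_bigr => -[].
apply: eq_bigr => i _; rewrite /rptrace dual_trace_sum; apply: eq_bigr => k _.
rewrite rptrace1E htensor_act.
have e2 : gmul std (gmul std (hdeg i) (hdeg k)) (hdeg k)^-1%g = hdeg i by rewrite /= mulgK.
apply: (tact_trace (hact_alg (V k)) e2 (mulVg (hdeg k)) ms (hact_alg (P i)) (dP i) (@mC _)).
move=> a t; rewrite -htensor_act.
exact: (@hhom_diag K G H (otensor P V) (Rtw alpha) f (i, k) a t fh).
Qed.

Lemma ftrace_left m : sym_rint cop m -> left_module_trace g (ftrace (phi := Ltw alpha) m).
Proof.
move=> ms; have mC := twisted_comm_left ms.
split; [exact: ftrace_linear | exact: ftrace_cyclic | move=> P V f Pp fh].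
have dP i := dual_system_of_projective i Pp.
transitivity (\sum_i \sum_k dual_trace (m (hdeg k * hdeg i)%g)
    (hact (htensor (V k) (P i))) (f (k, i) (k, i))).
  by rewrite exchange_big pair_bigA; apply: eq_bigr => -[].
apply: eq_bigr => i _; rewrite /lptrace dual_trace_sum; apply: eq_bigr => k _.
rewrite lptrace1E.
have fl a t : f (k, i) (k, i) (hact (htensor (V k) (P i)) a t) =
    hact (htensor (V k) (P i)) (Ltw alpha _ a) (f (k, i) (k, i) t).
  exact: (@hhom_diag K G H (otensor V P) (Ltw alpha) f (k, i) a t fh).
rewrite (dual_trace_flip (dP i) (@mC _) fl).
have e2 : gmul cop (gmul cop (hdeg i) (hdeg k)) (hdeg k)^-1%g = hdeg i by rewrite /= mulKg.
apply: (tact_trace (hact_alg (V k)) e2 (mulgV (hdeg k)) ms (hact_alg (P i)) (dP i) (@mC _)).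
set h := f (k, i) (k, i) in fl *.
have E u : (tflip (V k) (P i) \o h \o tflip (P i) (V k))%VF u = tflip _ _ (h (tflip _ _ u)).
  by rewrite !comp_lfunE.
by move=> a t; rewrite !E htensor_cop_inv fl (htensor_cop g).
Qed.

(** The module trace property, used only for two regular modules, gives the
    hypothesis of [sym_rint_of_traces]. *)
Lemma trform_right t : right_module_trace g (nu := alpha) t -> sym_rint std (trform t).
Proof.
move=> [tl tc tm]; have mC := trform_twisted_comm tl tc.
apply: (@sym_rint_of_traces K G H std alpha) => [|x a b|x y z e f]; first exact: gl_alg.
  by rewrite mC [aefun _ _ _](RmapE g).
case: z / e f => f fl pl.
pose P := oregular H x; pose V := oregular H y.
have Pp : projective P := @oregular_projective K G H x.
have PVp : projective (otensor P V).
  by apply: projective_of_dual_system => -[[] []]; apply: htensor_dual_system_r;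
    exact: dual_system_exists (dual_system_reg _).
pose h : hmap (otensor P V) (otwist (Rtw alpha) (otensor P V)) := fun _ _ => f.
pose V1 := hregular H y; pose P1 := hregular H x.
have fl' a u : f (hact (htensor P1 V1) a u) = hact (htensor P1 V1) (Rtw alpha _ a) (f u).
  by rewrite htensor_act [aefun _ _ _](RmapE g); exact: fl.
have hh : hhom h.
  by move=> [[] []] [[] []]; split=> // e a v; rewrite otwistE cast_id; exact: fl'.
have rE : @rptrace K G H g P (otwist (Rtw alpha) P) V h =
    fun _ _ => ptr (lmul (H y) (g y)) f.
  apply: hmap_ext => i j; rewrite /rptrace (bigD1 tt) //= big1 ?addr0 => [|[] //].
  exact: (rptrace1E (V := hregular H y)).
have rh : hhom (@rptrace K G H g P (otwist (Rtw alpha) P) V h).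
  rewrite rE => -[] []; split=> // e a v; rewrite otwistE cast_id [aefun _ _ _](RmapE g) /=.
  by rewrite !lmulE.
have := tm P V h Pp hh; rewrite (tr_ftrace tl tc PVp hh) (tr_ftrace tl tc Pp rh).
rewrite /ftrace (bigD1 (tt, tt)) //= big1 ?addr0 => [|[[] []] //].
rewrite (bigD1 tt) //= big1 ?addr0 => [|[] //].
rewrite rE => E.
transitivity (dual_trace (trform t (x * y)%g) (hact (htensor P1 V1)) f); last exact: E.
by rewrite htensor_act.
Qed.

(** As in [trform_right], with the test map conjugated by the exchange of the two
    factors. *)
Lemma trform_left t : left_module_trace g (nu := alpha) t -> sym_rint cop (trform t).
Proof.
move=> [tl tc tm]; have mC := trform_twisted_comm tl tc.
apply: (@sym_rint_of_traces K G H cop alpha) => [|x a b|x y z e f]; first exact: gl_alg.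
  by rewrite mC [aefun _ _ _](LmapE g).
case: z / e f => f fl pl.
pose P := oregular H x; pose V := oregular H y.
have Pp : projective P := @oregular_projective K G H x.
have dr : has_dual_system (lmul (H x)) by exact: dual_system_exists (dual_system_reg _).
have PVp : projective (otensor V P).
  by apply: projective_of_dual_system => -[[] []]; exact: htensor_dual_system_l.
pose V1 := hregular H y; pose P1 := hregular H x.
pose f' : 'End(tensor (H y) (H x)) := (tflip (H x) (H y) \o f \o tflip (H y) (H x))%VF.
have f'E u : f' u = tflip _ _ (f (tflip _ _ u)) by rewrite !comp_lfunE.
have ff : (tflip (H y) (H x) \o f' \o tflip (H x) (H y))%VF = f.
  by apply/lfunP => t'; rewrite !comp_lfunE !tflipK.
pose h : hmap (otensor V P) (otwist (Ltw alpha) (otensor V P)) := fun _ _ => f'.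
have fl' a u : f' (hact (htensor V1 P1) a u) = hact (htensor V1 P1) (Ltw alpha _ a) (f' u).
  rewrite !f'E (@htensor_cop K G H g y x V1 P1 a u) fl [aefun _ _ _](LmapE g).
  exact: (@htensor_cop_inv y x V1 P1).
have hh : hhom h.
  by move=> [[] []] [[] []]; split=> // e a v; rewrite otwistE cast_id; exact: fl'.
have rE : @lptrace K G H g P (otwist (Ltw alpha) P) V h =
    fun _ _ => ptr (lmul (H y) (pivV g y)) f.
  apply: hmap_ext => i j; rewrite /lptrace (bigD1 tt) //= big1 ?addr0 => [|[] //].
  rewrite -ff; exact: (lptrace1E (V := V1)).
have rh : hhom (@lptrace K G H g P (otwist (Ltw alpha) P) V h).
  rewrite rE => -[] []; split=> // e a v; rewrite otwistE cast_id [aefun _ _ _](LmapE g) /=.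
  by rewrite !lmulE.
have := tm P V h Pp hh; rewrite (tr_ftrace tl tc PVp hh) (tr_ftrace tl tc Pp rh).
rewrite /ftrace (bigD1 (tt, tt)) //= big1 ?addr0 => [|[[] []] //].
rewrite (bigD1 tt) //= big1 ?addr0 => [|[] //].
rewrite rE (dual_trace_flip (V := V1) (W := P1) dr (@mC _) fl') => <-.
by rewrite ff.
Qed.

End WithModulus.
End ModuleTraces.

Theorem theorem5p6 (K : fieldType) (G : groupType) (H : hopfGcoalg K G)
    (g : pivot H) (alpha : grouplike H) (alpha_modulus : is_modulus alpha) :
  [/\ tr_iso (right_module_trace g (nu := alpha)) (sym_right_integral g),
      int_one_dimensional (sym_right_integral g),
      tr_one_dimensional (right_module_trace g (nu := alpha)),
      (forall t : trfamily (Rtw alpha), right_module_trace g t ->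
         ~ tr_eq t (tr_zero (Rtw alpha)) -> tr_nondegenerate t) &
      tr_iso (left_module_trace g (nu := alpha)) (sym_left_integral g)].
Proof.
have [c [c_neq0 c_left c_mod]] := alpha_modulus.
pose m0 : gfunctional H := sym0 (Q := std g) c_neq0 c_left.
have m0S : sym_rint (std g) m0 by exact: sym0_sym.
have m01 : m0 1%g (pivV g 1%g ** c) = (1 : K) by exact: (sym0_neq0 (Q := std g)).
have mu m : sym_rint (std g) m -> exists k : K, forall x, m x = k *: m0 x.
  exact: (sym_unique (Q := std g)).
have t0R := ftrace_right c_neq0 c_left c_mod m0S.
have mC := twisted_comm_right c_neq0 c_left c_mod m0S.
split.
- apply: tr_iso_ftrace => [m /sym_rightP|m /sym_rightP|t [tl tc _]|t tR] //.
  + exact: twisted_comm_right c_neq0 c_left c_mod m.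
  + exact: ftrace_right c_neq0 c_left c_mod m.
  + by apply/sym_rightP; exact: trform_right.
- exists m0; split=> [|z|m /sym_rightP/mu//]; first exact/sym_rightP.
  by move: m01; rewrite z zero_lfunE => /esym/eqP; rewrite oner_eq0.
- exists (ftrace m0); split=> // [z|t tR].
    have := z _ _ (@oregular_projective K G H 1%g) (twmap_hhom (pivV g 1%g ** c)).
    by rewrite ftrace_twmap // m01 => /eqP; rewrite oner_eq0.
  have [tl tc _] := tR; have [k tk] := mu _ (trform_right tR).
  exists k => P f Pp fh; rewrite (tr_ftrace tl tc Pp fh) /tr_lincomb /tr_zero.
  have -> : trform t = (fun x => k *: m0 x + 0).
    by apply: functional_extensionality_dep => x; rewrite tk addr0.
  rewrite ftrace_lin_form; congr (_ + _); rewrite /ftrace big1 // => i _.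
  by rewrite /dual_trace big1 // => j _; rewrite zero_lfunE.
- move=> t tR t0; have [tl tc _] := tR; have mS := trform_right tR.
  apply: tr_nondegenerate_eq (tr_ftrace tl tc) _.
  apply: ftrace_nondeg => [|x a a0]; first exact: trform_twisted_comm.
  apply: (@sym_nondeg K G H (std g) c c_neq0 c_left (trform t) mS _ x a a0).
  have [k tk] := mu _ mS.
  have k0 : k != 0.
    apply/eqP => k0; apply: t0 => P f Pp fh; rewrite (tr_ftrace tl tc Pp fh) /tr_zero.
    rewrite /ftrace big1 // => i _; rewrite /dual_trace big1 // => j _.
    by rewrite tk k0 scale0r zero_lfunE.
  exists 1%g; rewrite tk; apply/eqP => /lfunP/(_ (pivV g 1%g ** c)).
  rewrite scale_lfunE m01 zero_lfunE /GRing.scale /= mulr1 => /eqP.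
  by rewrite (negPf k0).
- apply: tr_iso_ftrace => [m /sym_leftP|m /sym_leftP|t [tl tc _]|t tR] //.
  + exact: twisted_comm_left c_neq0 c_left c_mod m.
  + exact: ftrace_left c_neq0 c_left c_mod m.
  + by apply/sym_leftP; exact: trform_left.
Qed.
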